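(* Let $\omega_1=(-1,-\tfrac12)\times(-\tfrac12,\tfrac12)$, $\omega_2=(-\tfrac12,\tfrac12)\times(-\tfrac12,\tfrac12)$, $\omega_3=(\tfrac12,1)\times(-\tfrac12,\tfrac12)$, and let $\Omega=(-1,1)\times(-\tfrac12,\tfrac12)$. There is a constant $c>2$ with the following property. Let $f_1,f_2,f_3\in\mathbb{R}$ satisfy $f_2=\frac{f_1+f_3}{2}$ and $|f_2-f_1|<c$. Let $\xi,\eta\in\mathbb{R}^2$ be arbitrary and let $A_1,A_2,A_3\in\mathbb{R}^{2\times2}$ be the matrices with $$A_1e_2=A_2e_2=A_3e_2=\xi,\quad A_2e_1=\eta,\quad 2A_2e_1-2A_1e_1=(f_2-f_1)J\xi,\quad 2A_3e_1-2A_2e_1=(f_3-f_2)J\xi .$$ Let $u_0:\Omega\to\mathbb{R}^2$ be a continuous, piecewise affine map with $\nabla u_0=A_i$ on $\omega_i$ for $i=1,2,3$, and let $g:=\sum_{i=1}^3\det A_i\,\chi_{\omega_i}$. Then $u_0$ is the global minimizer of the Dirichlet energy $\mathbb{D}(u)=\int_\Omega|\nabla u|^2\,dx$ in the class $$\mathcal{A}_g=\{u\in H^1_{u_0}(\Omega;\mathbb{R}^2):\ \det\nabla u=g\ \text{a.e. in }\Omega\}.$$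
   Context: $e_1,e_2$ are the canonical basis vectors of $\mathbb{R}^2$. $J=e_2\otimes e_1-e_1\otimes e_2$ is the $2\times2$ matrix of rotation by $\pi/2$ anticlockwise. $\chi_S$ is the characteristic function of $S$. $H^1_{u_0}(\Omega;\mathbb{R}^2)$ is the set of $u\in H^1(\Omega;\mathbb{R}^2)$ with $u=u_0$ on $\partial\Omega$ in the sense of traces. $|\cdot|$ is the Frobenius norm on matrices. *)

(* Defs.v *)
From HB Require Import structures.
From mathcomp Require Import all_boot all_order all_algebra.
From mathcomp Require Import all_classical all_reals all_analysis.
Set Implicit Arguments.
Unset Strict Implicit.
Unset Printing Implicit Defensive.
Import Order.TTheory GRing.Theory Num.Theory.
Import numFieldNormedType.Exports.
Local Open Scope classical_set_scope.
Local Open Scope ring_scope.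

(* Functions "on D" are total functions whose values outside D are ignored.   *)

Section Plane.
Context {R : realType}.

Notation plane := (R * R)%type.

Notation leb1 := (@lebesgue_measure R).

Notation leb2 := (leb1 \x leb1)%E.

Definition rect (a b c d : R) : set plane := `]a, b[ `*` `]c, d[.

Definition dir (j : 'I_2) : plane := if j == ord0 then (1, 0) else (0, 1).

Definition vec (x : plane) : 'cV[R]_2 :=
  \col_i (if i == ord0 then x.1 else x.2).

Definition partial (j : 'I_2) (f : plane -> R) : plane -> R :=
  fun x => 'D_(dir j) f x.

Definition C1 (f : plane -> R) : Prop :=
  continuous f /\
  forall j, (forall x, derivable f x (dir j)) /\ continuous (partial j f).

(* Compactly supported C^1 test functions; for first-order weak derivatives   *)
(* this is the class used by Gilbarg and Trudinger, and by mollification it   *)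
(* gives the same weak derivatives as compactly supported C^oo ones.          *)
Definition test_function (D : set plane) (phi : plane -> R) : Prop :=
  [/\ C1 phi, compact (closure [set x | phi x != 0]) &
      closure [set x | phi x != 0] `<=` D].

Definition L2_sqnorm (D : set plane) (f : plane -> R) : \bar R :=
  (\int[leb2]_(x in D) ((f x) ^+ 2)%:E)%E.

Definition in_L2 (D : set plane) (f : plane -> R) : Prop :=
  measurable_fun D (f : measurableTypeR R * measurableTypeR R -> R) /\
  (L2_sqnorm D f < +oo)%E.

Definition is_weak_partial (D : set plane) (j : 'I_2) (w v : plane -> R) :
    Prop :=
  in_L2 D v /\
  forall phi, test_function D phi ->
    (\int[leb2]_(x in D) (w x * partial j phi x) =
     - \int[leb2]_(x in D) (v x * phi x))%R.

Definition in_H1 (D : set plane) (w : plane -> R) : Prop :=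
  in_L2 D w /\ forall j, exists v, is_weak_partial D j w v.

(* A chosen representative of the weak partial derivative, which is unique up *)
(* to null sets; the constant 0 if there is none.                             *)
Definition weak_partial (D : set plane) (j : 'I_2) (w : plane -> R) :
    plane -> R :=
  xget (fun _ => 0) [set v | is_weak_partial D j w v].

Definition H1_sqnorm (D : set plane) (w : plane -> R) : \bar R :=
  (L2_sqnorm D w + \sum_(j < 2) L2_sqnorm D (weak_partial D j w))%E.

(* The squared L^2 norm over the boundary of rect a b c d with respect to arc *)
(* length, as the sum over the four sides.                                    *)
Definition bdry_sqnorm (a b c d : R) (h : plane -> R) : \bar R :=
  (\int[leb1]_(y in `[c, d]) ((h (a, y)) ^+ 2)%:E +
   \int[leb1]_(y in `[c, d]) ((h (b, y)) ^+ 2)%:E +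
   \int[leb1]_(x in `[a, b]) ((h (x, c)) ^+ 2)%:E +
   \int[leb1]_(x in `[a, b]) ((h (x, d)) ^+ 2)%:E)%E.

Definition bdry_measurable (a b c d : R) (h : plane -> R) : Prop :=
  [/\ measurable_fun `[c, d] (fun y : measurableTypeR R => h (a, y)),
      measurable_fun `[c, d] (fun y : measurableTypeR R => h (b, y)),
      measurable_fun `[a, b] (fun x : measurableTypeR R => h (x, c)) &
      measurable_fun `[a, b] (fun x : measurableTypeR R => h (x, d))].

(* t is the trace of w on the boundary: the L^2(boundary)-limit of the        *)
(* boundary values of functions that are C^1 up to the boundary and converge  *)
(* to w in H^1.  Only the values of t on the boundary matter.                 *)
Definition has_trace (a b c d : R) (w t : plane -> R) : Prop :=
  [/\ in_H1 (rect a b c d) w, bdry_measurable a b c d t &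
    exists phi : nat -> plane -> R,
      [/\ forall n, C1 (phi n),
          H1_sqnorm (rect a b c d) (fun x => phi n x - w x)
            @[n --> \oo] --> 0%E &
          bdry_sqnorm a b c d (fun x => phi n x - t x)
            @[n --> \oo] --> 0%E]].

Definition component (u : plane -> 'cV[R]_2) (i : 'I_2) : plane -> R :=
  fun x => u x i ord0.

(* The i-th row is the gradient of the i-th component, so that the j-th       *)
(* column (grad D u x *m e_j) is the j-th partial derivative of u.            *)
Definition grad (D : set plane) (u : plane -> 'cV[R]_2) (x : plane) :
    'M[R]_2 :=
  \matrix_(i, j) weak_partial D j (component u i) x.

Definition H1_bdry (a b c d : R) (u0 : plane -> 'cV[R]_2) :
    set (plane -> 'cV[R]_2) :=
  [set u | forall i, in_H1 (rect a b c d) (component u i) /\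
     exists t, has_trace a b c d (component u i) t /\
               has_trace a b c d (component u0 i) t].

Definition frob_sq (M : 'M[R]_2) : R := \sum_i \sum_j (M i j) ^+ 2.

Definition dirichlet (D : set plane) (u : plane -> 'cV[R]_2) : \bar R :=
  (\int[leb2]_(x in D) (frob_sq (grad D u x))%:E)%E.

Definition ae_on (D : set plane) (P : plane -> Prop) : Prop :=
  {ae leb2, forall x, D x -> P x}.

Definition affine_on (D : set plane) (A : 'M[R]_2) (u : plane -> 'cV[R]_2) :
    Prop :=
  exists b : 'cV[R]_2, forall x, D x -> u x = A *m vec x + b.

Definition e1 : 'cV[R]_2 := delta_mx ord0 ord0.

Definition e2 : 'cV[R]_2 := delta_mx ord_max ord0.

Definition J : 'M[R]_2 := e2 *m e1^T - e1 *m e2^T.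

Definition Omega : set plane := rect (-1) 1 (- 2^-1) 2^-1.

Definition omega1 : set plane := rect (-1) (- 2^-1) (- 2^-1) 2^-1.

Definition omega2 : set plane := rect (- 2^-1) 2^-1 (- 2^-1) 2^-1.

Definition omega3 : set plane := rect 2^-1 1 (- 2^-1) 2^-1.

Definition admissible (u0 : plane -> 'cV[R]_2) (g : plane -> R) :
    set (plane -> 'cV[R]_2) :=
  H1_bdry (-1) 1 (- 2^-1) 2^-1 u0 `&`
  [set u | ae_on Omega (fun x => \det (grad Omega u x) = g x)].

(* "The" global minimizer: members of the class are identified when they      *)
(* agree almost everywhere.                                                   *)
Definition is_the_global_minimizer (C : set (plane -> 'cV[R]_2))
    (u0 : plane -> 'cV[R]_2) : Prop :=
  [/\ C u0,
      forall u, C u -> (dirichlet Omega u0 <= dirichlet Omega u)%E &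
      forall u, C u -> dirichlet Omega u = dirichlet Omega u0 ->
        ae_on Omega (fun x => u x = u0 x)].

End Plane.

(* Main.v *)
Require Import Defs.
From HB Require Import structures.
From mathcomp Require Import all_boot all_order all_algebra.
From mathcomp Require Import all_classical all_reals all_analysis.
From mathcomp Require Import measurable_realfun ring lra.
Set Implicit Arguments.
Unset Strict Implicit.
Unset Printing Implicit Defensive.
Import Order.TTheory GRing.Theory Num.Theory.
Import numFieldNormedType.Exports.
Local Open Scope classical_set_scope.
Local Open Scope ring_scope.

(** Let u be a competitor and phi = u - u0, which has zero trace. On the strip
    omega_i the constraint det (A_i + D phi) = det A_i says that
    det D phi = - cof A_i : D phi, so that for every real number m_i
      |D u|^2 - |A_i|^2
        = |D phi|^2 + m_i det D phi + (2 A_i + m_i cof A_i) : D phi.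
    Put d = f2 - f1 = f3 - f2 and m_i = d s_i with s = (- 1, 0, 1). The jump
    conditions say precisely that the first column of 2 A_i + m_i cof A_i is
    the same on the three strips; the second column is constant on each of
    them. The integral of the last term is therefore zero: D phi has mean
    zero ([zero_trace_grad]), and the y-derivative of phi even has mean zero on
    every vertical strip ([zero_trace_strip]).

    It remains to absorb the determinant. Write m_i = d x + d (s_i - x), where
    |s_i - x| <= 1/2 on omega_i. The second part costs at most
    |d| |D phi|^2 / 4, because |det M| <= |M|^2 / 2. For the affine weight the
    determinant is a null Lagrangian, and the integral of d x det D phi is minus
    that of d phi_1 d_y phi_2 ([zero_trace_jacobian]). This is estimated by
    Young's inequality and by the Poincare inequality
      int phi_1^2 <= (2/9) int (d_y phi_1)^2        ([Poincare]).
    Together the two parts cost less than 0.486 |d| int |D phi|^2, so for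
    |d| < c = 41/20 at least int |D phi|^2 / 1000 is left
    ([pointwise_gap], [integrated_gap]). This gives minimality; and
    if the energies are equal, then D phi = 0, hence phi = 0 by the Poincare
    inequality.

    The traces are limits of boundary values of continuously differentiable
    functions, and the condition on phi is used only in the form [zero_trace]:
    phi is a limit of functions f_n whose boundary values tend to zero in the
    mean square ([same_trace_zero]). Identities for f_n contain boundary terms
    that vanish in the limit, and the bilinear ones pass to the limit one
    factor at a time ([weak_cvg]). The null Lagrangian identity for f_n is
    [null_lagrangian]; it needs no second derivatives. Weak derivatives are
    unique by [fundamental_lemma], so the chosen representatives in the
    definitions may be replaced by any others. Finally u0 is itself in the
    class, since each component is an affine function plus multiples of
    |x + 1/2| and |x - 1/2| ([kinked_form]), for which [kinked_trace] provides
    continuously differentiable approximations. *)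


(** * Square-integrable functions *)

Section L2.
Context d (T : measurableType d) (R : realType).
Context (mu : {measure set T -> \bar R}) (D : set T).
Context (mD : measurable D) (Dfin : (mu D < +oo)%E).
Implicit Types f g h : T -> R.

Definition itg f := mu.-integrable D (EFin \o f).

(** For the planar Lebesgue measure this unfolds to [in_L2]. *)
Definition sqitg f :=
  measurable_fun D f /\ (\int[mu]_(x in D) ((f x) ^+ 2)%:E < +oo)%E.

Lemma itg_measurable f : itg f -> measurable_fun D f.
Proof. by move=> /measurable_int/measurable_EFinP. Qed.

Lemma itgD f g : itg f -> itg g -> itg (fun x => f x + g x).
Proof. by move=> If Ig; exact: (integrableD mD If Ig). Qed.

Lemma itgB f g : itg f -> itg g -> itg (fun x => f x - g x).
Proof. by move=> If Ig; exact: (integrableB mD If Ig). Qed.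

Lemma itgZ (c : R) f : itg f -> itg (fun x => c * f x).
Proof. by move=> If; exact: (integrableZl mD c If). Qed.

Lemma itg_le f g : measurable_fun D f -> itg g ->
  (forall x, D x -> `|f x| <= g x) -> itg f.
Proof.
move=> mf Ig fg; apply: (le_integrable mD _ _ Ig).
  exact/measurable_EFinP.
by move=> x Dx /=; rewrite lee_fin (le_trans (fg _ Dx))// ler_norm.
Qed.

Lemma itg_cst (c : R) : itg (fun=> c).
Proof.
apply: measurable_bounded_integrable => //.
by exists `|c|; split => // M cM x Dx; exact: ltW.
Qed.

Lemma itg_bounded f (M : R) : measurable_fun D f -> (forall x, D x -> `|f x| <= M) ->
  itg f.
Proof. by move=> mf fM; apply: (itg_le mf (itg_cst M)). Qed.

Lemma eq_itg f g : (forall x, D x -> f x = g x) -> itg f -> itg g.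
Proof.
move=> fg; apply: eq_integrable => // x; rewrite inE => Dx /=.
by rewrite fg.
Qed.

Lemma sqitg_itg2 f : sqitg f -> itg (fun x => (f x) ^+ 2).
Proof.
move=> [mf f2]; apply/integrableP; split.
  by apply/measurable_EFinP; exact: measurable_funX.
under eq_integral => x _ do rewrite /= ger0_norm ?sqr_ge0//.
by [].
Qed.

Lemma itg2_sqitg f : measurable_fun D f -> itg (fun x => (f x) ^+ 2) -> sqitg f.
Proof.
move=> mf /integrableP[_]; under eq_integral => x _.
  rewrite /= ger0_norm ?sqr_ge0//; over.
by split.
Qed.

Lemma sqitgM f g : sqitg f -> sqitg g -> itg (fun x => f x * g x).
Proof.
move=> Lf Lg; have [mf _] := Lf; have [mg _] := Lg.
apply: (itg_le _ (itgD (sqitg_itg2 Lf) (sqitg_itg2 Lg))).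
  exact: measurable_funM.
move=> x _; rewrite ler_norml; apply/andP; split; nra.
Qed.

Lemma sqitg_bounded f (M : R) : measurable_fun D f ->
  (forall x, D x -> `|f x| <= M) -> sqitg f.
Proof.
move=> mf fM; apply: itg2_sqitg => //; apply: (@itg_bounded _ (M ^+ 2)).
  exact: measurable_funX.
move=> x Dx; rewrite normrX lerXn2r ?nnegrE ?fM//.
exact: le_trans (fM x Dx).
Qed.

Lemma sqitg_cst (c : R) : sqitg (fun=> c).
Proof. by apply: (@sqitg_bounded _ `|c|). Qed.

Lemma sqitg_itg f : sqitg f -> itg f.
Proof.
by move=> /sqitgM /(_ (sqitg_cst 1)); apply: eq_itg => x _; rewrite mulr1.
Qed.

Lemma sqitgD f g : sqitg f -> sqitg g -> sqitg (fun x => f x + g x).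
Proof.
move=> Lf Lg; have [mf _] := Lf; have [mg _] := Lg.
apply: itg2_sqitg; first exact: measurable_funD.
apply: (@eq_itg (fun x => ((f x) ^+ 2 + (g x) ^+ 2) + 2 * (f x * g x))).
  by move=> x _; ring.
by apply: itgD; [apply: itgD; exact: sqitg_itg2|apply: itgZ; exact: sqitgM].
Qed.

Lemma sqitgMb f (k : T -> R) (M : R) : sqitg f -> measurable_fun D k ->
  (forall x, D x -> `|k x| <= M) -> sqitg (fun x => k x * f x).
Proof.
move=> Lf mk kM; have [mf _] := Lf.
apply: itg2_sqitg; first exact: measurable_funM.
apply: (itg_le _ (itgZ (M ^+ 2) (sqitg_itg2 Lf))).
  by apply: measurable_funX; exact: measurable_funM.
move=> x Dx; rewrite normrX normrM exprMn real_normK ?num_real//.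
rewrite -[X in _ <= _ * X]real_normK ?num_real// ler_wpM2r ?sqr_ge0//.
by rewrite -(real_normK (num_real (k x))) lerXn2r ?nnegrE ?kM//
  (le_trans _ (kM x Dx)).
Qed.

Lemma sqitgZ (c : R) f : sqitg f -> sqitg (fun x => c * f x).
Proof. by move=> Lf; apply: (@sqitgMb _ (fun=> c) `|c| Lf). Qed.

Lemma sqitgB f g : sqitg f -> sqitg g -> sqitg (fun x => f x - g x).
Proof.
move=> Lf /(sqitgZ (-1)) Lg; have := sqitgD Lf Lg.
by under eq_fun do rewrite mulN1r.
Qed.

Lemma eq_sqitg f g : (forall x, D x -> f x = g x) -> sqitg f -> sqitg g.
Proof.
move=> fg [mf f2]; split.
  by apply: eq_measurable_fun mf => x; rewrite inE => /fg.
rewrite (@eq_integral _ _ _ _ _ (fun x => ((f x) ^+ 2)%:E))// => x.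
by rewrite inE => /fg ->.
Qed.

(** The elementary substitute for the Cauchy-Schwarz inequality: the weight
    c is chosen afterwards, large enough to absorb the fixed factor g. *)
Lemma Rint_mul_le f g (c : R) : 0 < c -> sqitg f -> sqitg g ->
  2 * `|\int[mu]_(x in D) (f x * g x)| <=
    c * \int[mu]_(x in D) ((f x) ^+ 2) + c^-1 * \int[mu]_(x in D) ((g x) ^+ 2).
Proof.
move=> c0 Lf Lg.
have If := sqitg_itg2 Lf; have Ig := sqitg_itg2 Lg.
have Ifg := sqitgM Lf Lg.
have E x : 0 <= c * (f x + c^-1 * g x) ^+ 2 /\ 0 <= c * (f x - c^-1 * g x) ^+ 2.
  by split; rewrite mulr_ge0 ?sqr_ge0 ?ltW.
have cV : c * c^-1 = 1 by rewrite divff ?gt_eqF.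
rewrite -!RintegralZl// -RintegralD//; [|exact: itgZ..].
rewrite -[2 in X in X <= _]ger0_norm// -normrM -RintegralZl//.
apply: le_trans (le_normr_Rintegral _ _) _ => //; first exact: itgZ.
apply: le_Rintegral => //.
- by have := integrable_norm (itgZ 2 Ifg).
- by apply: itgD; exact: itgZ.
move=> x _; have [] := E x.
rewrite ler_norml => H1 H2; apply/andP.
have -> : c * f x ^+ 2 + c^-1 * g x ^+ 2 =
  c * (f x + c^-1 * g x) ^+ 2 - 2 * (f x * g x).
  rewrite sqrrD; transitivity
   (c * f x ^+ 2 + (c * c^-1) * 2 * (f x * g x) + (c * c^-1) * (c^-1 * g x ^+ 2)
    - 2 * (f x * g x)); last by ring.
  rewrite cV; ring.
have E2 : c * (f x - c^-1 * g x) ^+ 2 = c * (f x + c^-1 * g x) ^+ 2 -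
  4 * (f x * g x).
  transitivity (c * (f x + c^-1 * g x) ^+ 2 - (c * c^-1) * 4 * (f x * g x)).
    by ring.
  by rewrite cV; ring.
by split; lra.
Qed.

(** Norm convergence implies weak convergence. *)
Lemma weak_cvg (f_ : nat -> T -> R) f g :
  (forall n, sqitg (f_ n)) -> sqitg f -> sqitg g ->
  \int[mu]_(x in D) ((f_ n x - f x) ^+ 2) @[n --> \oo] --> 0 ->
  \int[mu]_(x in D) (f_ n x * g x) @[n --> \oo] --> \int[mu]_(x in D) (f x * g x).
Proof.
move=> Lf_ Lf Lg f_f; apply/cvgrPdist_le => /= e e0.
set G := \int[mu]_(x in D) ((g x) ^+ 2).
have G0 : 0 <= G by apply: Rintegral_ge0 => x _; exact: sqr_ge0.
pose c := (G + 1) / e.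
have c0 : 0 < c by rewrite divr_gt0// ltr_wpDl.
have cG : c^-1 * G <= e.
  rewrite /c invf_div mulrAC ler_pdivrMr ?ltr_wpDl//.
  by apply: ler_wpM2l; [exact: ltW|rewrite lerDl].
have ec : 0 < e / c by rewrite divr_gt0.
move/cvgrPdist_le : f_f => /(_ _ ec); apply: filterS => n.
rewrite sub0r normrN ger0_norm; last first.
  by apply: Rintegral_ge0 => x _; exact: sqr_ge0.
rewrite ler_pdivlMr// mulrC => ne.
rewrite distrC -RintegralB//; [|exact: sqitgM..].
have := Rint_mul_le c0 (sqitgB (Lf_ n) Lf) Lg.
under eq_Rintegral do rewrite mulrBl.
by move=> /le_trans/(_ (lerD ne cG)) H; lra.
Qed.

Lemma Rint_sq_eq0 f : sqitg f -> \int[mu]_(x in D) ((f x) ^+ 2) <= 0 ->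
  {ae mu, forall x, D x -> f x = 0}.
Proof.
move=> Lf f0; have mf := Lf.1.
have If := sqitg_itg2 Lf.
have : (\int[mu]_(x in D) `|(f x ^+ 2)%:E| = 0)%E.
  transitivity (\int[mu]_(x in D) (f x ^+ 2)%:E)%E.
    by apply: eq_integral => x _; rewrite gee0_abs ?lee_fin ?sqr_ge0.
  rewrite -[LHS]fineK ?(integrable_fin_num mD If)//; congr EFin.
  by apply/eqP; rewrite eq_le f0 fine_ge0// integral_ge0// => x _;
    rewrite lee_fin sqr_ge0.
move/(ae_eq_integral_abs mu mD); rewrite -/(EFin \o _) => h.
have : measurable_fun D (EFin \o (fun x => f x ^+ 2)).
  by apply/measurable_EFinP; exact: measurable_funX.
move/h; apply: filterS => x /[apply] -[] /eqP.
by rewrite sqrf_eq0 => /eqP.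
Qed.

(** Bounded pointwise convergence implies convergence in the mean square. *)
Lemma bounded_cvg_sq (f_ : nat -> T -> R) f (M : R) :
  (forall n, measurable_fun D (f_ n)) -> measurable_fun D f ->
  (forall n x, D x -> `|f_ n x| <= M) ->
  (forall x, D x -> f_ n x @[n --> \oo] --> f x) ->
  \int[mu]_(x in D) ((f_ n x - f x) ^+ 2) @[n --> \oo] --> 0.
Proof.
move=> mf_ mf f_M f_f.
have fM x : D x -> `|f x| <= M.
  move=> Dx; have /cvg_norm h := f_f x Dx.
  rewrite -(cvg_lim _ h)//; apply: limr_le; first by apply/cvg_ex; exists `|f x|.
  by apply: nearW => n; exact: f_M.
have b n x : D x -> `|(f_ n x - f x) ^+ 2| <= (2 * M) ^+ 2.
  move=> Dx; rewrite normrX lerXn2r ?nnegrE//.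
    by rewrite mulr_ge0// (le_trans _ (fM x Dx)).
  by rewrite (le_trans (ler_normB _ _))// mulr_natl mulr2n lerD ?f_M ?fM.
have := @dominated_convergence _ _ _ mu D mD
  (fun n x => ((f_ n x - f x) ^+ 2)%:E) (fun=> 0%E) (fun=> ((2 * M) ^+ 2)%:E).
case.
- move=> n; apply/measurable_EFinP; apply: measurable_funX.
  exact: measurable_funB.
- exact: measurable_cst.
- apply: aeW => x Dx; apply: cvg_EFin; first exact: nearW.
  rewrite (_ : 0 = (f x - f x) ^+ 2); last by rewrite subrr expr0n.
  by under [X in X @ _]eq_fun do rewrite expr2; rewrite expr2;
     apply: cvgM; (apply: cvgB; [exact: f_f|exact: cvg_cst]).
- exact: itg_cst.
- by apply: aeW => x n Dx; rewrite lee_fin b.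
move=> _ _; rewrite integral0 => h.
by apply: (@fine_cvg _ _ _ _ (fun n =>
  (\int[mu]_(x in D) ((f_ n x - f x) ^+ 2)%:E)%E)); exact: h.
Qed.

Lemma bounded_cvg (f_ : nat -> T -> R) f (M : R) :
  (forall n, measurable_fun D (f_ n)) -> measurable_fun D f ->
  (forall n x, D x -> `|f_ n x| <= M) ->
  (forall x, D x -> f_ n x @[n --> \oo] --> f x) ->
  \int[mu]_(x in D) (f_ n x) @[n --> \oo] --> \int[mu]_(x in D) (f x).
Proof.
move=> mf_ mf f_M f_f; have c := bounded_cvg_sq mf_ mf f_M f_f.
have fM x : D x -> `|f x| <= M.
  move=> Dx; have /cvg_norm h := f_f x Dx.
  rewrite -(cvg_lim _ h)//; apply: limr_le; first by apply/cvg_ex; exists `|f x|.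
  by apply: nearW => n; exact: f_M.
have := @weak_cvg f_ f (fun=> 1).
have -> : (fun n => \int[mu]_(x in D) (f_ n x * 1)) =
          (fun n => \int[mu]_(x in D) (f_ n x)).
  by apply/funext => n; under eq_Rintegral do rewrite mulr1.
have -> : \int[mu]_(x in D) (f x * 1) = \int[mu]_(x in D) (f x).
  by under eq_Rintegral do rewrite mulr1.
apply => //.
- by move=> n; apply: (@sqitg_bounded _ M) => // x; exact: f_M.
- by apply: (@sqitg_bounded _ M).
- exact: sqitg_cst.
Qed.

End L2.

(** * Calculus on rectangles *)

Section Plane.
Context {R : realType}.
Notation plane := (R * R)%type.
Notation mplane := (measurableTypeR R * measurableTypeR R)%type.
Notation leb1 := (@lebesgue_measure R).
Notation leb2 := (leb1 \x leb1)%E.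

Lemma rect_measurable (a b c d : R) : measurable (rect a b c d : set mplane).
Proof. by apply: measurableX; exact: measurable_itv. Qed.

(** The plane carries the product of the Borel sigma-algebras: an open set
    belongs to it as a countable union of rectangles with rational corners. *)
Lemma open_measurable2 (U : set plane) : open U -> measurable (U : set mplane).
Proof.
move=> oU.
pose V (q : (rat * rat) * (rat * rat)) : set plane :=
  rect (ratr q.1.1) (ratr q.1.2) (ratr q.2.1) (ratr q.2.2).
have -> : U = \bigcup_q (V q `&` [set _ | V q `<=` U]).
  apply/seteqP; split => [[x y] Uxy|p [q _] [Vp /= VU]]; last exact: VU.
  have /nbhs_ballP[e /= e0 eU] : nbhs (x, y) U by exact: open_nbhs_nbhs.
  have lt1 z : z - e < z by rewrite ltrBlDr ltrDl.
  have lt2 z : z < z + e by rewrite ltrDl.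
  have [q1 /[!in_itv]/=/andP[q1l q1r]] := rat_in_itvoo (lt1 x).
  have [q2 /[!in_itv]/=/andP[q2l q2r]] := rat_in_itvoo (lt2 x).
  have [q3 /[!in_itv]/=/andP[q3l q3r]] := rat_in_itvoo (lt1 y).
  have [q4 /[!in_itv]/=/andP[q4l q4r]] := rat_in_itvoo (lt2 y).
  exists ((q1, q2), (q3, q4)) => //; split.
    by split => /=; rewrite in_itv/= ?q1r ?q2l ?q3r ?q4l.
  move=> [x' y'] [] /= /[!in_itv]/= /andP[h1 h2] /andP[h3 h4]; apply: eU.
  by split; rewrite /ball/= ltr_norml; apply/andP; split; lra.
apply: countable_bigcupT_measurable.
  by apply: countableP.
move=> q; have [VU|VU] := pselect (V q `<=` U).
  rewrite (_ : [set _ | _] = setT) ?setIT; first exact: rect_measurable.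
  by apply/seteqP; split.
rewrite (_ : [set _ | _] = set0) ?setI0; first exact: measurable0.
by apply/seteqP; split.
Qed.

Lemma continuous_measurable2 (f : plane -> R) (D : set plane) :
  measurable (D : set mplane) -> continuous f ->
  measurable_fun (D : set mplane) (f : mplane -> R).
Proof.
move=> mD /continuousP cf; apply: (measurability _ (RGenOpens.measurableE R)).
move=> _ [_ [a [b ->]] <-]; apply: measurableI => //.
by apply: open_measurable2; apply: cf; exact: interval_open.
Qed.

Lemma rect_fin (a b c d : R) : (leb2 (rect a b c d : set mplane) < +oo)%E.
Proof.
rewrite /rect product_measure1E; [|exact: measurable_itv..].
have h u v : (leb1 `]u, v[%classic < +oo)%E.
  by rewrite lebesgue_measure_itv/= lte_fin; case: ifP => _; rewrite -?EFinB ltry.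
by apply: lte_mul_pinfty; rewrite ?ge0_fin_numE//; exact: h.
Qed.

Lemma itv_fin (a b : R) : (leb1 `[a, b]%classic < +oo)%E.
Proof.
by rewrite lebesgue_measure_itv/= lte_fin; case: ifP => _; rewrite -?EFinB ltry.
Qed.

Lemma rect_bounded (a b c d : R) (f : plane -> R) : continuous f ->
  exists M, forall x y, a <= x <= b -> c <= y <= d -> `|f (x, y)| <= M.
Proof.
move=> cf; have cK : compact (`[a, b]%classic `*` `[c, d]%classic : set plane).
  by apply: compact_setX; exact: segment_compact.
have : compact (f @` (`[a, b]%classic `*` `[c, d]%classic)).
  by apply: continuous_compact => //; exact: continuous_subspaceT.
move/compact_bounded => [M [_ hM]]; exists (M + 1) => x y xab ycd.
apply: (hM (M + 1)); first by rewrite ltrDl.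
by exists (x, y) => //; split; rewrite /= in_itv.
Qed.

Lemma itv_bounded (a b : R) (f : R -> R) : continuous f ->
  exists M, forall x, a <= x <= b -> `|f x| <= M.
Proof.
move=> cf; have : compact (f @` (`[a, b]%classic)).
  apply: continuous_compact; last exact: segment_compact.
  exact: continuous_subspaceT.
move/compact_bounded => [M [_ hM]]; exists (M + 1) => x xab.
by apply: (hM (M + 1)); [rewrite ltrDl|exists x => //; rewrite /= in_itv].
Qed.

Lemma rect_in (a b c d x y : R) :
  rect a b c d (x, y) <-> (a < x < b) /\ (c < y < d).
Proof. by rewrite /rect /=; split => -[]; rewrite /= !in_itv. Qed.

Lemma continuous_sqitg2 (a b c d : R) (f : plane -> R) : continuous f ->
  sqitg leb2 (rect a b c d) (f : mplane -> R).
Proof.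
move=> cf; have [M fM] := rect_bounded a b c d cf.
apply: (@sqitg_bounded _ _ _ _ _ (rect_measurable a b c d) (rect_fin a b c d) _ M).
  by apply: continuous_measurable2 => //; exact: rect_measurable.
move=> [x y] /rect_in[/andP[? ?] /andP[? ?]]; apply: fM; apply/andP; split;
  exact: ltW.
Qed.

Lemma continuous_sqitg1 (a b : R) (f : R -> R) : continuous f ->
  sqitg leb1 `[a, b]%classic (f : measurableTypeR R -> R).
Proof.
move=> cf; have [M fM] := itv_bounded a b cf.
apply: (@sqitg_bounded _ _ _ leb1 _ (measurable_itv _) (itv_fin a b) _ M).
  apply: measurable_funS (measurableT) _ (continuous_measurable_fun cf) => //.
by move=> x /=; rewrite in_itv/=; exact: fM.
Qed.

Lemma continuous_itg2 (a b c d : R) (f : plane -> R) : continuous f ->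
  itg leb2 (rect a b c d) (f : mplane -> R).
Proof.
move=> cf; apply: sqitg_itg; [exact: rect_measurable|exact: rect_fin|].
exact: continuous_sqitg2.
Qed.

Lemma continuous_itg1 (a b : R) (f : R -> R) : continuous f ->
  itg leb1 `[a, b]%classic (f : measurableTypeR R -> R).
Proof.
move=> cf; apply: sqitg_itg; [exact: measurable_itv|exact: itv_fin|].
exact: continuous_sqitg1.
Qed.

Lemma cont_pair1 (y : R) : continuous (fun x : R => (x, y) : plane).
Proof.
by move=> x; apply: (@cvg_pair _ _ _ _ (nbhs x) (nbhs y));
  [exact: cvg_id|exact: cvg_cst].
Qed.

Lemma cont_pair2 (x : R) : continuous (fun y : R => (x, y) : plane).
Proof.
by move=> y; apply: (@cvg_pair _ _ _ _ (nbhs x) (nbhs y));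
  [exact: cvg_cst|exact: cvg_id].
Qed.

Lemma cont_slice1 (f : plane -> R) y : continuous f ->
  continuous (fun x => f (x, y)).
Proof.
by move=> cf x; apply: (continuous_comp (@cont_pair1 y x)); exact: cf.
Qed.

Lemma cont_slice2 (f : plane -> R) x : continuous f ->
  continuous (fun y => f (x, y)).
Proof.
by move=> cf y; apply: (continuous_comp (@cont_pair2 x y)); exact: cf.
Qed.

(** Iterated integrals may be taken over closed intervals, although the
    rectangles themselves are open. *)
Lemma Fubini_rect (a b c d : R) (f : plane -> R) : continuous f ->
  \int[leb2]_(p in rect a b c d) f p =
  \int[leb1]_(x in `[a, b]) \int[leb1]_(y in `[c, d]) f (x, y) /\
  \int[leb2]_(p in rect a b c d) f p =
  \int[leb1]_(y in `[c, d]) \int[leb1]_(x in `[a, b]) f (x, y).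
Proof.
move=> cf.
pose g : mplane -> \bar R := (EFin \o (f : mplane -> R)) \_ (rect a b c d).
have mr := rect_measurable a b c d.
have Ig : leb2.-integrable setT g.
  apply/integrable_restrict => //; rewrite setTI.
  exact: (sqitg_itg mr (rect_fin a b c d) (continuous_sqitg2 _ _ _ _ cf)).
have E : (\int[leb2]_(p in rect a b c d) (f p)%:E = \int[leb2]_p g p)%E.
  by rewrite integral_mkcond.
have m1 (h : R -> R) (u v : R) : continuous h ->
    measurable_fun `]u, v[%classic h.
  by move=> /continuous_measurable_fun; exact: measurable_funS.
have in1 x y : a < x < b -> g (x, y) = ((fun y => (f (x, y))%:E) \_ `]c, d[) y.
  move=> xab; rewrite /g /patch; congr (if _ then _ else _).
  apply/idP/idP; rewrite !inE /= in_itv/=; first by case/rect_in.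
  by move=> ycd; apply/rect_in.
have in2 x y : c < y < d -> g (x, y) = ((fun x => (f (x, y))%:E) \_ `]a, b[) x.
  move=> ycd; rewrite /g /patch; congr (if _ then _ else _).
  apply/idP/idP; rewrite !inE /= in_itv/=; first by case/rect_in.
  by move=> xab; apply/rect_in.
have out x y : ~ (a < x < b) \/ ~ (c < y < d) -> g (x, y) = 0%E.
  move=> h; rewrite /g /patch; case: ifPn => //; rewrite inE => /rect_in[h1 h2].
  by case: h.
have F1 x : (\int[leb1]_y g (x, y) =
    ((fun x => (\int[leb1]_(y in `[c, d]) f (x, y))%:E) \_ `]a, b[) x)%E.
  rewrite [RHS]/patch; case: ifPn; rewrite ?inE ?notin_setE /= in_itv/= => xab.
    under eq_integral do rewrite in1//.
    rewrite -integral_mkcond /=.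
    rewrite -(@integral_itv_bndoo _ _ _ _ true false); last first.
      by apply/measurable_EFinP; apply: m1; exact: cont_slice2.
    rewrite fineK// integrable_fin_num//.
    by apply: continuous_itg1; exact: cont_slice2.
  by apply: integral0_eq => y _; apply: out; left; exact: xab.
have F2 y : (\int[leb1]_x g (x, y) =
    ((fun y => (\int[leb1]_(x in `[a, b]) f (x, y))%:E) \_ `]c, d[) y)%E.
  rewrite [RHS]/patch; case: ifPn; rewrite ?inE ?notin_setE /= in_itv/= => ycd.
    under eq_integral do rewrite in2//.
    rewrite -integral_mkcond /=.
    rewrite -(@integral_itv_bndoo _ _ _ _ true false); last first.
      by apply/measurable_EFinP; apply: m1; exact: cont_slice1.
    rewrite fineK// integrable_fin_num//.
    by apply: continuous_itg1; exact: cont_slice1.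
  by apply: integral0_eq => x _; apply: out; right; exact: ycd.
have F1' := funext F1; have F2' := funext F2.
split.
  rewrite {1}/Rintegral E -integral12_prod_meas1// F1' -integral_mkcond.
  rewrite -(@integral_itv_bndoo _ _ _ _ true false)//.
  have := measurable_fubini_F Ig; rewrite /fubini_F F1'.
  by move=> /(measurable_restrict _ (measurable_itv _) measurableT); rewrite setTI.
rewrite {1}/Rintegral E -integral21_prod_meas1// F2' -integral_mkcond.
rewrite -(@integral_itv_bndoo _ _ _ _ true false)//.
have := measurable_fubini_G Ig; rewrite /fubini_G F2'.
by move=> /(measurable_restrict _ (measurable_itv _) measurableT); rewrite setTI.
Qed.

Lemma FTC (g g' : R -> R) (a b : R) : a < b ->
  (forall x : R, is_derive x 1 g (g' x)) -> continuous g' ->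
  \int[leb1]_(x in `[a, b]) g' x = g b - g a.
Proof.
move=> ab dg cg'.
have cg : continuous g.
  by move=> x; apply/differentiable_continuous/derivable1_diffP; exact: ex_derive.
rewrite /Rintegral (@continuous_FTC2 _ g' g)//.
- exact: continuous_subspaceT.
- split; first by move=> x _; exact: ex_derive.
  + exact/cvg_at_right_filter/cg.
  + exact/cvg_at_left_filter/cg.
- by move=> x _; rewrite derive1E derive_val.
Qed.

Lemma ord2_neq0 (j : 'I_2) : j != ord0 -> j = ord_max.
Proof. by move=> j0; apply/val_inj; case: j j0 => -[|[]]. Qed.

Lemma dir_max : dir ord_max = (0, 1) :> plane.
Proof. by []. Qed.

Lemma partial_slice1 (f : plane -> R) (x y : R) : derivable f (x, y) (dir ord0) ->
  is_derive x 1 (fun t => f (t, y)) (partial ord0 f (x, y)).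
Proof.
rewrite /partial /dir eqxx.
have E : (fun h : R => h^-1 *: ((f \o shift (x, y)) (h *: (1, 0)) - f (x, y))) =
  (fun h : R => h^-1 *: (((fun t => f (t, y)) \o shift x) (h *: 1) - f (x, y))).
  apply/funext => h /=; congr (_ *: (f _ - _)).
  by rewrite /shift/=; congr (_, _); rewrite /= scaler0 add0r.
rewrite /derivable /derive E => dE.
by constructor => //; rewrite /derive.
Qed.

Lemma partial_slice2 (f : plane -> R) (x y : R) : derivable f (x, y) (dir ord_max) ->
  is_derive y 1 (fun t => f (x, t)) (partial ord_max f (x, y)).
Proof.
rewrite /partial dir_max.
have E : (fun h : R => h^-1 *: ((f \o shift (x, y)) (h *: (0, 1)) - f (x, y))) =
  (fun h : R => h^-1 *: (((fun t => f (x, t)) \o shift y) (h *: 1) - f (x, y))).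
  apply/funext => h /=; congr (_ *: (f _ - _)).
  by rewrite /shift/=; congr (_, _); rewrite /= scaler0 add0r.
rewrite /derivable /derive E => dE.
by constructor => //; rewrite /derive.
Qed.

Lemma C1_continuous (f : plane -> R) : C1 f -> continuous f.
Proof. by case. Qed.

Lemma C1_continuous_partial (f : plane -> R) j : C1 f -> continuous (partial j f).
Proof. by case=> _ /(_ j)[]. Qed.

Lemma C1_derivable (f : plane -> R) j x : C1 f -> derivable f x (dir j).
Proof. by case=> _ /(_ j)[]. Qed.

Lemma C1_slice1 (f : plane -> R) (x y : R) : C1 f ->
  is_derive x 1 (fun t => f (t, y)) (partial ord0 f (x, y)).
Proof. by move=> f1; apply: partial_slice1; exact: C1_derivable. Qed.

Lemma C1_slice2 (f : plane -> R) (x y : R) : C1 f ->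
  is_derive y 1 (fun t => f (x, t)) (partial ord_max f (x, y)).
Proof. by move=> f1; apply: partial_slice2; exact: C1_derivable. Qed.

Lemma int_partial1 (a b c d : R) (f : plane -> R) : a < b -> C1 f ->
  \int[leb2]_(p in rect a b c d) partial ord0 f p =
  \int[leb1]_(y in `[c, d]) (f (b, y) - f (a, y)).
Proof.
move=> ab f1; have [_ ->] := Fubini_rect a b c d (@C1_continuous_partial f ord0 f1).
apply: eq_Rintegral => y _.
apply: (@FTC (fun t => f (t, y)) (fun t => partial ord0 f (t, y))) => //.
  by move=> x; exact: C1_slice1.
by apply: cont_slice1; exact: C1_continuous_partial.
Qed.

Lemma int_partial2 (a b c d : R) (f : plane -> R) : c < d -> C1 f ->
  \int[leb2]_(p in rect a b c d) partial ord_max f p =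
  \int[leb1]_(x in `[a, b]) (f (x, d) - f (x, c)).
Proof.
move=> cd f1; have [-> _] := Fubini_rect a b c d (@C1_continuous_partial f ord_max f1).
apply: eq_Rintegral => x _.
apply: (@FTC (fun t => f (x, t)) (fun t => partial ord_max f (x, t))) => //.
  by move=> y; exact: C1_slice2.
by apply: cont_slice2; exact: C1_continuous_partial.
Qed.

Lemma C1M (f g : plane -> R) : C1 f -> C1 g -> C1 (fun x => f x * g x).
Proof.
move=> f1 g1; have cf := C1_continuous f1; have cg := C1_continuous g1.
split; first by move=> x; apply: cvgM; [exact: cf|exact: cg].
move=> j; split.
  by move=> x; apply: derivableM; exact: C1_derivable.
rewrite (_ : partial j _ = fun x => f x * partial j g x + g x * partial j f x).
  move=> x; apply: cvgD; apply: cvgM.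
  - exact: cf. - exact: C1_continuous_partial.
  - exact: cg. - exact: C1_continuous_partial.
by apply/funext => x; rewrite /partial deriveM//; exact: C1_derivable.
Qed.

Lemma partialM (f g : plane -> R) j x : C1 f -> C1 g ->
  partial j (fun x => f x * g x) x = partial j f x * g x + f x * partial j g x.
Proof.
move=> f1 g1; rewrite /partial deriveM; [|exact: C1_derivable..].
by rewrite addrC mulrC.
Qed.

Lemma C1B (f g : plane -> R) : C1 f -> C1 g -> C1 (fun x => f x - g x).
Proof.
move=> f1 g1; have cf := C1_continuous f1; have cg := C1_continuous g1.
split; first by move=> x; apply: cvgB; [exact: cf|exact: cg].
move=> j; split.
  by move=> x; apply: derivableB; exact: C1_derivable.
rewrite (_ : partial j _ = fun x => partial j f x - partial j g x).
  by move=> x; apply: cvgB; exact: C1_continuous_partial.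
by apply/funext => x; rewrite /partial deriveB//; exact: C1_derivable.
Qed.

Lemma partialB (f g : plane -> R) j x : C1 f -> C1 g ->
  partial j (fun x => f x - g x) x = partial j f x - partial j g x.
Proof. by move=> f1 g1; rewrite /partial deriveB//; exact: C1_derivable. Qed.

End Plane.

(** * The Jacobian as a null Lagrangian *)

Section NullLagrangian.
Context {R : realType}.
Notation plane := (R * R)%type.
Notation mplane := (measurableTypeR R * measurableTypeR R)%type.
Notation leb1 := (@lebesgue_measure R).
Notation leb2 := (leb1 \x leb1)%E.

Lemma cont_int1 (a b : R) (f : plane -> R) : continuous f ->
  continuous (fun y => \int[leb1]_(x in `[a, b]) f (x, y)).
Proof.
move=> cf y; apply/(@cvg_nbhsP _ R^o) => u uy.
have := cvg_seq_bounded (cvgP _ uy).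
move=> [B [_ hB]].
have uB n : `|u n| <= B + 1 by apply: hB => //; rewrite ltrDl.
have [M fM] := rect_bounded a b (- (B + 1)) (B + 1) cf.
have mf z : measurable_fun `[a, b]%classic (fun x => f (x, z)).
  apply: measurable_funS (measurableT) _ _ => //.
  by apply: continuous_measurable_fun; exact: cont_slice1.
apply: (@bounded_cvg _ _ _ leb1 _ (measurable_itv _) (itv_fin a b) _ _ M).
- by move=> n; exact: mf.
- exact: mf.
- by move=> n x /=; rewrite in_itv/= => xab; apply: fM => //; rewrite -ler_norml.
- move=> x _; apply: (@cvg_comp _ _ _ u (fun y => f (x, y)) _ _ _ uy).
  exact: cont_slice2.
Qed.

(** By the mean value theorem; this is the bound that allows differentiation
    under the integral sign by dominated convergence. *)
Lemma diff_quot_bound (g g' : R -> R) (y h M : R) :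
  (forall x : R, is_derive x 1 g (g' x)) ->
  (forall x : R, y - 1 <= x <= y + 1 -> `|g' x| <= M) ->
  h != 0 -> `|h| <= 1 -> `|h^-1 * (g (h + y) - g y)| <= M.
Proof.
move=> dg gM h0 h1.
have cg : continuous g.
  by move=> x; apply/differentiable_continuous/derivable1_diffP; exact: ex_derive.
have H (s t : R) : s <= t -> y - 1 <= s -> t <= y + 1 -> `|g t - g s| <= M * (t - s).
  move=> st ys ty.
  have [|x /=] := @MVT_segment _ g g' _ _ st (fun x _ => dg x).
    exact: continuous_subspaceT.
  rewrite in_itv/= => /andP[sx xt] ->; rewrite normrM (ger0_norm (_ : 0 <= t - s)).
    apply: ler_wpM2r; first by rewrite subr_ge0.
    by apply: gM; apply/andP; split; lra.
  by rewrite subr_ge0.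
move: h1; rewrite ler_norml => /andP[h1 h2].
rewrite normrM normfV ler_pdivrMl ?normr_gt0// mulrC.
have [hp|hn] := leP 0 h.
  rewrite (ger0_norm hp); apply: le_trans (H y (h + y) _ _ _) _; lra.
rewrite (ltr0_norm hn) distrC; apply: le_trans (H (h + y) y _ _ _) _; lra.
Qed.

Context (a b : R) (ab : a < b) (p q : plane -> R) (p1 : C1 p) (q1 : C1 q).
Let px := partial ord0 p.
Let py := partial ord_max p.
Let qx := partial ord0 q.
Let qy := partial ord_max q.
Let F y := \int[leb1]_(x in `[a, b]) (p (x, y) * qx (x, y)).
Let F' y := \int[leb1]_(x in `[a, b])
    (py (x, y) * qx (x, y) - px (x, y) * qy (x, y)) +
  (p (b, y) * qy (b, y) - p (a, y) * qy (a, y)).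

Let cp : continuous p := C1_continuous p1.
Let cq : continuous q := C1_continuous q1.
Let cpx : continuous px := @C1_continuous_partial _ _ ord0 p1.
Let cpy : continuous py := @C1_continuous_partial _ _ ord_max p1.
Let cqx : continuous qx := @C1_continuous_partial _ _ ord0 q1.
Let cqy : continuous qy := @C1_continuous_partial _ _ ord_max q1.

Let contM (f g : plane -> R) : continuous f -> continuous g ->
  continuous (fun x => f x * g x).
Proof. by move=> cf cg x; apply: cvgM; [exact: cf|exact: cg]. Qed.

Let contM1 (f g : R -> R) : continuous f -> continuous g ->
  continuous (fun x => f x * g x).
Proof. by move=> cf cg x; apply: cvgM; [exact: cf|exact: cg]. Qed.

Let contB (f g : plane -> R) : continuous f -> continuous g ->
  continuous (fun x => f x - g x).
Proof. by move=> cf cg x; apply: cvgB; [exact: cf|exact: cg]. Qed.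

Let contB1 (f g : R -> R) : continuous f -> continuous g ->
  continuous (fun x => f x - g x).
Proof. by move=> cf cg x; apply: cvgB; [exact: cf|exact: cg]. Qed.

Let K y h := \int[leb1]_(x in `[a, b])
    (h^-1 * (p (x, h + y) - p (x, y)) * qx (x, h + y)
     - px (x, y) * (h^-1 * (q (x, h + y) - q (x, y)))) +
  (p (b, y) * (h^-1 * (q (b, h + y) - q (b, y))) -
   p (a, y) * (h^-1 * (q (a, h + y) - q (a, y)))).

(** No second derivative of q appears: the difference of two x-derivatives of
    q is integrated by parts along the segment, at the cost of boundary
    terms, before the step h tends to zero. *)
Let F_quot y h : h^-1 * (F (h + y) - F y) = K y h.
Proof.
have mI : measurable (`[a, b]%classic : set (measurableTypeR R)) by [].
have c1 z : continuous (fun x => p (x, z)) by exact: cont_slice1.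
have c2 z : continuous (fun x => q (x, z)) by exact: cont_slice1.
have c3 z : continuous (fun x => px (x, z)) by exact: cont_slice1.
have c4 z : continuous (fun x => qx (x, z)) by exact: cont_slice1.
have I f := @continuous_itg1 _ a b f.
pose D x := q (x, h + y) - q (x, y).
pose D' x := qx (x, h + y) - qx (x, y).
have cD : continuous D by exact: contB1.
have cD' : continuous D' by exact: contB1.
have parts : \int[leb1]_(x in `[a, b]) (p (x, y) * D' x + px (x, y) * D x) =
    p (b, y) * D b - p (a, y) * D a.
  apply: (@FTC _ (fun x => p (x, y) * D x)) => //.
    move=> x; have d1 := C1_slice1 x y p1.
    have d2 := C1_slice1 x (h + y) q1; have d3 := C1_slice1 x y q1.
    by rewrite /D /D'; apply: is_derive_eq; rewrite /GRing.scale/= /px /qx; ring.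
  move=> x; apply: cvgD; first exact: (contM1 (c1 y) cD').
  exact: (contM1 (c3 y) cD).
have cDp : continuous (fun x => p (x, h + y) - p (x, y)) by exact: contB1.
have I1 : itg leb1 `[a, b]%classic (fun x => (p (x, h + y) - p (x, y)) * qx (x, h + y)).
  by apply: I; apply: contM1.
have I2 : itg leb1 `[a, b]%classic (fun x => p (x, y) * D' x + px (x, y) * D x).
  apply: I => x; apply: cvgD; first exact: (contM1 (c1 y) cD').
  exact: (contM1 (c3 y) cD).
have I3 : itg leb1 `[a, b]%classic (fun x => px (x, y) * D x).
  by apply: I; apply: contM1.
have -> : F (h + y) - F y =
   (\int[leb1]_(x in `[a, b]) ((p (x, h + y) - p (x, y)) * qx (x, h + y)) -
    \int[leb1]_(x in `[a, b]) (px (x, y) * D x)) +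
    (p (b, y) * D b - p (a, y) * D a).
  rewrite -parts /F -!RintegralB//; [|by apply: I; apply: contM1..].
  rewrite -RintegralD//; last exact: itgB.
  by apply: eq_Rintegral => x _; rewrite /D'; ring.
rewrite mulrDr -RintegralB// -RintegralZl//; last exact: itgB.
rewrite /K; congr (_ + _); last by rewrite /D; ring.
by apply: eq_Rintegral => x _; rewrite /D; ring.
Qed.

Let cvg_quot (g : R -> R) (l y : R) (u : nat -> R) : is_derive y 1 g l ->
  (forall n, u n != 0) -> u n @[n --> \oo] --> 0 ->
  (u n)^-1 * (g (u n + y) - g y) @[n --> \oo] --> l.
Proof.
move=> dg u0 uc; have d := @ex_derive _ _ _ _ _ _ _ dg.
have : h^-1 *: (g (h *: 1 + y) - g y) @[h --> 0^'] --> l.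
  by rewrite -(@derive_val _ _ _ _ _ _ _ dg); exact: d.
move/cvgr_dnbhsP => /(_ u (conj u0 uc)).
by under eq_fun do rewrite /GRing.scale/= mulr1.
Qed.

Lemma is_derive_F (y : R) : is_derive y 1 F (F' y).
Proof.
suff H : h^-1 *: (F (h *: 1 + y) - F y) @[h --> 0^'] --> F' y.
  constructor; first by apply/cvg_ex; exists (F' y).
  exact/cvg_lim.
apply/cvgr_dnbhsP => u [u0 uc].
under eq_fun do rewrite /GRing.scale/= mulr1 F_quot.
have [N _ uN] : \forall n \near \oo, `|u n| <= 1.
  move/cvgrPdist_le : uc => /(_ 1 ltr01); apply: filterS => n.
  by rewrite sub0r normrN.
suff : K y (u (n + N)%N) @[n --> \oo] --> F' y.
  by rewrite (cvg_shiftn N (fun n => K y (u n))).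
pose v n := u (n + N)%N.
have v0 n : v n != 0 by exact: u0.
have v1 n : `|v n| <= 1 by apply: uN; rewrite /= leq_addl.
have vc : v n @[n --> \oo] --> 0 by rewrite (cvg_shiftn N u).
have vyc : v n + y @[n --> \oo] --> y.
  by rewrite -[X in _ --> X]add0r; apply: cvgD => //; exact: cvg_cst.
have [Mp HMp] := rect_bounded a b (y - 1) (y + 1) cpy.
have [Mq HMq] := rect_bounded a b (y - 1) (y + 1) cqy.
have [Mqx HMqx] := rect_bounded a b (y - 1) (y + 1) cqx.
have [Mpx HMpx] := rect_bounded a b (y - 1) (y + 1) cpx.
have y1 n : y - 1 <= v n + y <= y + 1.
  by have := v1 n; rewrite ler_norml => /andP[? ?]; apply/andP; split; lra.
have y0 : y - 1 <= y <= y + 1 by apply/andP; split; lra.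
have Bp n x : a <= x <= b -> `|(v n)^-1 * (p (x, v n + y) - p (x, y))| <= Mp.
  move=> xab; apply: (@diff_quot_bound (fun t => p (x, t)) (fun t => py (x, t))) => //.
    by move=> t; exact: C1_slice2.
  by move=> t; exact: HMp.
have Bq n x : a <= x <= b -> `|(v n)^-1 * (q (x, v n + y) - q (x, y))| <= Mq.
  move=> xab; apply: (@diff_quot_bound (fun t => q (x, t)) (fun t => qy (x, t))) => //.
    by move=> t; exact: C1_slice2.
  by move=> t; exact: HMq.
have Cp x : (v n)^-1 * (p (x, v n + y) - p (x, y)) @[n --> \oo] --> py (x, y).
  by apply: (@cvg_quot (fun t => p (x, t))) => //; exact: C1_slice2.
have Cq x : (v n)^-1 * (q (x, v n + y) - q (x, y)) @[n --> \oo] --> qy (x, y).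
  by apply: (@cvg_quot (fun t => q (x, t))) => //; exact: C1_slice2.
rewrite /F' /K; apply: cvgD; last first.
  by apply: cvgB; (apply: cvgM; [exact: cvg_cst|]); [exact: Cq|exact: Cq].
apply: (@bounded_cvg _ _ _ leb1 _ (measurable_itv _) (itv_fin a b) _ _
  (Mp * Mqx + Mpx * Mq)).
- move=> n; apply: measurable_funS (measurableT) _ _ => //.
  apply: continuous_measurable_fun; apply: contB1.
    apply: contM1; last exact: cont_slice1.
    by apply: contM1; [exact: cst_continuous|apply: contB1; exact: cont_slice1].
  apply: contM1; first exact: cont_slice1.
  by apply: contM1; [exact: cst_continuous|apply: contB1; exact: cont_slice1].
- apply: measurable_funS (measurableT) _ _ => //.
  apply: continuous_measurable_fun; apply: contB1; apply: contM1; exact: cont_slice1.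
- move=> n x /=; rewrite in_itv/= => xab; apply: le_trans (ler_normB _ _) _.
  rewrite !normrM; apply: lerD.
    rewrite -normrM; apply: ler_pM => //; first exact: Bp.
    exact: (HMqx _ _ xab (y1 n)).
  apply: ler_pM => //; first exact: (HMpx _ _ xab y0).
  by rewrite -normrM; exact: Bq.
- move=> x _; apply: cvgB; apply: cvgM.
  + exact: Cp.
  + apply: (@cvg_comp _ _ _ (fun n => v n + y) (fun y => qx (x, y)) _ _ _ vyc).
    exact: cont_slice2.
  + exact: cvg_cst.
  + exact: Cq.
Qed.

(** The Jacobian is a divergence in the weak sense: for functions that are
    merely continuously differentiable the mixed second derivatives are
    avoided by differentiating the integral F over horizontal segments. *)
Lemma null_lagrangian (c d : R) : c < d ->
  \int[leb2]_(z in rect a b c d) (px z * qy z - py z * qx z) =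
  \int[leb1]_(y in `[c, d]) (p (b, y) * qy (b, y) - p (a, y) * qy (a, y)) -
  \int[leb1]_(x in `[a, b]) (p (x, d) * qx (x, d) - p (x, c) * qx (x, c)).
Proof.
move=> cd.
have cJ : continuous (fun z => py z * qx z - px z * qy z).
  by apply: contB; exact: contM.
have cB : continuous (fun y => p (b, y) * qy (b, y) - p (a, y) * qy (a, y)).
  by apply: contB1; apply: contM1; exact: cont_slice2.
have cF' : continuous F'.
  by move=> y; apply: cvgD; [exact: (cont_int1 cJ)|exact: cB].
have := FTC cd is_derive_F cF'.
rewrite /F' RintegralD//; last 2 first.
- by apply: continuous_itg1; exact: (@cont_int1 a b _ cJ).
- by apply: continuous_itg1; exact: cB.
have [_ <-] := Fubini_rect a b c d cJ.
rewrite [in X in _ = X]/F -RintegralB//; last 2 first.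
- by apply: continuous_itg1; apply: contM1; exact: cont_slice1.
- by apply: continuous_itg1; apply: contM1; exact: cont_slice1.
move=> <-.
rewrite opprD addrCA subrr addr0.
rewrite -[RHS]mulN1r -RintegralZl//; [|exact: rect_measurable|exact: continuous_itg2].
by apply: eq_Rintegral => z _; ring.
Qed.

End NullLagrangian.

(** * Bump functions *)

Section OneVariable.
Context {R : realType}.
Notation plane := (R * R)%type.

Lemma C1_fst (g g' : R -> R) : (forall x : R, is_derive x 1 g (g' x)) ->
  continuous g' -> C1 (fun p : plane => g p.1) /\
  (forall p, partial ord0 (fun p : plane => g p.1) p = g' p.1) /\
  (forall p, partial ord_max (fun p : plane => g p.1) p = 0).
Proof.
move=> dg cg'.
have cg : continuous g.
  by move=> x; apply/differentiable_continuous/derivable1_diffP; exact: ex_derive.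
have cfst : continuous (fst : plane -> R) by move=> p; exact: cvg_fst.
have E1 p : (fun h : R => h^-1 *: (((fun p : plane => g p.1) \o shift p)
      (h *: (1, 0)) - g p.1)) =
    (fun h : R => h^-1 *: ((g \o shift p.1) (h *: 1) - g p.1)).
  by apply/funext.
have E2 p : (fun h : R => h^-1 *: (((fun p : plane => g p.1) \o shift p)
      (h *: (0, 1)) - g p.1)) = (fun h : R => 0).
  by apply/funext => h; rewrite /shift /= scaler0 add0r subrr scaler0.
have D1 p : is_derive p (dir ord0) (fun p : plane => g p.1) (g' p.1).
  have := dg p.1; rewrite /dir eqxx => d1.
  split; first by rewrite /derivable E1; exact: ex_derive.
  by rewrite /derive E1; exact: derive_val.
have D2 p : is_derive p (dir ord_max) (fun p : plane => g p.1) 0.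
  rewrite dir_max; split; first by rewrite /derivable E2; exact: is_cvg_cst.
  by rewrite /derive E2; exact: lim_cst.
split; last by split => p; exact: derive_val.
split; first by move=> p; apply: (continuous_comp (cfst p)); exact: cg.
move=> j; have [->|j0] := eqVneq j ord0.
  split; first by move=> p; exact: ex_derive.
  rewrite (_ : partial _ _ = g' \o fst); last first.
    by apply/funext => p; exact: derive_val.
  by move=> p; apply: (continuous_comp (cfst p)); exact: cg'.
rewrite (ord2_neq0 j0).
split; first by move=> p; exact: ex_derive.
rewrite (_ : partial _ _ = cst 0); first exact: cst_continuous.
by apply/funext => p; exact: derive_val.
Qed.

Lemma C1_snd (g g' : R -> R) : (forall x : R, is_derive x 1 g (g' x)) ->
  continuous g' -> C1 (fun p : plane => g p.2) /\
  (forall p, partial ord0 (fun p : plane => g p.2) p = 0) /\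
  (forall p, partial ord_max (fun p : plane => g p.2) p = g' p.2).
Proof.
move=> dg cg'.
have cg : continuous g.
  by move=> x; apply/differentiable_continuous/derivable1_diffP; exact: ex_derive.
have csnd : continuous (snd : plane -> R) by move=> p; exact: cvg_snd.
have E1 p : (fun h : R => h^-1 *: (((fun p : plane => g p.2) \o shift p)
      (h *: (0, 1)) - g p.2)) =
    (fun h : R => h^-1 *: ((g \o shift p.2) (h *: 1) - g p.2)).
  by apply/funext.
have E2 p : (fun h : R => h^-1 *: (((fun p : plane => g p.2) \o shift p)
      (h *: (1, 0)) - g p.2)) = (fun h : R => 0).
  by apply/funext => h; rewrite /shift /= scaler0 add0r subrr scaler0.
have D1 p : is_derive p (dir ord_max) (fun p : plane => g p.2) (g' p.2).
  have := dg p.2; rewrite dir_max => d1.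
  split; first by rewrite /derivable E1; exact: ex_derive.
  by rewrite /derive E1; exact: derive_val.
have D2 p : is_derive p (dir ord0) (fun p : plane => g p.2) 0.
  rewrite /dir eqxx; split; first by rewrite /derivable E2; exact: is_cvg_cst.
  by rewrite /derive E2; exact: lim_cst.
split; last by split => p; exact: derive_val.
split; first by move=> p; apply: (continuous_comp (csnd p)); exact: cg.
move=> j; have [->|j0] := eqVneq j ord0.
  split; first by move=> p; exact: ex_derive.
  rewrite (_ : partial _ _ = cst 0); first exact: cst_continuous.
  by apply/funext => p; exact: derive_val.
rewrite (ord2_neq0 j0).
split; first by move=> p; exact: ex_derive.
rewrite (_ : partial _ _ = g' \o snd); last first.
  by apply/funext => p; exact: derive_val.
by move=> p; apply: (continuous_comp (csnd p)); exact: cg'.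
Qed.

Lemma is_derive_quadratic_error (g : R -> R) (x l : R) :
  (forall h, `|g (h + x) - g x - h * l| <= h ^+ 2) -> is_derive x 1 g l.
Proof.
move=> H; suff L : h^-1 *: (g (h *: 1 + x) - g x) @[h --> 0^'] --> l.
  by constructor; [apply/cvg_ex; exists l|exact/cvg_lim].
apply/cvgrPdist_le => /= e e0; near=> h.
have h0 : h != 0 by near: h; exact: nbhs_dnbhs_neq.
rewrite /GRing.scale/= mulr1 distrC.
have -> : h^-1 * (g (h + x) - g x) - l = h^-1 * (g (h + x) - g x - h * l).
  by rewrite [RHS]mulrBr mulrA mulVf// mul1r.
rewrite normrM normfV ler_pdivrMl ?normr_gt0//.
apply: (le_trans (H h)); rewrite -real_normK ?num_real// expr2 ler_wpM2l//.
near: h; apply: dnbhs0_le; exact: e0.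
Unshelve. all: by end_near. Qed.

Definition ramp2 (t : R) : R := (Num.max 0 t) ^+ 2.

Lemma ramp2_error (h t : R) :
  `|ramp2 (h + t) - ramp2 t - h * (2 * Num.max 0 t)| <= h ^+ 2.
Proof.
rewrite /ramp2 ler_norml; case: (leP 0 (h + t)) => h1; case: (leP 0 t) => h2;
  apply/andP; split; nra.
Qed.

Lemma is_derive_ramp2 (s t : R) :
  is_derive t 1 (fun t => ramp2 (t - s)) (2 * Num.max 0 (t - s)).
Proof. by apply: is_derive_quadratic_error => h; rewrite -(addrA h) ramp2_error. Qed.

(** A continuously differentiable step from 0 to 1: its derivative is the tent
    function with basis [0, 2] and height 1. *)
Definition smoothstep (t : R) : R :=
  (ramp2 t - 2 * ramp2 (t - 1) + ramp2 (t - 2)) / 2.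

Lemma smoothstep_itv t : 0 <= smoothstep t <= 1.
Proof.
rewrite /smoothstep /ramp2.
by case: (leP 0 t) => h1; case: (leP 0 (t - 1)) => h2; case: (leP 0 (t - 2)) => h3;
  apply/andP; split; nra.
Qed.

Lemma smoothstep_le0 t : t <= 0 -> smoothstep t = 0.
Proof.
move=> t0; rewrite /smoothstep /ramp2 !max_l ?expr0n/=; lra.
Qed.

Lemma smoothstep_ge2 t : 2 <= t -> smoothstep t = 1.
Proof.
by move=> t2; rewrite /smoothstep /ramp2 !max_r; [field|lra..].
Qed.

Definition smoothstep' (t : R) : R :=
  Num.max 0 t - 2 * Num.max 0 (t - 1) + Num.max 0 (t - 2).

Lemma is_derive_smoothstep (t : R) : is_derive t 1 smoothstep (smoothstep' t).
Proof.
have d0 : is_derive t 1 ramp2 (2 * Num.max 0 t).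
  by have := is_derive_ramp2 0 t; under eq_fun do rewrite subr0; rewrite subr0.
have d1 := is_derive_ramp2 1 t; have d2 := is_derive_ramp2 2 t.
by rewrite /smoothstep /smoothstep'; apply: is_derive_eq; rewrite /GRing.scale/=; field.
Qed.

Lemma smoothstep'_continuous : continuous smoothstep'.
Proof.
have c s : continuous (fun t : R => Num.max 0 (t - s)).
  move=> t; apply: (@continuous_max _ _ (cst 0) (fun t => t - s)).
    exact: cst_continuous.
  by apply: cvgB; [exact: cvg_id|exact: cvg_cst].
move=> t; apply: cvgD; [apply: cvgB|exact: c].
  apply: (@continuous_max _ _ (cst 0) id) => //.
  exact: cst_continuous.
by apply: cvgM; [exact: cvg_cst|exact: c].
Qed.

(** The quadratic factor is positive exactly on ]a, b[; subtracting 1 keeps the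
    support away from the end points, and a large n recovers the indicator. *)
Definition bump1 (a b : R) (n : nat) (x : R) : R :=
  smoothstep (n%:R * ((x - a) * (b - x)) - 1).

Definition bump1' (a b : R) (n : nat) (x : R) : R :=
  smoothstep' (n%:R * ((x - a) * (b - x)) - 1) * (n%:R * (a + b - 2 * x)).

Lemma is_derive_bump a b n (x : R) : is_derive x 1 (bump1 a b n) (bump1' a b n x).
Proof.
apply: (@is_derive1_comp _ smoothstep
  (fun x => n%:R * ((x - a) * (b - x)) - 1)).
  exact: is_derive_smoothstep.
by apply: is_derive_eq; rewrite /GRing.scale/=; ring.
Qed.

Lemma bump1'_continuous a b n : continuous (bump1' a b n).
Proof.
have cin : continuous (fun x : R => n%:R * ((x - a) * (b - x)) - 1).
  move=> x; apply: cvgB; last exact: cvg_cst.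
  apply: cvgM; first exact: cvg_cst.
  by apply: cvgM; apply: cvgB; (exact: cvg_id || exact: cvg_cst).
move=> x; apply: cvgM.
  apply: (@cvg_comp _ _ _ (fun x => n%:R * ((x - a) * (b - x)) - 1) smoothstep'
    _ _ _ (cin x)).
  exact: smoothstep'_continuous.
apply: cvgM; first exact: cvg_cst.
by apply: cvgB; [exact: cvg_cst|apply: cvgM; [exact: cvg_cst|exact: cvg_id]].
Qed.

Lemma bump_itv a b n x : 0 <= bump1 a b n x <= 1.
Proof. exact: smoothstep_itv. Qed.

Lemma bump_neq0 a b n x : bump1 a b n x != 0 -> 1 <= n%:R * ((x - a) * (b - x)).
Proof.
apply: contraNT; rewrite -ltNge => h; rewrite /bump1 smoothstep_le0//; lra.
Qed.

Lemma bump_cvg (a b x : R) : a < b ->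
  bump1 a b n x @[n --> \oo] --> (\1_(`]a, b[%classic) x : R).
Proof.
move=> ab; rewrite indicE; have [|] := boolP (x \in `]a, b[%classic).
  rewrite inE /= in_itv/= => /andP[ax xb].
  have s0 : 0 < (x - a) * (b - x) by rewrite mulr_gt0// subr_gt0.
  apply: cvg_near_cst; near=> n; rewrite /bump1 smoothstep_ge2//.
  suff : 3 <= n%:R * ((x - a) * (b - x)) by lra.
  rewrite -ler_pdivrMr//; near: n; exact: nbhs_infty_ger.
rewrite notin_setE /= in_itv/= => xab.
apply: cvg_near_cst; apply: nearW => n; apply/eqP/negP => /negP/bump_neq0 h.
apply: xab; have : 0 < (x - a) * (b - x).
  rewrite ltNge; apply/negP => s0.
  have : n%:R * ((x - a) * (b - x)) <= 0 by rewrite mulr_ge0_le0.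
  lra.
move=> {}h; apply/andP; split; rewrite ltNge; apply/negP => h2; nra.
Unshelve. all: by end_near. Qed.

End OneVariable.

(** * The fundamental lemma of the calculus of variations *)

Section Fundamental.
Context {R : realType}.
Notation plane := (R * R)%type.
Notation mplane := (measurableTypeR R * measurableTypeR R)%type.
Notation leb1 := (@lebesgue_measure R).
Notation leb2 := (leb1 \x leb1)%E.

Definition bump2 (a b c d : R) (n : nat) (z : plane) : R :=
  bump1 a b n z.1 * bump1 c d n z.2.

Lemma bump_fst_C1 (a b : R) n : C1 (fun z : plane => bump1 a b n z.1) /\
  (forall z, partial ord_max (fun z : plane => bump1 a b n z.1) z = 0).
Proof.
have [h [_ h2]] := C1_fst (is_derive_bump a b n) (@bump1'_continuous _ a b n).
by split.
Qed.

Lemma bump2_C1 (a b c d : R) n : C1 (bump2 a b c d n).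
Proof.
apply: C1M; first by case: (bump_fst_C1 a b n).
by have [] := C1_snd (is_derive_bump c d n) (@bump1'_continuous _ c d n).
Qed.

Lemma bump2_norm (a b c d : R) n z : `|bump2 a b c d n z| <= 1.
Proof.
rewrite /bump2 normrM.
have /andP[h1 h2] := bump_itv a b n z.1; have /andP[h3 h4] := bump_itv c d n z.2.
by rewrite !ger0_norm// mulr_ile1.
Qed.

Lemma bump2_cvg (a b c d : R) z : a < b -> c < d ->
  bump2 a b c d n z @[n --> \oo] --> (\1_(rect a b c d) z : R).
Proof.
move=> ab cd.
have -> : \1_(rect a b c d) z = \1_(`]a, b[%classic) z.1 * \1_(`]c, d[%classic) z.2 :> R.
  rewrite !indicE -natrM mulnb; congr ((nat_of_bool _)%:R).
  by apply/idP/andP; rewrite !inE.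
by apply: cvgM; exact: bump_cvg.
Qed.

Lemma bump2_test (D : set plane) (a b c d : R) n : a < b -> c < d ->
  rect a b c d `<=` D -> test_function D (bump2 a b c d n).
Proof.
move=> ab cd rD.
pose s (z : plane) : R := n%:R * ((z.1 - a) * (b - z.1)).
pose t (z : plane) : R := n%:R * ((z.2 - c) * (d - z.2)).
have c1 : continuous (fst : plane -> R) by move=> p; exact: cvg_fst.
have c2 : continuous (snd : plane -> R) by move=> p; exact: cvg_snd.
have cs : continuous s.
  move=> z; apply: cvgM; first exact: cvg_cst.
  by apply: cvgM; apply: cvgB; (exact: cvg_cst || exact: c1).
have ct : continuous t.
  move=> z; apply: cvgM; first exact: cvg_cst.
  by apply: cvgM; apply: cvgB; (exact: cvg_cst || exact: c2).
pose K := [set z | 1 <= s z] `&` [set z | 1 <= t z].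
have cK : closed K.
  apply: closedI.
    rewrite (_ : [set _ | _] = s @^-1` [set x | 1 <= x])//.
    apply: (preimage_closed (fun z _ => cs z)); exact: closed_ge.
  rewrite (_ : [set _ | _] = t @^-1` [set x | 1 <= x])//.
  apply: (preimage_closed (fun z _ => ct z)); exact: closed_ge.
have pos (u v x : R) : u < v -> 1 <= n%:R * ((x - u) * (v - x)) -> u < x < v.
  move=> uv h; have : 0 < (x - u) * (v - x).
    rewrite ltNge; apply/negP => s0.
    have : n%:R * ((x - u) * (v - x)) <= 0 by rewrite mulr_ge0_le0.
    lra.
  by move=> {}h; apply/andP; split; rewrite ltNge; apply/negP => h2; nra.
have Kr : K `<=` rect a b c d.
  by move=> [x y] [/= /(pos _ _ _ ab) hx /(pos _ _ _ cd) hy]; apply/rect_in.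
have SK : closure [set x | bump2 a b c d n x != 0] `<=` K.
  rewrite [X in _ `<=` X](closure_id K).1//; apply: closureS.
  move=> z /=; rewrite /bump2 mulf_eq0 negb_or => /andP[/bump_neq0 h1 /bump_neq0 h2].
  by split.
split; first exact: bump2_C1.
- apply: (@subclosed_compact _ _ (`[a, b]%classic `*` `[c, d]%classic)).
  + exact: closed_closure.
  + by apply: compact_setX; exact: segment_compact.
  + apply: subset_trans SK _; apply: subset_trans Kr _ => -[x y] [] /=.
    by rewrite !in_itv/= => /andP[/ltW h1 /ltW h2] /andP[/ltW h3 /ltW h4];
       rewrite h1 h2 h3 h4.
- by apply: subset_trans SK _; apply: subset_trans Kr _.
Qed.

Definition rects : set (set plane) :=
  [set A | exists a b c d, A = rect a b c d].

Lemma rects_setI : setI_closed rects.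
Proof.
move=> _ _ [a [b [c [d ->]]]] [a' [b' [c' [d' ->]]]].
exists (Num.max a a'), (Num.min b b'), (Num.max c c'), (Num.min d d').
apply/seteqP; split => -[x y].
  move=> [/rect_in[/andP[h1 h2] /andP[h3 h4]] /rect_in[/andP[k1 k2] /andP[k3 k4]]].
  by apply/rect_in; rewrite !gt_max !lt_min h1 h2 h3 h4 k1 k2 k3 k4.
move=> /rect_in; rewrite !gt_max !lt_min.
move=> [/andP[/andP[h1 h2] /andP[h3 h4]] /andP[/andP[k1 k2] /andP[k3 k4]]].
by split; apply/rect_in; rewrite ?h1 ?h2 ?h3 ?h4 ?k1 ?k2 ?k3 ?k4.
Qed.

(** Open rectangles form a generating family that is stable under
    intersection, as the monotone class argument below requires. *)
Lemma measurable_rects : @measurable _ mplane = <<s rects >>.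
Proof.
have big (x : R) : exists n : nat, - n%:R < x < n%:R.
  have [n xn] : exists n : nat, `|x| < n%:R.
    by exists (Num.bound `|x|); exact: archi_boundP.
  by exists n; rewrite -ltr_norml.
apply/seteqP; split; last first.
  apply: smallest_sub; first exact: sigma_algebra_measurable.
  by move=> _ [a [b [c [d ->]]]]; exact: rect_measurable.
have m1 : @measurable_fun _ _ (g_sigma_algebraType rects) (measurableTypeR R)
    setT fst.
  apply: (measurability _ (RGenOpens.measurableE R)) => _ [_ [x [y ->]] <-].
  rewrite setTI (_ : _ @^-1` _ = \bigcup_n rect x y (- n%:R) n%:R).
    apply: bigcupT_measurable => n; apply: sub_sigma_algebra.
    by exists x, y, (- n%:R), n%:R.
  apply/seteqP; split => [[u v] /=|[u v] [n _ []]//].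
  by move=> xy; have [n vn] := big v; exists n => //; split => //=; rewrite in_itv.
have m2 : @measurable_fun _ _ (g_sigma_algebraType rects) (measurableTypeR R)
    setT snd.
  apply: (measurability _ (RGenOpens.measurableE R)) => _ [_ [x [y ->]] <-].
  rewrite setTI (_ : _ @^-1` _ = \bigcup_n rect (- n%:R) n%:R x y).
    apply: bigcupT_measurable => n; apply: sub_sigma_algebra.
    by exists (- n%:R), n%:R, x, y.
  apply/seteqP; split => [[u v] /=|[u v] [n _ []]//].
  by move=> xy; have [n vn] := big u; exists n => //; split => //=; rewrite in_itv.
rewrite measurable_prod_measurableType.
apply: smallest_sub; first exact: smallest_sigma_algebra.
move=> _ [A mA [B mB <-]].
have := m1 measurableT A mA; have := m2 measurableT B mB.
rewrite !setTI => h2 h1.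
exact: (@measurableI _ (g_sigma_algebraType rects) _ _ h1 h2).
Qed.

(** The fundamental lemma of the calculus of variations, for continuously
    differentiable test functions: products of bumps exhaust the indicators
    of rectangles, and rectangles generate the Borel sets. *)
Lemma fundamental_lemma (A B C E : R) (v : plane -> R) :
  sqitg leb2 (rect A B C E) (v : mplane -> R) ->
  (forall phi, test_function (rect A B C E) phi ->
    \int[leb2]_(z in rect A B C E) (v z * phi z) = 0) ->
  {ae leb2, forall z, rect A B C E z -> v z = 0}.
Proof.
move=> Lv hv; set D := rect A B C E; have mD : measurable (D : set mplane).
  exact: rect_measurable.
have Dfin : (leb2 (D : set mplane) < +oo)%E := rect_fin A B C E.
have Iv : itg leb2 D v := sqitg_itg mD Dfin Lv.
have IvS (S : set mplane) : measurable S -> leb2.-integrable (D `&` S) (EFin \o v).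
  move=> mS; apply: (integrableS mD) => //; exact: measurableI.
pose P (S : set mplane) := (\int[leb2]_(z in D `&` S) (v z)%:E = 0)%E.
have Pempty S : D `&` S = set0 -> P S by rewrite /P => ->; rewrite integral_set0.
have Psub a b c d : rect a b c d `<=` D -> P (rect a b c d).
  move=> rD; have [ab|ba] := ltP a b; last first.
    apply: Pempty; apply/seteqP; split => // -[x y] [_ /rect_in[/andP[h1 h2] _]].
    by have := lt_le_trans (lt_trans h1 h2) ba; rewrite ltxx.
  have [cd|dc] := ltP c d; last first.
    apply: Pempty; apply/seteqP; split => // -[x y] [_ /rect_in[_ /andP[h1 h2]]].
    by have := lt_le_trans (lt_trans h1 h2) dc; rewrite ltxx.
  have mr := rect_measurable a b c d.
  have mb n : measurable_fun (D : set mplane) (bump2 a b c d n : mplane -> R).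
    by apply: continuous_measurable2 => //; exact: C1_continuous (bump2_C1 _ _ _ _ _).
  have mi : measurable_fun (D : set mplane) (\1_(rect a b c d) : mplane -> R).
    exact: measurable_indic.
  have nb n (z : mplane) : D z -> `|bump2 a b c d n z| <= 1.
    by move=> _; exact: bump2_norm.
  have cb (z : mplane) : D z ->
     bump2 a b c d n z @[n --> \oo] --> (\1_(rect a b c d) z : R).
    by move=> _; exact: bump2_cvg.
  have L2b := bounded_cvg_sq mD Dfin mb mi nb cb.
  have Lb n : sqitg leb2 D (bump2 a b c d n : mplane -> R).
    by apply: (sqitg_bounded mD Dfin (mb n)) => z Dz; exact: nb.
  have Li : sqitg leb2 D (\1_(rect a b c d) : mplane -> R).
    apply: (@sqitg_bounded _ _ _ _ _ mD Dfin _ 1 mi) => z _.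
    by rewrite indicE; case: (_ \in _); rewrite ?normr1 ?normr0.
  have := weak_cvg mD Lb Li Lv L2b.
  under eq_fun => n.
    under eq_Rintegral do rewrite mulrC.
    rewrite hv; last exact: bump2_test.
    over.
  move/cvg_lim => /(_ (@Rhausdorff R)); rewrite lim_cst// => /esym.
  under eq_Rintegral do rewrite mulrC.
  move=> h; rewrite /P integral_mkcondr.
  rewrite -[LHS]fineK; last first.
    have Ir := (integrable_restrict leb2 mr mD (EFin \o v)).1 (IvS _ mr).
    exact: (integrable_fin_num mD Ir).
  congr EFin; rewrite -[RHS]h; congr fine; apply: eq_integral => z _.
  rewrite /patch indicE; case: (z \in _); first by rewrite mulr1.
  by rewrite mulr0.
have PG : rects `<=` P.
  move=> S GS; have [a [b [c [d e]]]] : rects (D `&` S).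
    by apply: rects_setI => //; exists A, B, C, E.
  by have := Psub a b c d; rewrite /P -e setIA setIid; apply; exact: subIsetl.
have PT : P setT.
  by have := Psub A B C E (@subset_refl _ _); rewrite /P setIid setIT.
have PP S : measurable (S : set mplane) -> P S.
  rewrite measurable_rects; apply: (dynkin_induction measurable_rects) => //.
  - exact: rects_setI.
  - move=> S' mS PS; rewrite /P; move: PT; rewrite /P setIT.
    rewrite -{1}(setIT D) -(setUv S') setIUr integral_setU//.
    + by rewrite PS add0e.
    + exact: measurableI.
    + by apply: measurableI => //; exact: measurableC.
    + rewrite -setIUr setUv setIT; apply/measurable_EFinP; exact: itg_measurable Iv.
    + rewrite disj_set2E; apply/eqP/seteqP; split => // z [[_ Sz] [_ nSz]].
      exact: nSz.
  - move=> F mF tF PF; rewrite /P setI_bigcupr integral_bigcup.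
    + by apply: eseries0 => n _ _; exact: PF.
    + exact: trivIset_setIl.
    + by move=> n; exact: measurableI.
    + rewrite -setI_bigcupr; apply: IvS; exact: bigcupT_measurable.
have : ae_eq leb2 D (EFin \o v) (cst 0%E).
  apply: integral_ae_eq => // S SD mS.
  rewrite integral0; have := PP S mS; rewrite /P.
  by rewrite setIidr.
by apply: filterS => z /[apply] -[].
Qed.

End Fundamental.

(** * Weak derivatives and traces *)

Section SquareLimits.
Context d (T : measurableType d) (R : realType).
Context (mu : {measure set T -> \bar R}) (D : set T) (mD : measurable D).

Lemma sqnormB_cvg0 (f g : nat -> T -> R) :
  (forall n, measurable_fun D (f n)) -> (forall n, measurable_fun D (g n)) ->
  (\int[mu]_(x in D) ((f n x) ^+ 2)%:E)%E @[n --> \oo] --> 0%E ->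
  (\int[mu]_(x in D) ((g n x) ^+ 2)%:E)%E @[n --> \oo] --> 0%E ->
  (\int[mu]_(x in D) ((f n x - g n x) ^+ 2)%:E)%E @[n --> \oo] --> 0%E.
Proof.
move=> mf mg f0 g0.
have mf2 n : measurable_fun D (fun x => ((f n x) ^+ 2)%:E).
  by apply/measurable_EFinP; exact: measurable_funX.
have mg2 n : measurable_fun D (fun x => ((g n x) ^+ 2)%:E).
  by apply/measurable_EFinP; exact: measurable_funX.
have H n : (0 <= \int[mu]_(x in D) ((f n x - g n x) ^+ 2)%:E <=
   2%:E * (\int[mu]_(x in D) ((f n x) ^+ 2)%:E +
           \int[mu]_(x in D) ((g n x) ^+ 2)%:E))%E.
  apply/andP; split.
    by apply: integral_ge0 => x _; rewrite lee_fin sqr_ge0.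
  rewrite -ge0_integralD//; [|by move=> x _; rewrite lee_fin sqr_ge0..].
  rewrite -ge0_integralZl//; last 2 first.
  - exact: emeasurable_funD.
  - by move=> x _; rewrite -EFinD lee_fin addr_ge0// sqr_ge0.
  apply: ge0_le_integral => //.
  - by move=> x _; rewrite lee_fin sqr_ge0.
  - apply/measurable_EFinP; apply: measurable_funX; exact: measurable_funB.
  - by apply/measurable_funeM; exact: emeasurable_funD.
  - move=> x _; rewrite -EFinD -EFinM lee_fin.
    by have := sqr_ge0 (f n x + g n x); nra.
apply: (@squeeze_cvge _ _ _ _ (cst 0%E) _ (fun n =>
   2%:E * (\int[mu]_(x in D) ((f n x) ^+ 2)%:E +
           \int[mu]_(x in D) ((g n x) ^+ 2)%:E))%E).
- exact: nearW.
- exact: cvg_cst.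
- rewrite -[X in _ --> X](mule0 2%:E) -[X in _ --> (_ * X)%E](adde0 0%E).
  by apply: cvgeZl => //; apply: cvgeD.
Qed.

Lemma sqnorm_cvg0_real (f : nat -> T -> R) :
  (\int[mu]_(x in D) ((f n x) ^+ 2)%:E)%E @[n --> \oo] --> 0%E ->
  \int[mu]_(x in D) ((f n x) ^+ 2) @[n --> \oo] --> 0.
Proof.
by move=> h; apply: (@fine_cvg _ _ _ _ (fun n =>
  (\int[mu]_(x in D) ((f n x) ^+ 2)%:E)%E)); exact: h.
Qed.

Lemma ae_eq_sqnorm (f g : T -> R) :
  measurable_fun D f -> measurable_fun D g ->
  {ae mu, forall x, D x -> f x = g x} ->
  (\int[mu]_(x in D) ((f x) ^+ 2)%:E = \int[mu]_(x in D) ((g x) ^+ 2)%:E)%E.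
Proof.
move=> mf mg fg; apply: ae_eq_integral => //.
- by apply/measurable_EFinP; exact: measurable_funX.
- by apply/measurable_EFinP; exact: measurable_funX.
- move: fg; apply: (@filterS _ _ (ae_filter_ringOfSetsType mu)) => x.
  by move=> /[apply] /= ->.
Qed.

Lemma ae_eq_Rint (f g : T -> R) :
  measurable_fun D f -> measurable_fun D g ->
  {ae mu, forall x, D x -> f x = g x} ->
  \int[mu]_(x in D) f x = \int[mu]_(x in D) g x.
Proof.
move=> mf mg fg; congr fine; apply: ae_eq_integral => //.
- exact/measurable_EFinP.
- exact/measurable_EFinP.
- move: fg; apply: (@filterS _ _ (ae_filter_ringOfSetsType mu)) => x.
  by move=> /[apply] /= ->.
Qed.

End SquareLimits.

Section WeakPartial.
Context {R : realType}.
Notation plane := (R * R)%type.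
Notation mplane := (measurableTypeR R * measurableTypeR R)%type.
Notation leb1 := (@lebesgue_measure R).
Notation leb2 := (leb1 \x leb1)%E.
Context (a b c d : R) (ab : a < b) (cd : c < d).
Let D := rect a b c d.
Let mD : measurable (D : set mplane) := rect_measurable a b c d.
Let Dfin : (leb2 (D : set mplane) < +oo)%E := rect_fin a b c d.
Notation "'L2" := (@sqitg _ mplane R leb2 D).
Notation I f := (Rintegral leb2 D f).

Lemma test_out (phi : plane -> R) z : test_function D phi -> ~ D z -> phi z = 0.
Proof.
move=> [_ _ h] nD; apply/eqP/negP => /negP p0; apply: nD; apply: h.
exact: subset_closure.
Qed.

Lemma weak_partial_ae (j : 'I_2) (w v v' : plane -> R) :
  is_weak_partial D j w v -> is_weak_partial D j w v' ->
  {ae leb2, forall z, D z -> v z = v' z}.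
Proof.
move=> [Lv hv] [Lv' hv'].
have := @fundamental_lemma _ a b c d (fun z => v z - v' z) (sqitgB mD Lv Lv').
move=> H; have {H} : {ae leb2, forall z, D z -> v z - v' z = 0}.
  apply: H => phi tphi; have [phi1 _ _] := tphi.
  have Lphi : 'L2 phi by apply: continuous_sqitg2; exact: C1_continuous.
  under eq_Rintegral do rewrite mulrBl.
  rewrite (RintegralB mD (sqitgM mD Lv Lphi) (sqitgM mD Lv' Lphi)).
  by have := hv _ tphi; rewrite hv'// => /oppr_inj ->; rewrite subrr.
apply: (@filterS _ _ (ae_filter_ringOfSetsType leb2)) => z /[apply] /eqP.
by rewrite subr_eq0 => /eqP.
Qed.

(** The boundary values of f are arbitrary: the boundary terms vanish with the
    test function. *)
Lemma C1_weak_partial (f : plane -> R) j : C1 f ->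
  is_weak_partial D j f (partial j f).
Proof.
move=> f1; split.
  by apply: continuous_sqitg2; exact: C1_continuous_partial.
move=> phi tphi; have [phi1 _ _] := tphi.
have Lf : 'L2 f by apply: continuous_sqitg2; exact: C1_continuous.
have Lpf : 'L2 (partial j f).
  by apply: continuous_sqitg2; exact: C1_continuous_partial.
have Lphi : 'L2 phi by apply: continuous_sqitg2; exact: C1_continuous.
have Lpphi : 'L2 (partial j phi).
  by apply: continuous_sqitg2; exact: C1_continuous_partial.
have fphi1 : C1 (fun z => f z * phi z) by exact: C1M.
suff : I (fun z => partial j (fun z => f z * phi z) z) = 0.
  under eq_Rintegral do rewrite partialM//.
  rewrite (RintegralD mD (sqitgM mD Lpf Lphi) (sqitgM mD Lf Lpphi)).
  by move/eqP; rewrite addrC addr_eq0 => /eqP.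
have [->|j0] := eqVneq j ord0.
  rewrite int_partial1//.
  transitivity (\int[leb1]_(y in `[c, d]) (0 : R)).
    apply: eq_Rintegral => y _; rewrite !(test_out tphi) ?mulr0 ?subrr//.
      by move=> /rect_in[]; rewrite ltxx.
    by move=> /rect_in[]; rewrite ltxx andbF.
  by rewrite Rintegral_cst// mul0r.
rewrite (ord2_neq0 j0).
rewrite int_partial2//.
transitivity (\int[leb1]_(x in `[a, b]) (0 : R)).
  apply: eq_Rintegral => x _; rewrite !(test_out tphi) ?mulr0 ?subrr//.
    by move=> /rect_in[_]; rewrite ltxx.
  by move=> /rect_in[_]; rewrite ltxx andbF.
by rewrite Rintegral_cst// mul0r.
Qed.

Lemma weak_partialB (j : 'I_2) (w w' v v' : plane -> R) : 'L2 w -> 'L2 w' ->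
  is_weak_partial D j w v -> is_weak_partial D j w' v' ->
  is_weak_partial D j (fun z => w z - w' z) (fun z => v z - v' z).
Proof.
move=> Lw Lw' [Lv hv] [Lv' hv']; split; first exact: (sqitgB mD).
move=> phi tphi; have [phi1 _ _] := tphi.
have Lphi : 'L2 phi by apply: continuous_sqitg2; exact: C1_continuous.
have Lpphi : 'L2 (partial j phi).
  by apply: continuous_sqitg2; exact: C1_continuous_partial.
under eq_Rintegral do rewrite mulrBl.
under [in RHS]eq_Rintegral do rewrite mulrBl.
rewrite (RintegralB mD (sqitgM mD Lv Lphi) (sqitgM mD Lv' Lphi)).
rewrite (RintegralB mD (sqitgM mD Lw Lpphi) (sqitgM mD Lw' Lpphi)).
by rewrite (hv _ tphi) (hv' _ tphi) opprB opprK addrC.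
Qed.

Lemma weak_partial_limit (j : 'I_2) (f : nat -> plane -> R) (w v : plane -> R) :
  (forall n, C1 (f n)) -> 'L2 w -> 'L2 v ->
  \int[leb2]_(z in D) ((f n z - w z) ^+ 2) @[n --> \oo] --> 0 ->
  \int[leb2]_(z in D) ((partial j (f n) z - v z) ^+ 2) @[n --> \oo] --> 0 ->
  is_weak_partial D j w v.
Proof.
move=> f1 Lw Lv fw fv; split => // phi tphi; have [phi1 _ _] := tphi.
have Lphi : 'L2 phi by apply: continuous_sqitg2; exact: C1_continuous.
have Lpphi : 'L2 (partial j phi).
  by apply: continuous_sqitg2; exact: C1_continuous_partial.
have Lf n : 'L2 (f n) by apply: continuous_sqitg2; exact: C1_continuous.
have Lpf n : 'L2 (partial j (f n)).
  by apply: continuous_sqitg2; exact: C1_continuous_partial.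
have c1 := weak_cvg mD Lf Lw Lpphi fw.
have /cvgN c2 := weak_cvg mD Lpf Lv Lphi fv.
apply: (cvg_unique _ c1) => //.
suff -> : (fun n => I (fun z => f n z * partial j phi z)) =
   \- (fun n => I (fun z => partial j (f n) z * phi z)) by exact: c2.
by apply/funext => n; have [_ ->] := C1_weak_partial j (f1 n).
Qed.

Lemma weak_partialP (j : 'I_2) (w : plane -> R) :
  (exists v, is_weak_partial D j w v) ->
  is_weak_partial D j w (weak_partial D j w).
Proof. by move=> [v hv]; rewrite /weak_partial; apply: xgetPex; exists v. Qed.

Lemma H1_weak_partial (j : 'I_2) (w : plane -> R) : in_H1 D w ->
  is_weak_partial D j w (weak_partial D j w).
Proof. by move=> [_ /(_ j)]; exact: weak_partialP. Qed.

(** The trace only records boundary values in the mean square, so all that can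
    be extracted from it is an approximating sequence. *)
Lemma trace_approx (w t : plane -> R) : has_trace a b c d w t ->
  exists f : nat -> plane -> R, [/\ forall n, C1 (f n),
   L2_sqnorm D (fun z => f n z - w z) @[n --> \oo] --> 0%E,
   forall j, L2_sqnorm D (fun z => partial j (f n) z - weak_partial D j w z)
     @[n --> \oo] --> 0%E &
   bdry_sqnorm a b c d (fun z => f n z - t z) @[n --> \oo] --> 0%E].
Proof.
move=> [Hw mt [f [f1 fw ft]]]; exists f; split => //.
  apply: (squeeze_cvge _ (cvg_cst 0%E) fw); apply: nearW => n.
  apply/andP; split; first by apply: integral_ge0 => x _; rewrite lee_fin sqr_ge0.
  rewrite /H1_sqnorm leeDl// sume_ge0// => j _.
  by apply: integral_ge0 => x _; rewrite lee_fin sqr_ge0.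
move=> j; apply: (squeeze_cvge _ (cvg_cst 0%E) fw); apply: nearW => n.
have fn0 (g : plane -> R) : (0 <= L2_sqnorm D g)%E.
  by apply: integral_ge0 => x _; rewrite lee_fin sqr_ge0.
rewrite fn0/=.
have Lw : 'L2 w by case: Hw.
have Lf : 'L2 (f n) by apply: continuous_sqitg2; exact: C1_continuous.
have wp := weak_partialB Lf Lw (C1_weak_partial j (f1 n)) (H1_weak_partial j Hw).
have wp' := weak_partialP (ex_intro _ _ wp).
rewrite /L2_sqnorm (ae_eq_sqnorm mD wp.1.1 wp'.1.1 (weak_partial_ae wp wp')).
rewrite /H1_sqnorm (bigD1 j isT) addeCA leeDl//; apply: adde_ge0.
  exact: fn0.
by apply: sume_ge0 => i _; exact: fn0.
Qed.

(** Membership in H^1_0, with G the gradient of w, in the form in which it is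
    used: mean-square approximation, together with the derivatives, by
    continuously differentiable functions whose boundary values tend to zero
    in the mean square. *)
Definition zero_trace (w : plane -> R) (G : 'I_2 -> plane -> R) : Prop :=
  [/\ 'L2 w, forall j, 'L2 (G j) & exists f : nat -> plane -> R,
    [/\ forall n, C1 (f n),
        I (fun z => (f n z - w z) ^+ 2) @[n --> \oo] --> 0,
        forall j, I (fun z => (partial j (f n) z - G j z) ^+ 2) @[n --> \oo] --> 0,
        \int[leb1]_(y in `[c, d]) ((f n (a, y)) ^+ 2) @[n --> \oo] --> 0 /\
        \int[leb1]_(y in `[c, d]) ((f n (b, y)) ^+ 2) @[n --> \oo] --> 0 &
        \int[leb1]_(x in `[a, b]) ((f n (x, c)) ^+ 2) @[n --> \oo] --> 0 /\
        \int[leb1]_(x in `[a, b]) ((f n (x, d)) ^+ 2) @[n --> \oo] --> 0]].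

Lemma bdry_sqnorm_cvg0 (h : nat -> plane -> R) :
  bdry_sqnorm a b c d (h n) @[n --> \oo] --> 0%E ->
  [/\ (\int[leb1]_(y in `[c, d]) ((h n (a, y)) ^+ 2)%:E)%E @[n --> \oo] --> 0%E,
      (\int[leb1]_(y in `[c, d]) ((h n (b, y)) ^+ 2)%:E)%E @[n --> \oo] --> 0%E,
      (\int[leb1]_(x in `[a, b]) ((h n (x, c)) ^+ 2)%:E)%E @[n --> \oo] --> 0%E &
      (\int[leb1]_(x in `[a, b]) ((h n (x, d)) ^+ 2)%:E)%E @[n --> \oo] --> 0%E].
Proof.
move=> H.
have p0 (s t : R) (g : R -> R) : (0 <= \int[leb1]_(y in `[s, t]) ((g y) ^+ 2)%:E)%E.
  by apply: integral_ge0 => x _; rewrite lee_fin sqr_ge0.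
have S4 (x1 x2 x3 x4 : \bar R) : (0 <= x1 -> 0 <= x2 -> 0 <= x3 -> 0 <= x4 ->
    [/\ x1 <= x1 + x2 + x3 + x4, x2 <= x1 + x2 + x3 + x4,
        x3 <= x1 + x2 + x3 + x4 & x4 <= x1 + x2 + x3 + x4])%E.
  move=> h1 h2 h3 h4; split.
  - by rewrite -!addeA leeDl// !adde_ge0.
  - by rewrite -!addeA addeCA leeDl// !adde_ge0.
  - by rewrite -addeA addeCA leeDl// !adde_ge0.
  - by rewrite addeC leeDl// !adde_ge0.
have K n := S4 _ _ _ _ (p0 c d (fun y => h n (a, y))) (p0 c d (fun y => h n (b, y)))
  (p0 a b (fun x => h n (x, c))) (p0 a b (fun x => h n (x, d))).
split; apply: (squeeze_cvge _ (cvg_cst 0%E) H); apply: nearW => n;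
  have [k1 k2 k3 k4] := K n; apply/andP; split; (exact: p0 || assumption).
Qed.

(** The two approximating sequences have the same boundary limit, so their
    difference has small boundary values; this is the only way in which the
    boundary condition is used. *)
Lemma same_trace_zero (u v t : plane -> R) :
  has_trace a b c d u t -> has_trace a b c d v t ->
  zero_trace (fun z => u z - v z)
    (fun j z => weak_partial D j u z - weak_partial D j v z).
Proof.
move=> ut vt; have [Hu [ta tb tc td] _] := ut; have [Hv _ _] := vt.
have [f [f1 fu fdu fb]] := trace_approx ut.
have [g [g1 gv gdv gb]] := trace_approx vt.
have Lu : 'L2 u by case: Hu.
have Lv : 'L2 v by case: Hv.
have wu j := H1_weak_partial j Hu; have wv j := H1_weak_partial j Hv.
have Lf n : 'L2 (f n) by apply: continuous_sqitg2; exact: C1_continuous.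
have Lg n : 'L2 (g n) by apply: continuous_sqitg2; exact: C1_continuous.
have Lpf n j : 'L2 (partial j (f n)).
  by apply: continuous_sqitg2; exact: C1_continuous_partial.
have Lpg n j : 'L2 (partial j (g n)).
  by apply: continuous_sqitg2; exact: C1_continuous_partial.
split; first exact: (sqitgB mD).
  by move=> j; apply: (sqitgB mD); [case: (wu j)|case: (wv j)].
have mc (q : plane -> R) y : continuous q -> measurable_fun `[a, b]%classic
    (fun x : measurableTypeR R => q (x, y)).
  by move=> cq; apply: (@itg_measurable _ _ _ leb1); apply: continuous_itg1; exact: cont_slice1.
have mc' (q : plane -> R) x : continuous q -> measurable_fun `[c, d]%classic
    (fun y : measurableTypeR R => q (x, y)).
  by move=> cq; apply: (@itg_measurable _ _ _ leb1); apply: continuous_itg1; exact: cont_slice2.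
have cf n := C1_continuous (f1 n); have cg n := C1_continuous (g1 n).
have side (r s : R) (F F' : nat -> measurableTypeR R -> R)
    (T : measurableTypeR R -> R) :
    (forall n, measurable_fun `[r, s]%classic (F n)) ->
    (forall n, measurable_fun `[r, s]%classic (F' n)) ->
    measurable_fun `[r, s]%classic T ->
    (\int[leb1]_(y in `[r, s]) ((F n y - T y) ^+ 2)%:E)%E @[n --> \oo] --> 0%E ->
    (\int[leb1]_(y in `[r, s]) ((F' n y - T y) ^+ 2)%:E)%E @[n --> \oo] --> 0%E ->
    \int[leb1]_(y in `[r, s]) ((F n y - F' n y) ^+ 2) @[n --> \oo] --> 0.
  move=> mF mF' mT FT F'T.
  have := @sqnormB_cvg0 _ _ _ leb1 _ (measurable_itv _)
    (fun n y => F n y - T y) (fun n y => F' n y - T y)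
    (fun n => measurable_funB (mF n) mT) (fun n => measurable_funB (mF' n) mT) FT F'T.
  move/sqnorm_cvg0_real; apply: cvg_trans; apply: near_eq_cvg; apply: nearW => n.
  by apply: eq_Rintegral => z _; congr (_ ^+ 2); ring.
exists (fun n z => f n z - g n z); split.
- by move=> n; exact: C1B.
- have := sqnormB_cvg0 mD (fun n => (sqitgB mD (Lf n) Lu).1)
    (fun n => (sqitgB mD (Lg n) Lv).1) fu gv.
  move/sqnorm_cvg0_real; apply: cvg_trans; apply: near_eq_cvg; apply: nearW => n.
  by apply: eq_Rintegral => z _; congr (_ ^+ 2); ring.
- move=> j; have := sqnormB_cvg0 mD (fun n => (sqitgB mD (Lpf n j) (wu j).1).1)
    (fun n => (sqitgB mD (Lpg n j) (wv j).1).1) (fdu j) (gdv j).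
  move/sqnorm_cvg0_real; apply: cvg_trans; apply: near_eq_cvg; apply: nearW => n.
  by apply: eq_Rintegral => z _; congr (_ ^+ 2); rewrite partialB//; ring.
- have [fa fb' _ _] := bdry_sqnorm_cvg0 fb.
  have [ga gb' _ _] := bdry_sqnorm_cvg0 gb.
  split.
    by apply: (side _ _ _ _ _ _ _ ta fa ga) => n; exact: mc'.
  by apply: (side _ _ _ _ _ _ _ tb fb' gb') => n; exact: mc'.
- have [_ _ fc fd] := bdry_sqnorm_cvg0 fb.
  have [_ _ gc gd] := bdry_sqnorm_cvg0 gb.
  split.
    by apply: (side _ _ _ _ _ _ _ tc fc gc) => n; exact: mc.
  by apply: (side _ _ _ _ _ _ _ td fd gd) => n; exact: mc.
Qed.

End WeakPartial.

(** * Functions with zero trace *)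

Lemma cvg_seq_eq (R : realType) (u v : nat -> R) (l : R) : u =1 v ->
  u n @[n --> \oo] --> l -> v n @[n --> \oo] --> l.
Proof. by move=> /funext ->. Qed.

Section ZeroTrace.
Context {R : realType}.
Notation plane := (R * R)%type.
Notation mplane := (measurableTypeR R * measurableTypeR R)%type.
Notation leb1 := (@lebesgue_measure R).
Notation leb2 := (leb1 \x leb1)%E.
Context (a b c d : R) (ab : a < b) (cd : c < d).
Let D := rect a b c d.
Let mD : measurable (D : set mplane) := rect_measurable a b c d.
Let Dfin : (leb2 (D : set mplane) < +oo)%E := rect_fin a b c d.
Notation "'L2" := (@sqitg _ mplane R leb2 D).
Notation I f := (Rintegral leb2 D f).
Notation o0 := (ord0 : 'I_2).
Notation o1 := (ord_max : 'I_2).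

Lemma sqitg_contM (k f : plane -> R) : continuous k -> 'L2 f ->
  'L2 (fun z => k z * f z).
Proof.
move=> ck Lf; have [M kM] := rect_bounded a b c d ck.
apply: (@sqitgMb _ _ _ _ _ mD _ _ M) => //.
  exact: continuous_measurable2.
move=> [x y] /rect_in[/andP[? ?] /andP[? ?]]; apply: kM; apply/andP; split;
  exact: ltW.
Qed.

Lemma C1_sqitg (f : plane -> R) : C1 f -> 'L2 f.
Proof. by move=> f1; apply: continuous_sqitg2; exact: C1_continuous. Qed.

Lemma C1_partial_sqitg (f : plane -> R) j : C1 f -> 'L2 (partial j f).
Proof. by move=> f1; apply: continuous_sqitg2; exact: C1_continuous_partial. Qed.

Lemma bdry_term_cvg0 (s t : R) (F : nat -> R -> R) (k : R -> R) :
  (forall n, continuous (F n)) -> continuous k ->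
  \int[leb1]_(y in `[s, t]) ((F n y) ^+ 2) @[n --> \oo] --> 0 ->
  \int[leb1]_(y in `[s, t]) (F n y * k y) @[n --> \oo] --> 0.
Proof.
move=> cF ck F0.
have := @weak_cvg _ _ _ leb1 _ (measurable_itv `[s, t]) F (fun=> 0) k
  (fun n => continuous_sqitg1 s t (cF n))
  (continuous_sqitg1 s t (@cst_continuous _ _ 0)) (continuous_sqitg1 s t ck).
have -> : (fun n => \int[leb1]_(y in `[s, t]) ((F n y - 0) ^+ 2)) =
          (fun n => \int[leb1]_(y in `[s, t]) ((F n y) ^+ 2)).
  by apply/funext => n; under eq_Rintegral do rewrite subr0.
move=> /(_ F0).
have -> : \int[leb1]_(y in `[s, t]) (0 * k y) = 0.
  under eq_Rintegral do rewrite mul0r.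
  by rewrite Rintegral_cst// mul0r.
exact.
Qed.

Lemma bdry_terms_cvg0 (s t : R) (F F' : nat -> R -> R) (k k' : R -> R) :
  (forall n, continuous (F n)) -> (forall n, continuous (F' n)) ->
  continuous k -> continuous k' ->
  \int[leb1]_(y in `[s, t]) ((F n y) ^+ 2) @[n --> \oo] --> 0 ->
  \int[leb1]_(y in `[s, t]) ((F' n y) ^+ 2) @[n --> \oo] --> 0 ->
  \int[leb1]_(y in `[s, t]) (F n y * k y - F' n y * k' y) @[n --> \oo] --> 0.
Proof.
move=> cF cF' ck ck' F0 F'0.
have h := bdry_term_cvg0 cF ck F0; have h' := bdry_term_cvg0 cF' ck' F'0.
have m (u v : R -> R) : continuous u -> continuous v ->
    itg leb1 `[s, t]%classic (fun y => u y * v y).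
  move=> cu cv; apply: continuous_itg1 => y.
  by apply: cvgM; [exact: cu|exact: cv].
rewrite -[X in _ --> X](subr0 0); apply: cvg_seq_eq (cvgB h h') => n /=.
by rewrite RintegralB//; exact: m.
Qed.

(** Integration by parts without boundary terms, against test functions that
    need not vanish near the boundary. *)
Lemma zero_trace_by_parts (w : plane -> R) (G : 'I_2 -> plane -> R)
    (psi : plane -> R) j : zero_trace a b c d w G -> C1 psi ->
  I (fun z => w z * partial j psi z) = - I (fun z => G j z * psi z).
Proof.
move=> [Lw LG [f [f1 fw fG [fa fb] [fc fd]]]] psi1.
have cf n := C1_continuous (f1 n).
have cpsi := C1_continuous psi1.
have c1 := weak_cvg mD (fun n => C1_sqitg (f1 n)) Lw (C1_partial_sqitg j psi1) fw.
have c2 := weak_cvg mD (fun n => C1_partial_sqitg j (f1 n)) (LG j) (C1_sqitg psi1) (fG j).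
suff B0 : I (fun z => partial j (fun z => f n z * psi z) z) @[n --> \oo] --> 0.
  apply/eqP; rewrite -addr_eq0 addrC; apply/eqP.
  apply: (cvg_unique _ (cvgD c2 c1)) => //.
  move: B0; apply: cvg_seq_eq => n /=.
  under eq_Rintegral do rewrite partialM//.
  by rewrite (RintegralD mD (sqitgM mD (C1_partial_sqitg j (f1 n)) (C1_sqitg psi1))
    (sqitgM mD (C1_sqitg (f1 n)) (C1_partial_sqitg j psi1))).
have [->|j0] := eqVneq j o0.
  under eq_fun do rewrite (int_partial1 _ _ ab (C1M (f1 _) psi1)).
  apply: (@bdry_terms_cvg0 c d (fun n y => f n (b, y)) (fun n y => f n (a, y))
    (fun y => psi (b, y)) (fun y => psi (a, y))) => //;
    try (move=> n); exact: cont_slice2.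
rewrite (ord2_neq0 j0).
under eq_fun do rewrite (int_partial2 _ _ cd (C1M (f1 _) psi1)).
apply: (@bdry_terms_cvg0 a b (fun n y => f n (y, d)) (fun n y => f n (y, c))
  (fun y => psi (y, d)) (fun y => psi (y, c))) => //;
  try (move=> n); exact: cont_slice1.
Qed.

Lemma is_derive_affine (al be x : R) : is_derive x 1 (fun x : R => al + be * x) be.
Proof. by apply: is_derive_eq; rewrite /GRing.scale/=; ring. Qed.

Lemma affine_C1 (al be : R) : C1 (fun z : plane => al + be * z.1) /\
  (forall z, partial o0 (fun z : plane => al + be * z.1) z = be) /\
  (forall z, partial o1 (fun z : plane => al + be * z.1) z = 0).
Proof.
exact: (@C1_fst _ (fun x => al + be * x) (fun=> be) (is_derive_affine al be)
  (@cst_continuous _ _ be)).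
Qed.

(** The null Lagrangian of (al + be x) f_n and q, with f_n approximating w:
    differentiating the weight produces the term with the factor be. *)
Lemma zero_trace_jacobian_C1 (w : plane -> R) (G : 'I_2 -> plane -> R)
    (q : plane -> R) (al be : R) : zero_trace a b c d w G -> C1 q ->
  be * I (fun z => w z * partial o1 q z) +
  I (fun z => G o0 z * ((al + be * z.1) * partial o1 q z)) -
  I (fun z => G o1 z * ((al + be * z.1) * partial o0 q z)) = 0.
Proof.
move=> [Lw LG [f [f1 fw fG [fa fb] [fc fd]]]] q1.
have [s1 [s_x s_y]] := affine_C1 al be.
pose s (z : plane) := al + be * z.1.
have cs : continuous s := C1_continuous s1.
have cq j : continuous (partial j q) := @C1_continuous_partial _ _ j q1.
have Lq j : 'L2 (partial j q) := C1_partial_sqitg j q1.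
have Lsq j : 'L2 (fun z => s z * partial j q z) by exact: sqitg_contM.
have cf n := C1_continuous (f1 n).
have c1 := weak_cvg mD (fun n => C1_sqitg (f1 n)) Lw (Lq o1) fw.
have c2 := weak_cvg mD (fun n => C1_partial_sqitg o0 (f1 n)) (LG o0) (Lsq o1) (fG o0).
have c3 := weak_cvg mD (fun n => C1_partial_sqitg o1 (f1 n)) (LG o1) (Lsq o0) (fG o1).
have sf1 n : C1 (fun z => s z * f n z) by exact: C1M.
pose N n := I (fun z => partial o0 (fun z => s z * f n z) z * partial o1 q z -
                        partial o1 (fun z => s z * f n z) z * partial o0 q z).
have N0 : N n @[n --> \oo] --> 0.
  have := @bdry_terms_cvg0 c d (fun n y => f n (b, y)) (fun n y => f n (a, y))
    (fun y => s (b, y) * partial o1 q (b, y))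
    (fun y => s (a, y) * partial o1 q (a, y)).
  move=> /(_ (fun n => cont_slice2 (cf n)) (fun n => cont_slice2 (cf n))).
  move=> /(_ (cont_slice2 (fun z => cvgM (cs z) (cq o1 z)))
             (cont_slice2 (fun z => cvgM (cs z) (cq o1 z))) fb fa) B1.
  have := @bdry_terms_cvg0 a b (fun n y => f n (y, d)) (fun n y => f n (y, c))
    (fun y => s (y, d) * partial o0 q (y, d))
    (fun y => s (y, c) * partial o0 q (y, c)).
  move=> /(_ (fun n => cont_slice1 (cf n)) (fun n => cont_slice1 (cf n))).
  move=> /(_ (cont_slice1 (fun z => cvgM (cs z) (cq o0 z)))
             (cont_slice1 (fun z => cvgM (cs z) (cq o0 z))) fd fc) B2.
  rewrite -[X in _ --> X](subr0 0); apply: cvg_seq_eq (cvgB B1 B2) => n /=.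
  rewrite /N (null_lagrangian ab (sf1 _) q1 cd); congr (_ - _).
    by apply: eq_Rintegral => y _; ring.
  by apply: eq_Rintegral => y _; ring.
apply: (cvg_unique _ (cvgB (cvgD (cvgM (cvg_cst be) c1) c2) c3)) => //.
move: N0; apply: cvg_seq_eq => n /=.
have i1 := sqitgM mD (C1_sqitg (f1 n)) (Lq o1).
have i2 := sqitgM mD (C1_partial_sqitg o0 (f1 n)) (Lsq o1).
have i3 := sqitgM mD (C1_partial_sqitg o1 (f1 n)) (Lsq o0).
transitivity (be * I (fun z => f n z * partial o1 q z) +
  I (fun z => partial o0 (f n) z * (s z * partial o1 q z)) -
  I (fun z => partial o1 (f n) z * (s z * partial o0 q z))); last by [].
rewrite -(RintegralZl be mD i1) -(RintegralD mD (itgZ mD be i1) i2).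
rewrite -(RintegralB mD (itgD mD (itgZ mD be i1) i2) i3).
apply: eq_Rintegral => z _.
by rewrite !partialM// s_x s_y /s; ring.
Qed.

(** The Jacobian of a map with zero trace, weighted by an affine function of
    the first variable; in particular (be = 0) its integral vanishes. *)
Lemma zero_trace_jacobian (w w' : plane -> R) (G G' : 'I_2 -> plane -> R)
    (al be : R) : zero_trace a b c d w G -> zero_trace a b c d w' G' ->
  be * I (fun z => w z * G' o1 z) +
  I (fun z => G o0 z * ((al + be * z.1) * G' o1 z)) -
  I (fun z => G o1 z * ((al + be * z.1) * G' o0 z)) = 0.
Proof.
move=> Hw Hw'; have [Lw LG _] := Hw.
have [Lw' LG' [f [f1 fw fG _ _]]] := Hw'.
have [s1 [s_x s_y]] := affine_C1 al be.
pose s (z : plane) := al + be * z.1.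
have cs : continuous s := C1_continuous s1.
have LsG j : 'L2 (fun z => s z * G j z) by apply: sqitg_contM.
have c1 := weak_cvg mD (fun n => C1_partial_sqitg o1 (f1 n)) (LG' o1) Lw (fG o1).
have c2 := weak_cvg mD (fun n => C1_partial_sqitg o1 (f1 n)) (LG' o1) (LsG o0) (fG o1).
have c3 := weak_cvg mD (fun n => C1_partial_sqitg o0 (f1 n)) (LG' o0) (LsG o1) (fG o0).
have E1 (h h' : plane -> R) : I (fun z => h z * h' z) = I (fun z => h' z * h z).
  by apply: eq_Rintegral => z _; rewrite mulrC.
have E2 (h h' : plane -> R) : I (fun z => h z * (s z * h' z)) =
    I (fun z => h' z * (s z * h z)).
  by apply: eq_Rintegral => z _; ring.
rewrite E1 E2 (E2 (G o1)).
apply: (cvg_unique _ (cvgB (cvgD (cvgM (cvg_cst be) c1) c2) c3)) => //.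
have : (0 : R) @[n --> \oo] --> (0 : R) by exact: cvg_cst.
apply: cvg_seq_eq => n /=.
rewrite -(zero_trace_jacobian_C1 al be Hw (f1 n)).
by rewrite (E1 w) (E2 (G o0)) (E2 (G o1)).
Qed.

(** A bump that depends on the first variable only has zero derivative in the
    second one, so integration by parts localizes to a vertical strip without
    further terms. *)
Lemma zero_trace_strip (w : plane -> R) (G : 'I_2 -> plane -> R) (r s : R) :
  zero_trace a b c d w G -> r < s ->
  I (fun z => \1_(`]r, s[%classic) z.1 * G o1 z) = 0.
Proof.
move=> Hw rs; have [Lw LG _] := Hw.
have b1 n := bump_fst_C1 r s n.
have mb n : measurable_fun (D : set mplane)
    ((fun z => bump1 r s n z.1) : mplane -> R).
  by apply: continuous_measurable2 => //; exact: C1_continuous (b1 n).1.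
have mi : measurable_fun (D : set mplane)
    ((fun z => \1_(`]r, s[%classic) z.1) : mplane -> R).
  apply: measurableT_comp => //.
  by apply: measurable_funS (measurableT) _ (@measurable_fst _ _ _ _).
have nb n (z : mplane) : D z -> `|bump1 r s n z.1| <= 1.
  by move=> _; have /andP[h1 h2] := bump_itv r s n z.1; rewrite ger0_norm.
have cb (z : mplane) : D z ->
   bump1 r s n z.1 @[n --> \oo] --> (\1_(`]r, s[%classic) z.1 : R).
  by move=> _; exact: bump_cvg.
have L2b := bounded_cvg_sq mD Dfin mb mi nb cb.
have Lb n : 'L2 (fun z => bump1 r s n z.1) by exact: C1_sqitg (b1 n).1.
have Li : 'L2 (fun z => \1_(`]r, s[%classic) z.1).
  apply: (@sqitg_bounded _ _ _ _ _ mD Dfin _ 1 mi) => z _.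
  by rewrite indicE; case: (_ \in _); rewrite ?normr1 ?normr0.
have c1 := weak_cvg mD Lb Li (LG o1) L2b.
apply: (cvg_unique _ c1) => //.
have : (0 : R) @[n --> \oo] --> (0 : R) by exact: cvg_cst.
apply: cvg_seq_eq => n.
have := zero_trace_by_parts o1 Hw (b1 n).1.
under eq_Rintegral do rewrite (b1 n).2 mulr0.
rewrite Rintegral_cst// mul0r => /esym/eqP; rewrite oppr_eq0 => /eqP <-.
by apply: eq_Rintegral => z _; rewrite mulrC.
Qed.

Lemma zero_trace_grad (w : plane -> R) (G : 'I_2 -> plane -> R) j :
  zero_trace a b c d w G -> I (G j) = 0.
Proof.
move=> Hw; have [s1 [s_x s_y]] := affine_C1 1 0.
have := zero_trace_by_parts j Hw s1.
have p0 z : partial j (fun z : plane => 1 + 0 * z.1) z = 0.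
  have [->|j0] := eqVneq j o0; first exact: s_x.
  rewrite (ord2_neq0 j0).
  exact: s_y.
under eq_Rintegral do rewrite p0 mulr0.
rewrite Rintegral_cst// mul0r => /esym/eqP; rewrite oppr_eq0 => /eqP <-.
by apply: eq_Rintegral => z _; ring.
Qed.

(** The integral of the y-derivative of k(y) w^2, expanded. *)
Lemma zero_trace_square (w : plane -> R) (G : 'I_2 -> plane -> R)
    (k k' : R -> R) : (forall y : R, is_derive y 1 k (k' y)) -> continuous k' ->
  zero_trace a b c d w G ->
  I (fun z => w z * (k' z.2 * w z)) + I (fun z => G o1 z * (k z.2 * w z)) +
  I (fun z => w z * (k z.2 * G o1 z)) = 0.
Proof.
move=> dk ck' Hw; have [Lw LG [f [f1 fw fG _ _]]] := Hw.
have [k1 [_ k_y]] := C1_snd dk ck'.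
have csnd : continuous (snd : plane -> R) by move=> p; exact: cvg_snd.
have ck2 : continuous (fun z : plane => k z.2) := C1_continuous k1.
have ck'2 : continuous (fun z : plane => k' z.2).
  by move=> p; apply: (continuous_comp (csnd p)); exact: ck'.
have L1 : 'L2 (fun z => k' z.2 * w z) by exact: sqitg_contM.
have L2' : 'L2 (fun z => k z.2 * w z) by exact: sqitg_contM.
have L3 : 'L2 (fun z => k z.2 * G o1 z) by exact: sqitg_contM.
have c1 := weak_cvg mD (fun n => C1_sqitg (f1 n)) Lw L1 fw.
have c2 := weak_cvg mD (fun n => C1_partial_sqitg o1 (f1 n)) (LG o1) L2' (fG o1).
have c3 := weak_cvg mD (fun n => C1_sqitg (f1 n)) Lw L3 fw.
apply: (cvg_unique _ (cvgD (cvgD c1 c2) c3)) => //.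
have : (0 : R) @[n --> \oo] --> (0 : R) by exact: cvg_cst.
apply: cvg_seq_eq => n /=.
have kf : C1 (fun z => k z.2 * f n z) by exact: C1M.
have := zero_trace_by_parts o1 Hw kf.
have i1 := sqitgM mD (C1_sqitg (f1 n)) L1.
have i2 := sqitgM mD (C1_partial_sqitg o1 (f1 n)) L2'.
have i3 := sqitgM mD (C1_sqitg (f1 n)) L3.
move/eqP; rewrite -addr_eq0 => /eqP <-.
transitivity (I (fun z => f n z * (k' z.2 * w z)) +
  I (fun z => partial o1 (f n) z * (k z.2 * w z)) +
  I (fun z => f n z * (k z.2 * G o1 z))); last by [].
rewrite -(RintegralD mD i1 i2); congr (_ + _).
  by apply: eq_Rintegral => z _; rewrite partialM// k_y; ring.
by apply: eq_Rintegral => z _; ring.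
Qed.

End ZeroTrace.

(** * A Poincare inequality *)

Section Poincare.
Context {R : realType}.
Notation plane := (R * R)%type.
Notation mplane := (measurableTypeR R * measurableTypeR R)%type.
Notation leb1 := (@lebesgue_measure R).
Notation leb2 := (leb1 \x leb1)%E.
Context (a b : R).
Let D : set plane := rect a b (- 2^-1) 2^-1.
Let mD : measurable (D : set mplane) := rect_measurable _ _ _ _.

(** The optimal multiplier is k(y) = - pi tan(pi y), which makes - k' - k^2
    constant but is unbounded; this polynomial keeps - k' - k^2 above 9/2 on
    the section of the strip, and any bound above 4 is good enough. *)
Lemma riccati_bound (y : R) : - 2^-1 < y < 2^-1 ->
  9 / 2 <= - - (5 + 400 * y ^+ 4) - (- (5 * y + 80 * y ^+ 5)) ^+ 2.
Proof.
move=> /andP[y1 y2]; pose s := y ^+ 2.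
have s0 : 0 <= s by exact: sqr_ge0.
have s1 : s <= 4^-1 by rewrite /s; nra.
have -> : - - (5 + 400 * y ^+ 4) - (- (5 * y + 80 * y ^+ 5)) ^+ 2 =
  5 - 25 * s + 400 * s ^+ 2 - 800 * s ^+ 3 - 6400 * s ^+ 5 by rewrite /s; ring.
have [h|h] := leP s (10^-1).
  have e1 : s ^+ 3 <= 10^-1 * s ^+ 2 by rewrite exprS ler_wpM2r// sqr_ge0.
  have e2 : s ^+ 5 <= 1000^-1 * s ^+ 2.
    rewrite (_ : s ^+ 5 = s ^+ 3 * s ^+ 2); last by ring.
    rewrite ler_wpM2r ?sqr_ge0//.
    have : s ^+ 3 <= 10^-1 ^+ 3 by rewrite lerXn2r ?nnegrE// invr_ge0.
    by rewrite (_ : 10^-1 ^+ 3 = 1000^-1 :> R)//; field.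
  have : 0 <= (s - 25 / 626) ^+ 2 by exact: sqr_ge0.
  by nra.
have s2 : 0 <= s ^+ 2 by exact: sqr_ge0.
have s3 : 0 <= s ^+ 3 by exact: exprn_ge0.
have : 0 <= s * (4^-1 - s) *
    (6400 * s ^+ 3 + 1600 * s ^+ 2 + (1200 * s - 100)).
  by apply: mulr_ge0; [apply: mulr_ge0|]; lra.
have -> : s * (4^-1 - s) * (6400 * s ^+ 3 + 1600 * s ^+ 2 + (1200 * s - 100)) =
  - 25 * s + 400 * s ^+ 2 - 800 * s ^+ 3 - 6400 * s ^+ 5 by field.
lra.
Qed.

(** Expand the square (G_2 - k w)^2 with the k of [riccati_bound] and integrate
    the mixed term by parts with [zero_trace_square]. *)
Lemma Poincare (w : plane -> R) (G : 'I_2 -> plane -> R) : a < b ->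
  zero_trace a b (- 2^-1) 2^-1 w G ->
  9 / 2 * \int[leb2]_(z in D) ((w z) ^+ 2) <=
  \int[leb2]_(z in D) ((G ord_max z) ^+ 2).
Proof.
move=> ab Hw; have [Lw LG _] := Hw.
pose k (y : R) := - (5 * y + 80 * y ^+ 5).
pose k' (y : R) := - (5 + 400 * y ^+ 4).
have dk (y : R) : is_derive y 1 k (k' y).
  by apply: is_derive_eq; rewrite /GRing.scale/= /k'; ring.
have ck' : continuous k'.
  move=> y; apply: cvgN; apply: cvgD; first exact: cvg_cst.
  by apply: cvgM; [exact: cvg_cst|exact: exprn_continuous].
have ck : continuous k.
  by move=> x; apply/differentiable_continuous/derivable1_diffP; exact: ex_derive.
have cd : - 2^-1 < 2^-1 :> R by lra.
have csnd : continuous (snd : plane -> R) by move=> p; exact: cvg_snd.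
have H := zero_trace_square ab cd dk ck' Hw.
have L1 : sqitg leb2 (D : set mplane) (fun z => k' z.2 * w z).
  by apply: sqitg_contM => // p; apply: (continuous_comp (csnd p)); exact: ck'.
have L2 : sqitg leb2 (D : set mplane) (fun z => k z.2 * w z).
  by apply: sqitg_contM => // p; apply: (continuous_comp (csnd p)); exact: ck.
have L3 : sqitg leb2 (D : set mplane) (fun z => k z.2 * G ord_max z).
  by apply: sqitg_contM => // p; apply: (continuous_comp (csnd p)); exact: ck.
have i1 := sqitgM mD Lw L1. have i2 := sqitgM mD (LG ord_max) L2.
have i3 := sqitgM mD Lw L3.
have iG := sqitg_itg2 (LG ord_max). have iw := sqitg_itg2 Lw.
rewrite -(RintegralZl _ mD iw) -[leLHS]addr0 -[X in _ + X <= _]H.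
rewrite -(RintegralD mD i1 i2) -(RintegralD mD (itgD mD i1 i2) i3).
rewrite -(RintegralD mD (itgZ mD _ iw) (itgD mD (itgD mD i1 i2) i3)).
apply: le_Rintegral => //.
  by apply: itgD => //; [exact: itgZ|apply: itgD => //; exact: itgD].
move=> [x y] /rect_in[_ /riccati_bound] /=; rewrite -/(k y) -/(k' y) => h.
have := sqr_ge0 (G ord_max (x, y) - k y * w (x, y)).
have := ler_wpM2r (sqr_ge0 (w (x, y))) h.
move=> h1 h2.
rewrite -subr_ge0; apply: le_trans h2 _.
rewrite -subr_ge0.
set gg := G _ _; set ww := w _.
have -> : gg ^+ 2 -
  (9 / 2 * ww ^+ 2 + (ww * (k' y * ww) + gg * (k y * ww) + ww * (k y * gg))) -
  (gg - k y * ww) ^+ 2 = (- k' y - k y ^+ 2) * ww ^+ 2 - 9 / 2 * ww ^+ 2 by ring.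
by rewrite subr_ge0.
Qed.

End Poincare.

(** * Functions with two vertical kinks *)

Section TraceIntro.
Context {R : realType}.
Notation plane := (R * R)%type.
Notation mplane := (measurableTypeR R * measurableTypeR R)%type.
Notation leb1 := (@lebesgue_measure R).
Notation leb2 := (leb1 \x leb1)%E.
Context (a b c d : R) (ab : a < b) (cd : c < d).
Let D := rect a b c d.
Let mD : measurable (D : set mplane) := rect_measurable a b c d.
Let Dfin : (leb2 (D : set mplane) < +oo)%E := rect_fin a b c d.
Notation "'L2" := (@sqitg _ mplane R leb2 D).
Notation I f := (Rintegral leb2 D f).

Lemma sqnorm_real dd (T : measurableType dd) (mu : {measure set T -> \bar R})
    (A : set T) (f : T -> R) : measurable A -> sqitg mu A f ->
  (\int[mu]_(x in A) ((f x) ^+ 2)%:E = (\int[mu]_(x in A) ((f x) ^+ 2))%:E)%E.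
Proof.
move=> mA Lf; rewrite /Rintegral fineK//.
exact: (integrable_fin_num mA (sqitg_itg2 Lf)).
Qed.

(** The H^1 norm of the definition refers to chosen weak derivatives; V replaces
    them because it is a limit of derivatives, hence a weak derivative, and
    weak derivatives are unique almost everywhere. *)
Lemma has_trace_intro (w t : plane -> R) (V : 'I_2 -> plane -> R)
    (f : nat -> plane -> R) : 'L2 w -> (forall j, 'L2 (V j)) -> continuous t ->
  (forall n, C1 (f n)) ->
  I (fun z => (f n z - w z) ^+ 2) @[n --> \oo] --> 0 ->
  (forall j, I (fun z => (partial j (f n) z - V j z) ^+ 2) @[n --> \oo] --> 0) ->
  \int[leb1]_(y in `[c, d]) ((f n (a, y) - t (a, y)) ^+ 2) @[n --> \oo] --> 0 ->
  \int[leb1]_(y in `[c, d]) ((f n (b, y) - t (b, y)) ^+ 2) @[n --> \oo] --> 0 ->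
  \int[leb1]_(x in `[a, b]) ((f n (x, c) - t (x, c)) ^+ 2) @[n --> \oo] --> 0 ->
  \int[leb1]_(x in `[a, b]) ((f n (x, d) - t (x, d)) ^+ 2) @[n --> \oo] --> 0 ->
  has_trace a b c d w t /\ forall j, is_weak_partial D j w (V j).
Proof.
move=> Lw LV ct f1 fw fV fa fb fc fd.
have wp j : is_weak_partial D j w (V j).
  exact: (weak_partial_limit ab cd f1 Lw (LV j) fw (fV j)).
have Lf n : 'L2 (f n) by exact: C1_sqitg.
have cf n := C1_continuous (f1 n).
split => //; split.
- by split => // j; exists (V j).
- by split; [apply: (@itg_measurable _ _ _ leb1 `[c, d]%classic)..
    |apply: (@itg_measurable _ _ _ leb1 `[a, b]%classic)
    |apply: (@itg_measurable _ _ _ leb1 `[a, b]%classic)];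
    apply: continuous_itg1; (exact: cont_slice2 || exact: cont_slice1).
exists f; split => //.
  have E n : H1_sqnorm D (fun z => f n z - w z) =
    ((I (fun z => (f n z - w z) ^+ 2)) +
     ((I (fun z => (partial ord0 (f n) z - V ord0 z) ^+ 2)) +
      (I (fun z => (partial ord_max (f n) z - V ord_max z) ^+ 2))))%:E.
    have L2E j : L2_sqnorm D (weak_partial D j (fun z => f n z - w z)) =
      (I (fun z => (partial j (f n) z - V j z) ^+ 2))%:E.
      have wd := weak_partialB (Lf n) Lw (C1_weak_partial ab cd j (f1 n)) (wp j).
      have wd' := weak_partialP (ex_intro _ _ wd).
      rewrite /L2_sqnorm -(ae_eq_sqnorm mD wd.1.1 wd'.1.1 (weak_partial_ae wd wd')).
      exact: (sqnorm_real mD wd.1).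
    have o1E : lift ord0 ord0 = ord_max :> 'I_2 by exact/val_inj.
    rewrite !EFinD /H1_sqnorm; congr (_ + _)%E.
      exact: (sqnorm_real mD (sqitgB mD (Lf n) Lw)).
    by rewrite big_ord_recl big_ord1 o1E; congr (_ + _)%E; exact: L2E.
  have -> : (fun n => H1_sqnorm (rect a b c d) (fun x => f n x - w x)) = _ := funext E.
  apply: cvg_EFin; first exact: nearW.
  rewrite (_ : 0 = 0 + (0 + 0) :> R); last by rewrite !addr0.
  by apply: cvgD => //; apply: cvgD; exact: fV.
have L1 (r s : R) (g g' : R -> R) : continuous g -> continuous g' ->
    sqitg leb1 `[r, s]%classic (fun y => g y - g' y).
  move=> cg cg'; apply: continuous_sqitg1 => y.
  by apply: cvgB; [exact: cg|exact: cg'].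
have E n : bdry_sqnorm a b c d (fun z => f n z - t z) =
   (\int[leb1]_(y in `[c, d]) ((f n (a, y) - t (a, y)) ^+ 2) +
    \int[leb1]_(y in `[c, d]) ((f n (b, y) - t (b, y)) ^+ 2) +
    \int[leb1]_(x in `[a, b]) ((f n (x, c) - t (x, c)) ^+ 2) +
    \int[leb1]_(x in `[a, b]) ((f n (x, d) - t (x, d)) ^+ 2))%:E.
  have l1 := L1 c d _ _ (cont_slice2 (x := a) (cf n)) (cont_slice2 (x := a) ct).
  have l2 := L1 c d _ _ (cont_slice2 (x := b) (cf n)) (cont_slice2 (x := b) ct).
  have l3 := L1 a b _ _ (cont_slice1 (y := c) (cf n)) (cont_slice1 (y := c) ct).
  have l4 := L1 a b _ _ (cont_slice1 (y := d) (cf n)) (cont_slice1 (y := d) ct).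
  by rewrite /bdry_sqnorm (sqnorm_real _ l1)// (sqnorm_real _ l2)//
    (sqnorm_real _ l3)// (sqnorm_real _ l4).
have -> : (fun n => bdry_sqnorm a b c d (fun x => f n x - t x)) = _ := funext E.
apply: cvg_EFin; first exact: nearW.
rewrite (_ : 0 = 0 + 0 + 0 + 0 :> R); last by rewrite !addr0.
by apply: cvgD => //; apply: cvgD => //; exact: cvgD.
Qed.

End TraceIntro.

Section Kinks.
Context {R : realType}.
Notation plane := (R * R)%type.
Notation mplane := (measurableTypeR R * measurableTypeR R)%type.
Notation leb1 := (@lebesgue_measure R).
Notation leb2 := (leb1 \x leb1)%E.

(** A continuously differentiable approximation of the absolute value, exact
    at distance at least 1 / (n + 1) from the origin. *)
Definition smooth_abs (n : nat) (s : R) : R :=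
  (ramp2 (n.+1%:R * s - (- 1)) - ramp2 (n.+1%:R * s - 1)) / (2 * n.+1%:R) - s.

Definition smooth_sg (n : nat) (s : R) : R :=
  Num.max 0 (n.+1%:R * s - (- 1)) - Num.max 0 (n.+1%:R * s - 1) - 1.

Lemma is_derive_smooth_abs n (s : R) :
  is_derive s 1 (smooth_abs n) (smooth_sg n s).
Proof.
have N0 : n.+1%:R != 0 :> R by [].
have dl (r : R) : is_derive s 1 (fun s => ramp2 (n.+1%:R * s - r))
    (2 * Num.max 0 (n.+1%:R * s - r) * n.+1%:R).
  apply: (@is_derive1_comp _ (fun t => ramp2 (t - r)) (fun s => n.+1%:R * s)).
    exact: is_derive_ramp2.
  by apply: is_derive_eq; rewrite /GRing.scale/=; ring.
have d1 := dl (-1); have d2 := dl 1.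
rewrite /smooth_abs /smooth_sg.
by apply: is_derive_eq; rewrite /GRing.scale/=; field.
Qed.

Lemma smooth_sg_continuous n : continuous (smooth_sg n).
Proof.
have c r : continuous (fun t : R => Num.max 0 (n.+1%:R * t - r)).
  have cr : continuous (fun t : R => n.+1%:R * t - r).
    move=> t; apply: cvgB; last exact: cvg_cst.
    by apply: cvgM; [exact: cvg_cst|exact: cvg_id].
  move=> t; exact: (continuous_max (@cst_continuous _ _ 0 t) (cr t)).
by move=> t; apply: cvgB; [apply: cvgB; exact: c|exact: cvg_cst].
Qed.

Lemma smooth_abs_bound n (s : R) :
  `|s| <= smooth_abs n s <= `|s| + (2 * n.+1%:R)^-1.
Proof.
have N0 : 0 < n.+1%:R :> R by rewrite ltr0n.
have H (t : R) : 2 * `|t| <= ramp2 (t - (-1)) - ramp2 (t - 1) - 2 * t <=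
    2 * `|t| + 1.
  rewrite /ramp2; case: (ger0P t) => ht; case: (leP 0 (t - (-1))) => h1;
    case: (leP 0 (t - 1)) => h2; apply/andP; split; nra.
have -> : smooth_abs n s = (ramp2 (n.+1%:R * s - (-1)) - ramp2 (n.+1%:R * s - 1)
   - 2 * (n.+1%:R * s)) / (2 * n.+1%:R).
  by rewrite /smooth_abs; field; rewrite gt_eqF.
have := H (n.+1%:R * s); rewrite normrM (ger0_norm (ltW N0)) => /andP[h1 h2].
have E : `|s| * (2 * n.+1%:R) = 2 * (n.+1%:R * `|s|) by ring.
rewrite ler_pdivlMr ?ler_pdivrMr ?mulr_gt0//; apply/andP; split; first by rewrite E.
have -> : (`|s| + (2 * n.+1%:R)^-1) * (2 * n.+1%:R) = 2 * (n.+1%:R * `|s|) + 1.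
  by field; rewrite gt_eqF.
exact: h2.
Qed.

Lemma smooth_sg_bound n (s : R) : `|smooth_sg n s| <= 1.
Proof.
rewrite /smooth_sg; set t := _ * s; rewrite ler_norml.
case: (leP 0 (t - (-1))) => h1; case: (leP 0 (t - 1)) => h2;
  apply/andP; split; lra.
Qed.

Lemma smooth_abs_cvg (s : R) : smooth_abs n s @[n --> \oo] --> `|s|.
Proof.
apply: (@squeeze_cvgr _ _ _ _ (cst `|s|) (fun n => `|s| + 2^-1 * n.+1%:R^-1)).
- by apply: nearW => n; rewrite -invfM; exact: smooth_abs_bound.
- exact: cvg_cst.
- rewrite -[X in _ --> X]addr0; apply: cvgD; first exact: cvg_cst.
  rewrite -[X in _ --> X](mulr0 2^-1); apply: cvgM; first exact: cvg_cst.
  exact: cvg_harmonic.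
Qed.

Lemma smooth_sg_cvg (s : R) : smooth_sg n s @[n --> \oo] --> Num.sg s.
Proof.
apply: cvg_near_cst; have [s0|s0|->] := ltgtP s 0.
- near=> n; rewrite /smooth_sg ltr0_sg//.
  have : n.+1%:R * s <= -1.
    suff : 1 <= n.+1%:R * - s by rewrite mulrN; lra.
    rewrite -ler_pdivrMr ?oppr_gt0// div1r; apply: (@le_trans _ _ n%:R).
      by near: n; exact: nbhs_infty_ger.
    by rewrite ler_nat.
  by move=> h; rewrite !max_l; lra.
- near=> n; rewrite /smooth_sg gtr0_sg//.
  have : 1 <= n.+1%:R * s.
    rewrite -ler_pdivrMr// div1r; apply: (@le_trans _ _ n%:R).
      by near: n; exact: nbhs_infty_ger.
    by rewrite ler_nat.
  by move=> h; rewrite !max_r; lra.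
- near=> n; rewrite /smooth_sg mulr0 sgr0 max_r ?max_l; lra.
Unshelve. all: by end_near. Qed.

Definition kinked (al be ga k1 k2 : R) (z : plane) : R :=
  al + be * z.1 + ga * z.2 + k1 * `|z.1 + 2^-1| + k2 * `|z.1 - 2^-1|.

Definition kinked_partial (be ga k1 k2 : R) (j : 'I_2) (z : plane) : R :=
  if j == ord0 then be + k1 * Num.sg (z.1 + 2^-1) + k2 * Num.sg (z.1 - 2^-1)
  else ga.

Lemma kinked_continuous al be ga k1 k2 : continuous (kinked al be ga k1 k2).
Proof.
have c1 : continuous (fst : plane -> R) by move=> p; exact: cvg_fst.
have c2 : continuous (snd : plane -> R) by move=> p; exact: cvg_snd.
move=> z; apply: cvgD; last first.
  apply: cvgM; first exact: cvg_cst.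
  by apply: cvg_norm; apply: cvgB; [exact: c1|exact: cvg_cst].
apply: cvgD; last first.
  apply: cvgM; first exact: cvg_cst.
  by apply: cvg_norm; apply: cvgD; [exact: c1|exact: cvg_cst].
apply: cvgD; last by apply: cvgM; [exact: cvg_cst|exact: c2].
by apply: cvgD; [exact: cvg_cst|apply: cvgM; [exact: cvg_cst|exact: c1]].
Qed.

(* A function of z.1 minus a function of z.2, so that it is continuously
   differentiable as a difference of such functions. *)
Definition smooth_kinked (al be ga k1 k2 : R) (n : nat) (z : plane) : R :=
  (al + be * z.1 + k1 * smooth_abs n (z.1 + 2^-1)
    + k2 * smooth_abs n (z.1 - 2^-1)) - (- ga) * z.2.

Lemma smooth_kinked_C1 al be ga k1 k2 n : C1 (smooth_kinked al be ga k1 k2 n) /\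
  forall j z, partial j (smooth_kinked al be ga k1 k2 n) z =
    if j == ord0 then be + k1 * smooth_sg n (z.1 + 2^-1)
      + k2 * smooth_sg n (z.1 - 2^-1) else ga.
Proof.
pose g (x : R) := al + be * x + k1 * smooth_abs n (x + 2^-1)
    + k2 * smooth_abs n (x - 2^-1).
pose g' (x : R) := be + k1 * smooth_sg n (x + 2^-1) + k2 * smooth_sg n (x - 2^-1).
have sh (r x : R) : is_derive x 1 (fun x => smooth_abs n (x + r)) (smooth_sg n (x + r)).
  rewrite -[X in is_derive _ _ _ X]mulr1.
  apply: (@is_derive1_comp _ (smooth_abs n) (fun x => x + r)).
    exact: is_derive_smooth_abs.
  by apply: is_derive_eq; rewrite addr0.
have dg (x : R) : is_derive x 1 g (g' x).
  have d1 := sh 2^-1 x; have d2 := sh (- 2^-1) x.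
  by rewrite /g /g'; apply: is_derive_eq; rewrite /GRing.scale/=; ring.
have cg' : continuous g'.
  have cs r : continuous (fun x : R => smooth_sg n (x + r)).
    move=> x; apply: (@cvg_comp _ _ _ (fun x => x + r) (smooth_sg n) _ (nbhs (x + r))).
      by apply: cvgD; [exact: cvg_id|exact: cvg_cst].
    exact: smooth_sg_continuous.
  move=> x; apply: cvgD.
    apply: cvgD; first exact: cvg_cst.
    by apply: cvgM; [exact: cvg_cst|exact: cs].
  by apply: cvgM; [exact: cvg_cst|exact: cs].
have [g1 [g_x g_y]] := C1_fst dg cg'.
have dl (y : R) : is_derive y 1 (fun y : R => - ga * y) (- ga).
  by apply: is_derive_eq; rewrite /GRing.scale/=; ring.
have [h1 [h_x h_y]] := C1_snd dl (@cst_continuous _ _ (- ga)).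
split; first exact: C1B g1 h1.
move=> j z; rewrite (partialB j z g1 h1).
have [->|j0] := eqVneq j ord0; first by rewrite g_x h_x subr0.
rewrite (ord2_neq0 j0).
by rewrite g_y h_y sub0r opprK.
Qed.

Lemma smooth_kinked_cvg al be ga k1 k2 z :
  smooth_kinked al be ga k1 k2 n z @[n --> \oo] --> kinked al be ga k1 k2 z.
Proof.
rewrite (_ : kinked _ _ _ _ _ _ = (al + be * z.1 + k1 * `|z.1 + 2^-1| +
  k2 * `|z.1 - 2^-1|) - (- ga) * z.2); last by rewrite /kinked; ring.
apply: cvgB; last exact: cvg_cst.
apply: cvgD; last by apply: cvgM; [exact: cvg_cst|exact: smooth_abs_cvg].
apply: cvgD; last by apply: cvgM; [exact: cvg_cst|exact: smooth_abs_cvg].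
exact: cvg_cst.
Qed.

Lemma smooth_kinked_partial_cvg al be ga k1 k2 j z :
  partial j (smooth_kinked al be ga k1 k2 n) z @[n --> \oo] -->
  kinked_partial be ga k1 k2 j z.
Proof.
have fp n := (smooth_kinked_C1 al be ga k1 k2 n).2.
rewrite /kinked_partial.
have -> : (fun n => partial j (smooth_kinked al be ga k1 k2 n) z) =
   (fun n => if j == ord0 then be + k1 * smooth_sg n (z.1 + 2^-1) +
                k2 * smooth_sg n (z.1 - 2^-1) else ga).
  by apply/funext => n; rewrite fp.
case: ifP => _; last exact: cvg_cst.
apply: cvgD; last by apply: cvgM; [exact: cvg_cst|exact: smooth_sg_cvg].
apply: cvgD; first exact: cvg_cst.
by apply: cvgM; [exact: cvg_cst|exact: smooth_sg_cvg].
Qed.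

Lemma smooth_kinked_error al be ga k1 k2 n z :
  `|smooth_kinked al be ga k1 k2 n z| <=
  `|kinked al be ga k1 k2 z| + (`|k1| + `|k2|).
Proof.
have H (s : R) : `|smooth_abs n s - `|s| | <= 1.
  have /andP[h1 h2] := smooth_abs_bound n s.
  rewrite ger0_norm ?subr_ge0// lerBlDl; apply: (le_trans h2).
  rewrite lerD2l invf_le1 ?mulr_gt0// -natrM ler1n.
  by rewrite muln_gt0.
rewrite (_ : smooth_kinked _ _ _ _ _ _ _ = kinked al be ga k1 k2 z +
  (k1 * (smooth_abs n (z.1 + 2^-1) - `|z.1 + 2^-1|) +
   k2 * (smooth_abs n (z.1 - 2^-1) - `|z.1 - 2^-1|))); last first.
  by rewrite /smooth_kinked /kinked; ring.
apply: (le_trans (ler_normD _ _)); rewrite lerD2l.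
apply: (le_trans (ler_normD _ _)); rewrite !normrM.
by apply: lerD; rewrite ler_piMr.
Qed.

Context (a b c d : R) (ab : a < b) (cd : c < d).
Let D := rect a b c d.
Let mD : measurable (D : set mplane) := rect_measurable a b c d.
Let Dfin : (leb2 (D : set mplane) < +oo)%E := rect_fin a b c d.

Lemma kinked_partial_measurable be ga k1 k2 j :
  measurable_fun (D : set mplane) (kinked_partial be ga k1 k2 j : mplane -> R).
Proof.
have f1 n := (smooth_kinked_C1 0 be ga k1 k2 n).1.
have fp n := (smooth_kinked_C1 0 be ga k1 k2 n).2.
apply: (@measurable_fun_cvg _ _ _ (D : set mplane) (fun n => partial j (smooth_kinked 0 be ga k1 k2 n))).
  by move=> n; apply: continuous_measurable2 => //; exact: C1_continuous_partial.
by move=> z _; exact: smooth_kinked_partial_cvg.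
Qed.

Lemma kinked_partial_bound be ga k1 k2 j z :
  `|kinked_partial be ga k1 k2 j z| <= `|be| + `|k1| + `|k2| + `|ga|.
Proof.
have sg1 (s : R) : `|Num.sg s| <= 1 by rewrite normr_sg; case: eqP.
rewrite /kinked_partial; case: ifP => _.
  rewrite -[leLHS]addr0; apply: lerD => //.
  apply: (le_trans (ler_normD _ _)); apply: lerD; last first.
    by rewrite normrM ler_piMr.
  apply: (le_trans (ler_normD _ _)); apply: lerD => //.
  by rewrite normrM ler_piMr.
by rewrite lerDr !addr_ge0.
Qed.

Lemma kinked_trace (w : plane -> R) al be ga k1 k2 :
  (forall z, D z -> w z = kinked al be ga k1 k2 z) ->
  has_trace a b c d w (kinked al be ga k1 k2) /\
  forall j, is_weak_partial D j w (kinked_partial be ga k1 k2 j).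
Proof.
move=> wE; set U := kinked al be ga k1 k2.
have cU : continuous U by exact: kinked_continuous.
pose f := smooth_kinked al be ga k1 k2.
have f1 n : C1 (f n) := (smooth_kinked_C1 al be ga k1 k2 n).1.
have fp n := (smooth_kinked_C1 al be ga k1 k2 n).2.
have cf n := C1_continuous (f1 n).
have [M UM] := rect_bounded a b c d cU.
pose M' := M + (`|k1| + `|k2|).
have fM n x y : a <= x <= b -> c <= y <= d -> `|f n (x, y)| <= M'.
  move=> hx hy; apply: (le_trans (smooth_kinked_error _ _ _ _ _ _ _)).
  by rewrite lerD2r; exact: UM.
have oc (x y z : R) : x < z < y -> x <= z <= y.
  by move=> /andP[h1 h2]; rewrite !ltW.
have LU : sqitg leb2 (D : set mplane) U by exact: continuous_sqitg2.
have Lw : sqitg leb2 (D : set mplane) w by apply: eq_sqitg LU => z /wE.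
have m1 (r s : R) (g : R -> R) : continuous g ->
    measurable_fun `[r, s]%classic (g : measurableTypeR R -> R).
  by move=> cg; apply: (@itg_measurable _ _ _ leb1); exact: continuous_itg1.
have ixy (r s z : R) : `[r, s]%classic z -> r <= z <= s by rewrite /= in_itv.
apply: (@has_trace_intro _ a b c d ab cd w U (kinked_partial be ga k1 k2) f) => //.
- move=> j; apply: (sqitg_bounded mD Dfin (kinked_partial_measurable _ _ _ _ _)).
  by move=> z _; exact: kinked_partial_bound.
- have := @bounded_cvg_sq _ _ _ _ _ mD Dfin f U M'.
  have -> : (fun n => \int[leb2]_(z in D) ((f n z - U z) ^+ 2)) =
            (fun n => \int[leb2]_(z in D) ((f n z - w z) ^+ 2)).
    by apply/funext => n; apply: eq_Rintegral => z; rewrite inE => /wE ->.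
  apply.
  + by move=> n; exact: continuous_measurable2.
  + exact: continuous_measurable2.
  + by move=> n [x y] /rect_in[/oc hx /oc hy]; exact: fM.
  + by move=> z _; exact: smooth_kinked_cvg.
- move=> j.
  apply: (@bounded_cvg_sq _ _ _ _ _ mD Dfin (fun n => partial j (f n))
    (kinked_partial be ga k1 k2 j) (`|be| + `|k1| + `|k2| + `|ga|)).
  + by move=> n; apply: continuous_measurable2 => //; exact: C1_continuous_partial.
  + exact: kinked_partial_measurable.
  + move=> n z _; rewrite fp; case: ifP => _.
      rewrite -[leLHS]addr0; apply: lerD => //.
      apply: (le_trans (ler_normD _ _)); apply: lerD; last first.
        by rewrite normrM ler_piMr// smooth_sg_bound.
      apply: (le_trans (ler_normD _ _)); apply: lerD => //.
      by rewrite normrM ler_piMr// smooth_sg_bound.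
    by rewrite lerDr !addr_ge0.
  + by move=> z _; exact: smooth_kinked_partial_cvg.
- apply: (@bounded_cvg_sq _ _ _ leb1 _ (measurable_itv _) (itv_fin c d)
    (fun n y => f n (a, y)) (fun y => U (a, y)) M').
  + by move=> n; apply: m1; exact: cont_slice2.
  + by apply: m1; exact: cont_slice2.
  + by move=> n y /ixy; apply: fM; rewrite lexx ltW.
  + by move=> y _; exact: smooth_kinked_cvg.
- apply: (@bounded_cvg_sq _ _ _ leb1 _ (measurable_itv _) (itv_fin c d)
    (fun n y => f n (b, y)) (fun y => U (b, y)) M').
  + by move=> n; apply: m1; exact: cont_slice2.
  + by apply: m1; exact: cont_slice2.
  + by move=> n y /ixy; apply: fM; rewrite lexx ltW.
  + by move=> y _; exact: smooth_kinked_cvg.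
- apply: (@bounded_cvg_sq _ _ _ leb1 _ (measurable_itv _) (itv_fin a b)
    (fun n x => f n (x, c)) (fun x => U (x, c)) M').
  + by move=> n; apply: m1; exact: cont_slice1.
  + by apply: m1; exact: cont_slice1.
  + by move=> n x /ixy hx; apply: fM => //; rewrite lexx ltW.
  + by move=> y _; exact: smooth_kinked_cvg.
- apply: (@bounded_cvg_sq _ _ _ leb1 _ (measurable_itv _) (itv_fin a b)
    (fun n x => f n (x, d)) (fun x => U (x, d)) M').
  + by move=> n; apply: m1; exact: cont_slice1.
  + by apply: m1; exact: cont_slice1.
  + by move=> n x /ixy hx; apply: fM => //; rewrite lexx ltW.
  + by move=> y _; exact: smooth_kinked_cvg.
Qed.

End Kinks.

(** * The energy gap *)

Section AlmostEverywhere.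
Context d (T : measurableType d) (R : realType).
Context (mu : {measure set T -> \bar R}) (D : set T) (mD : measurable D).

Lemma ae_imply (P Q : T -> Prop) : (forall x, P x -> Q x) ->
  {ae mu, forall x, P x} -> {ae mu, forall x, Q x}.
Proof. by move=> PQ; apply: (@filterS _ _ (ae_filter_ringOfSetsType mu)). Qed.

Lemma ae_and (P Q : T -> Prop) : {ae mu, forall x, P x} ->
  {ae mu, forall x, Q x} -> {ae mu, forall x, P x /\ Q x}.
Proof.
move=> hP hQ; apply: (@filterI _ _ (ae_filter_ringOfSetsType mu)).
  exact: hP.
exact: hQ.
Qed.

Lemma ae_Rint_ge0 (f : T -> R) : itg mu D f ->
  {ae mu, forall x, D x -> 0 <= f x} -> 0 <= \int[mu]_(x in D) f x.
Proof.
move=> If f0; have mf := itg_measurable If.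
rewrite (@ae_eq_Rint _ _ _ mu D mD f (fun x => Num.max (f x) 0))//.
- by apply: Rintegral_ge0 => x _; rewrite le_max lexx orbT.
- exact: measurable_maxr.
- by move: f0; apply: ae_imply => x h /h f0; rewrite max_l.
Qed.

End AlmostEverywhere.

Section PiecewiseAffine.
Context {R : realType}.
Notation plane := (R * R)%type.
Notation mplane := (measurableTypeR R * measurableTypeR R)%type.
Notation leb1 := (@lebesgue_measure R).
Notation leb2 := (leb1 \x leb1)%E.

(** The sign of s selects the side of the line from which (x0, y0) is
    approached. *)
Lemma side_limit (u : plane -> R) (x0 y0 s p q : R) :
  {for (x0, y0), continuous u} ->
  (forall n : nat, u (x0 + s * n.+1%:R^-1, y0) = p * (x0 + s * n.+1%:R^-1) + q) ->
  u (x0, y0) = p * x0 + q.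
Proof.
move=> cu uE.
have v : x0 + s * n.+1%:R^-1 @[n --> \oo] --> x0.
  rewrite -[X in _ --> X]addr0; apply: cvgD; first exact: cvg_cst.
  rewrite -[X in _ --> X](mulr0 s); apply: cvgM; first exact: cvg_cst.
  exact: cvg_harmonic.
have v2 : (x0 + s * n.+1%:R^-1, y0) @[n --> \oo] --> (x0, y0).
  by apply: (@cvg_pair _ _ _ _ (nbhs x0) (nbhs y0)) => //; exact: cvg_cst.
have c1 : u (x0 + s * n.+1%:R^-1, y0) @[n --> \oo] --> u (x0, y0).
  apply: (@cvg_comp _ _ _ (fun n => (x0 + s * n.+1%:R^-1, y0)) u _
    (nbhs (x0, y0)) _ v2).
  exact: cu.
apply: (cvg_unique _ c1) => //=.
have -> : (fun n : nat => u (x0 + s * n.+1%:R^-1, y0)) = _ := funext uE.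
by apply: cvgD; [apply: cvgM; [exact: cvg_cst|exact: v]|exact: cvg_cst].
Qed.

(** Continuity across the two interfaces determines q1 and q3 from q2. Each kink
    coefficient is half of the jump of the slope. *)
Lemma kinked_form (u : plane -> R) (p1 p2 p3 ga q1 q2 q3 : R) :
  (forall z, Omega z -> {for z, continuous u}) ->
  (forall z, omega1 z -> u z = p1 * z.1 + ga * z.2 + q1) ->
  (forall z, omega2 z -> u z = p2 * z.1 + ga * z.2 + q2) ->
  (forall z, omega3 z -> u z = p3 * z.1 + ga * z.2 + q3) ->
  forall z, Omega z -> u z =
    kinked (q2 - (p2 - p1) / 4 - (p3 - p2) / 4) ((p1 + p3) / 2) ga
      ((p2 - p1) / 2) ((p3 - p2) / 2) z.
Proof.
move=> cu u1 u2 u3.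
have e n : 0 < (n.+1%:R : R)^-1 <= 1.
  by rewrite invr_gt0 ltr0n/= invf_le1// ler1n.
have L1 (y : R) : - 2^-1 < y < 2^-1 ->
   u (- 2^-1, y) = p1 * - 2^-1 + (ga * y + q1) /\
   u (- 2^-1, y) = p2 * - 2^-1 + (ga * y + q2).
  move=> hy; have hz : Omega (- 2^-1, y).
    by apply/rect_in; split => //; apply/andP; split; lra.
  split.
    apply: (@side_limit u (- 2^-1) y (- 4^-1) _ _ (cu _ hz)) => n.
    rewrite u1 /= ?addrA//; apply/rect_in; split => //.
    by move: (e n); move: (n.+1%:R^-1) => t /andP[? ?]; apply/andP; split; lra.
  apply: (@side_limit u (- 2^-1) y (4^-1) _ _ (cu _ hz)) => n.
  rewrite u2 /= ?addrA//; apply/rect_in; split => //.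
  by move: (e n); move: (n.+1%:R^-1) => t /andP[? ?]; apply/andP; split; lra.
have L2 (y : R) : - 2^-1 < y < 2^-1 ->
   u (2^-1, y) = p2 * 2^-1 + (ga * y + q2) /\
   u (2^-1, y) = p3 * 2^-1 + (ga * y + q3).
  move=> hy; have hz : Omega (2^-1, y).
    by apply/rect_in; split => //; apply/andP; split; lra.
  split.
    apply: (@side_limit u (2^-1) y (- 4^-1) _ _ (cu _ hz)) => n.
    rewrite u2 /= ?addrA//; apply/rect_in; split => //.
    by move: (e n); move: (n.+1%:R^-1) => t /andP[? ?]; apply/andP; split; lra.
  apply: (@side_limit u (2^-1) y (4^-1) _ _ (cu _ hz)) => n.
  rewrite u3 /= ?addrA//; apply/rect_in; split => //.
  by move: (e n); move: (n.+1%:R^-1) => t /andP[? ?]; apply/andP; split; lra.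
have [|l1 l1'] := L1 0; first by apply/andP; split; lra.
have [|l2 l2'] := L2 0; first by apply/andP; split; lra.
move=> [x y] /rect_in[/andP[x1 x2] hy]; rewrite /kinked /=.
have [h1|h1|h1] := ltgtP x (- 2^-1).
- rewrite u1/=; last by apply/rect_in; split => //; apply/andP; split.
  rewrite !ltr0_norm; [|lra..]; nra.
- have [h2|h2|h2] := ltgtP x (2^-1).
  + rewrite u2/=; last by apply/rect_in; split => //; apply/andP; split.
    rewrite gtr0_norm ?ltr0_norm; [|lra..]; nra.
  + rewrite u3/=; last by apply/rect_in; split => //; apply/andP; split.
    rewrite !gtr0_norm; [|lra..]; nra.
  + rewrite h2 (L2 y hy).1 subrr normr0 gtr0_norm; [|lra]; nra.
- rewrite h1 (L1 y hy).2 addNr normr0 ltr0_norm; [|lra]; nra.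
Qed.

Lemma kinked_slope (p1 p2 p3 ga x y : R) :
  let k := kinked_partial ((p1 + p3) / 2) ga ((p2 - p1) / 2) ((p3 - p2) / 2) in
  [/\ x < - 2^-1 -> k ord0 (x, y) = p1,
      - 2^-1 < x < 2^-1 -> k ord0 (x, y) = p2,
      2^-1 < x -> k ord0 (x, y) = p3 & k ord_max (x, y) = ga].
Proof.
rewrite /kinked_partial /=; split => //.
- by move=> h; rewrite !ltr0_sg; [field|lra..].
- by move=> /andP[h1 h2]; rewrite gtr0_sg ?ltr0_sg; [field|lra..].
- by move=> h; rewrite !gtr0_sg; [field|lra..].
Qed.

Lemma ae_vertical_line (r : R) : {ae leb2, forall z : mplane, z.1 != r}.
Proof.
exists ([set r] `*` setT); split.
- by apply: measurableX => //; exact: measurable_set1.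
- rewrite product_measure1E//.
  by rewrite /= lebesgue_measure_set1 mul0e.
- by move=> [x y] /= /negP; rewrite negbK => /eqP ->.
Qed.

End PiecewiseAffine.

Section EnergyGap.
Context {R : realType}.

(** The gap before integration. Here (a0, x0; a1, x1) is the gradient of the
    laminate, the g's are the entries of the gradient of the perturbation, W
    is its first component, s is -1, 0 or 1 according to the strip and X is
    the first coordinate. The second and third summands have integral zero,
    the fourth a nonnegative one. What remains is coercive: Young's inequality
    with weight 53/25 splits the product of W and g11, and both
    |d| (1/4 + 53/225) and |d| (1/4 + 25/106) stay below 999/1000. *)
Lemma pointwise_gap (d s X W a0 a1 x0 x1 b0 b1 g00 g01 g10 g11 : R) :
  `|d| <= 41 / 20 -> `|s - X| <= 2^-1 ->
  2 * a0 + d * s * x1 = 2 * b0 -> 2 * a1 - d * s * x0 = 2 * b1 ->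
  (a0 + g00) * (x1 + g11) - (x0 + g01) * (a1 + g10) = a0 * x1 - x0 * a1 ->
  (a0 ^+ 2 + x0 ^+ 2 + a1 ^+ 2 + x1 ^+ 2) +
  (2 * b0 * g00 + 2 * b1 * g10 +
    (2 * x0 - d * s * a1) * g01 + (2 * x1 + d * s * a0) * g11) +
  (d * (W * g11) + g00 * ((0 + d * X) * g11) - g01 * ((0 + d * X) * g10)) +
  `|d| * (53 / 50) * (2 / 9 * g01 ^+ 2 - W ^+ 2) +
  1000^-1 * (g00 ^+ 2 + g01 ^+ 2 + g10 ^+ 2 + g11 ^+ 2) <=
  (a0 + g00) ^+ 2 + (x0 + g01) ^+ 2 + (a1 + g10) ^+ 2 + (x1 + g11) ^+ 2.
Proof.
move=> d2 sX e0 e1 hdet.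
set N := g00 ^+ 2 + g01 ^+ 2 + g10 ^+ 2 + g11 ^+ 2.
set J := g00 * g11 - g01 * g10.
have N0 : 0 <= N by rewrite /N !addr_ge0 ?sqr_ge0.
have JN : `|J| <= N / 2.
  have h1 := sqr_ge0 (g00 + g11); have h2 := sqr_ge0 (g00 - g11).
  have h3 := sqr_ge0 (g01 + g10); have h4 := sqr_ge0 (g01 - g10).
  rewrite ler_norml /J /N; apply/andP; split; nra.
have d0 : 0 <= `|d| by [].
have T1 : - (`|d| / 4 * N) <= d * (s - X) * J.
  have : `|d * (s - X) * J| <= `|d| / 4 * N.
    rewrite !normrM (_ : `|d| / 4 * N = `|d| * 2^-1 * (N / 2)); last by field.
    by apply: ler_pM => //; apply: ler_wpM2l.
  by rewrite ler_norml => /andP[].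
have T2 : - (`|d| * (53 / 50) * W ^+ 2 + `|d| * (25 / 106) * g11 ^+ 2) <=
    - (d * (W * g11)).
  rewrite lerN2; apply: (le_trans (ler_norm _)); rewrite !normrM.
  rewrite -!mulrA -mulrDr ler_wpM2l//.
  rewrite -(real_normK (num_real W)) -(real_normK (num_real g11)).
  have := sqr_ge0 (53 * `|W| - 25 * `|g11|).
  by rewrite -subr_ge0 => h; nra.
have T3 : 1000^-1 * N + `|d| / 4 * N + `|d| * (53 / 50) * (2 / 9) * g01 ^+ 2 +
    `|d| * (25 / 106) * g11 ^+ 2 <= N.
  have q1 := sqr_ge0 g00; have q2 := sqr_ge0 g01.
  have q3 := sqr_ge0 g10; have q4 := sqr_ge0 g11.
  have r1 : `|d| * g01 ^+ 2 <= 41 / 20 * g01 ^+ 2 by exact: ler_wpM2r.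
  have r2 : `|d| * g11 ^+ 2 <= 41 / 20 * g11 ^+ 2 by exact: ler_wpM2r.
  have r3 : `|d| * N <= 41 / 20 * N by exact: ler_wpM2r.
  have NE : N = g00 ^+ 2 + g01 ^+ 2 + g10 ^+ 2 + g11 ^+ 2 by [].
  lra.
rewrite -subr_ge0.
(* The constraint hdet enters with the factor d s, as a Lagrange multiplier. *)
have -> : (a0 + g00) ^+ 2 + (x0 + g01) ^+ 2 + (a1 + g10) ^+ 2 + (x1 + g11) ^+ 2 -
 (a0 ^+ 2 + x0 ^+ 2 + a1 ^+ 2 + x1 ^+ 2 +
  (2 * b0 * g00 + 2 * b1 * g10 + (2 * x0 - d * s * a1) * g01 +
   (2 * x1 + d * s * a0) * g11) +
  (d * (W * g11) + g00 * ((0 + d * X) * g11) - g01 * ((0 + d * X) * g10)) +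
  `|d| * (53 / 50) * (2 / 9 * g01 ^+ 2 - W ^+ 2) + 1000^-1 * N) =
 (N - 1000^-1 * N + `|d| * (53 / 50) * (W ^+ 2 - 2 / 9 * g01 ^+ 2) +
  d * (s - X) * J - d * (W * g11)) -
 (d * s) * ((a0 + g00) * (x1 + g11) - (x0 + g01) * (a1 + g10) - (a0 * x1 - x0 * a1)).
  by rewrite -e0 -e1 /N /J; ring.
rewrite hdet subrr mulr0 subr0.
by move: T1 T2 T3; lra.
Qed.

End EnergyGap.

Section IntegratedGap.
Context {R : realType}.
Notation plane := (R * R)%type.
Notation mplane := (measurableTypeR R * measurableTypeR R)%type.
Notation leb1 := (@lebesgue_measure R).
Notation leb2 := (leb1 \x leb1)%E.
Notation D := (@Omega R).
Let mD : measurable (D : set mplane) := rect_measurable _ _ _ _.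
Let Dfin : (leb2 (D : set mplane) < +oo)%E := rect_fin _ _ _ _.
Notation "'L2" := (@sqitg _ mplane R leb2 D).
Notation itg2 := (@itg _ mplane R leb2 D).
Notation I f := (Rintegral leb2 D f).
Notation o0 := (ord0 : 'I_2).
Notation o1 := (ord_max : 'I_2).

(** One value on each of the three strips, and 0 on the lines between them. *)
Definition strip_fun (e1 e2 e3 x : R) : R :=
  e1 * \1_(`]-1, - 2^-1[%classic) x + e2 * \1_(`]- 2^-1, 2^-1[%classic) x +
  e3 * \1_(`]2^-1, 1[%classic) x.

Lemma strip_fun_val (e1 e2 e3 x : R) : -1 < x < 1 ->
  [/\ x < - 2^-1 -> strip_fun e1 e2 e3 x = e1,
      - 2^-1 < x < 2^-1 -> strip_fun e1 e2 e3 x = e2 &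
      2^-1 < x -> strip_fun e1 e2 e3 x = e3].
Proof.
move=> /andP[x1 x2].
have in1 (r s : R) : r < x < s -> \1_(`]r, s[%classic) x = 1 :> R.
  by move=> h; rewrite indicE mem_set//= in_itv.
have out (r s : R) : ~ (r < x < s) -> \1_(`]r, s[%classic) x = 0 :> R.
  by move=> h; rewrite indicE memNset//= in_itv.
rewrite /strip_fun; split => h.
- rewrite in1 ?x1// !out; first by rewrite !mulr0 !addr0 mulr1.
  + by move=> /andP[? ?]; lra.
  + by move=> /andP[? ?]; lra.
- rewrite (in1 _ _ h) !out; first by rewrite !mulr0 addr0 add0r mulr1.
  + by move: h => /andP[? ?] /andP[? ?]; lra.
  + by move: h => /andP[? ?] /andP[? ?]; lra.
- rewrite (in1 2^-1) ?h// !out; first by rewrite !mulr0 !add0r mulr1.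
  + by move=> /andP[? ?]; lra.
  + by move=> /andP[? ?]; lra.
Qed.

Lemma indic_sqitg (r s : R) (g : plane -> R) : 'L2 g ->
  itg2 (fun z => \1_(`]r, s[%classic) z.1 * g z).
Proof.
move=> Lg; apply: (sqitg_itg mD Dfin); apply: (@sqitgMb _ _ _ _ _ mD _ _ 1 Lg).
  apply: measurableT_comp => //.
  by apply: measurable_funS (measurableT) _ (@measurable_fst _ _ _ _).
by move=> z _; rewrite indicE; case: (_ \in _); rewrite ?normr1 ?normr0.
Qed.

Lemma zero_trace_strips (w : plane -> R) (G : 'I_2 -> plane -> R) (e1 e2 e3 : R) :
  zero_trace (-1) 1 (- 2^-1) 2^-1 w G ->
  itg2 (fun z => strip_fun e1 e2 e3 z.1 * G o1 z) /\
  I (fun z => strip_fun e1 e2 e3 z.1 * G o1 z) = 0.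
Proof.
move=> Hw; have [_ LG _] := Hw.
have E : (fun z : plane => strip_fun e1 e2 e3 z.1 * G o1 z) =
  (fun z => e1 * (\1_(`]-1, - 2^-1[%classic) z.1 * G o1 z) +
    e2 * (\1_(`]- 2^-1, 2^-1[%classic) z.1 * G o1 z) +
    e3 * (\1_(`]2^-1, 1[%classic) z.1 * G o1 z)).
  by apply/funext => z; rewrite /strip_fun; ring.
have i1 := itgZ mD e1 (indic_sqitg (-1) (- 2^-1) (LG o1)).
have i2 := itgZ mD e2 (indic_sqitg (- 2^-1) (2^-1) (LG o1)).
have i3 := itgZ mD e3 (indic_sqitg (2^-1) 1 (LG o1)).
rewrite E; split; first exact: (itgD mD (itgD mD i1 i2) i3).
rewrite (RintegralD mD (itgD mD i1 i2) i3) (RintegralD mD i1 i2).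
rewrite !RintegralZl//; [|exact: indic_sqitg..].
by rewrite !(zero_trace_strip _ _ Hw) ?mulr0 ?addr0//; lra.
Qed.

Definition sqsum (v : 'I_2 -> 'I_2 -> plane -> R) (z : plane) : R :=
  (v o0 o0 z) ^+ 2 + (v o0 o1 z) ^+ 2 + (v o1 o0 z) ^+ 2 + (v o1 o1 z) ^+ 2.

Lemma sqsum_itg v : (forall k j, 'L2 (v k j)) -> itg2 (sqsum v).
Proof.
move=> Lv; apply: (itgD mD); last exact: sqitg_itg2.
apply: (itgD mD); last exact: sqitg_itg2.
by apply: (itgD mD); exact: sqitg_itg2.
Qed.

(** Integration of [pointwise_gap] over the strip, with p the gradient of the
    laminate, q that of a competitor and W the difference of the two maps. The
    conditions on 2 a_i are the jump conditions; they make the coefficients of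
    the first column of q - p constant. *)
Lemma integrated_gap (d : R) (a1 a2 a3 x : 'I_2 -> R)
    (p q : 'I_2 -> 'I_2 -> plane -> R) (W : 'I_2 -> plane -> R) :
  `|d| <= 41 / 20 ->
  2 * a2 o0 - 2 * a1 o0 = - (d * x o1) -> 2 * a3 o0 - 2 * a2 o0 = - (d * x o1) ->
  2 * a2 o1 - 2 * a1 o1 = d * x o0 -> 2 * a3 o1 - 2 * a2 o1 = d * x o0 ->
  (forall k j, 'L2 (p k j)) ->
  (forall k, zero_trace (-1) 1 (- 2^-1) 2^-1 (W k) (fun j z => q k j z - p k j z)) ->
  {ae leb2, forall z : mplane, D z -> forall k,
    [/\ z.1 < - 2^-1 -> p k o0 z = a1 k, - 2^-1 < z.1 < 2^-1 -> p k o0 z = a2 k,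
        2^-1 < z.1 -> p k o0 z = a3 k & p k o1 z = x k]} ->
  {ae leb2, forall z : mplane, D z ->
    q o0 o0 z * q o1 o1 z - q o0 o1 z * q o1 o0 z =
    p o0 o0 z * p o1 o1 z - p o0 o1 z * p o1 o0 z} ->
  (forall k j, 'L2 (q k j)) /\
  I (sqsum p) + 1000^-1 * I (sqsum (fun k j z => q k j z - p k j z)) <=
  I (sqsum q).
Proof.
move=> d2 j0 j0' j1 j1' Lp zt hp hdet.
pose G k j z := q k j z - p k j z.
have LG k j : 'L2 (G k j) by have [_ h _] := zt k; exact: h.
have LW k : 'L2 (W k) by have [h _ _] := zt k.
have Lq k j : 'L2 (q k j).
  apply: eq_sqitg (sqitgD mD (LG k j) (Lp k j)) => z _.
  by rewrite /G subrK.
split=> //.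
have ip := sqsum_itg Lp; have iq := sqsum_itg Lq; have iG := sqsum_itg LG.
have lt11 : (-1 : R) < 1 by lra.
have ltc : - (2^-1 : R) < 2^-1 by lra.
(* The part linear in the perturbation: the coefficients of its first column
   are constant, those of its second column jump between the strips, where
   the multiplier takes the values - d, 0 and d. *)
pose s01 := strip_fun (2 * x o0 - d * -1 * a1 o1) (2 * x o0 - d * 0 * a2 o1)
  (2 * x o0 - d * 1 * a3 o1).
pose s11 := strip_fun (2 * x o1 + d * -1 * a1 o0) (2 * x o1 + d * 0 * a2 o0)
  (2 * x o1 + d * 1 * a3 o0).
pose Lin z := 2 * a2 o0 * G o0 o0 z + 2 * a2 o1 * G o1 o0 z +
  s01 z.1 * G o0 o1 z + s11 z.1 * G o1 o1 z.
have [iLin ILin] : itg2 Lin /\ I Lin = 0.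
  have i1 := itgZ mD (2 * a2 o0) (sqitg_itg mD Dfin (LG o0 o0)).
  have i2 := itgZ mD (2 * a2 o1) (sqitg_itg mD Dfin (LG o1 o0)).
  have [i3 I3] := zero_trace_strips (2 * x o0 - d * -1 * a1 o1)
    (2 * x o0 - d * 0 * a2 o1) (2 * x o0 - d * 1 * a3 o1) (zt o0).
  have [i4 I4] := zero_trace_strips (2 * x o1 + d * -1 * a1 o0)
    (2 * x o1 + d * 0 * a2 o0) (2 * x o1 + d * 1 * a3 o0) (zt o1).
  have i12 := itgD mD i1 i2; have i123 := itgD mD i12 i3.
  split; first exact: (itgD mD i123 i4).
  rewrite /Lin (RintegralD mD i123 i4) (RintegralD mD i12 i3) (RintegralD mD i1 i2).
  rewrite I3 I4 (RintegralZl _ mD (sqitg_itg mD Dfin (LG o0 o0))).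
  rewrite (RintegralZl _ mD (sqitg_itg mD Dfin (LG o1 o0))).
  have z1 : I (G o0 o0) = 0 by exact: (zero_trace_grad lt11 ltc o0 (zt o0)).
  have z2 : I (G o1 o0) = 0 by exact: (zero_trace_grad lt11 ltc o0 (zt o1)).
  by rewrite z1 z2 !mulr0 !addr0.
(* The affine part d x of the multiplier. *)
pose Jac z := d * (W o0 z * G o1 o1 z) + G o0 o0 z * ((0 + d * z.1) * G o1 o1 z) -
  G o0 o1 z * ((0 + d * z.1) * G o1 o0 z).
have cs : continuous (fun z : plane => 0 + d * z.1).
  by apply: C1_continuous; exact: (affine_C1 0 d).1.
have [iJac IJac] : itg2 Jac /\ I Jac = 0.
  have i0 := sqitgM mD (LW o0) (LG o1 o1).
  have i1 := itgZ mD d i0.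
  have i2 := sqitgM mD (LG o0 o0) (sqitg_contM cs (LG o1 o1)).
  have i3 := sqitgM mD (LG o0 o1) (sqitg_contM cs (LG o1 o0)).
  have i12 := itgD mD i1 i2.
  split; first exact: (itgB mD i12 i3).
  rewrite /Jac (RintegralB mD i12 i3) (RintegralD mD i1 i2) (RintegralZl _ mD i0).
  exact: (zero_trace_jacobian lt11 ltc 0 d (zt o0) (zt o1)).
(* The Poincare inequality, multiplied by |d| and by half of the Young weight. *)
pose Sq z := `|d| * (53 / 50) * (2 / 9 * (G o0 o1 z) ^+ 2 - (W o0 z) ^+ 2).
have [iSq ISq] : itg2 Sq /\ 0 <= I Sq.
  have i1 := sqitg_itg2 (LG o0 o1); have i2 := sqitg_itg2 (LW o0).
  have i12 := itgB mD (itgZ mD (2 / 9) i1) i2.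
  split; first exact: (itgZ mD _ i12).
  rewrite /Sq (RintegralZl _ mD i12) (RintegralB mD (itgZ mD (2 / 9) i1) i2).
  rewrite (RintegralZl _ mD i1); apply: mulr_ge0.
    by apply: mulr_ge0 => //; lra.
  have := Poincare lt11 (zt o0); rewrite -/(G o0) => P.
  have : 9 / 2 * I (fun z => (W o0 z) ^+ 2) <= I (fun z => (G o0 o1 z) ^+ 2) by exact: P.
  by clear; lra.
have i1 := itgD mD ip iLin; have i2 := itgD mD i1 iJac; have i3 := itgD mD i2 iSq.
have i4 := itgD mD i3 (itgZ mD 1000^-1 iG).
have iE := itgB mD iq i4.
have : 0 <= I (fun z => sqsum q z - (sqsum p z + Lin z + Jac z + Sq z +
    1000^-1 * sqsum G z)).
  apply: (ae_Rint_ge0 mD iE).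
  move: (ae_and (ae_and hp hdet) (ae_and (ae_vertical_line (- 2^-1)) (ae_vertical_line (2^-1)))).
  apply: ae_imply => -[X Y] [[hp' hdet'] [/= nX1 nX2]] Dz.
  move: hp' hdet' => /(_ Dz) hp' /(_ Dz) hdet'; set z := (X, Y) in hp' hdet' *.
  have [/= p01 p02 p03 p0x] := hp' o0; have [/= p11 p12 p13 p1x] := hp' o1.
  have X1 : -1 < X < 1 by case/rect_in: Dz.
  have [s1 s2 s3] := strip_fun_val (2 * x o0 - d * -1 * a1 o1)
    (2 * x o0 - d * 0 * a2 o1) (2 * x o0 - d * 1 * a3 o1) X1.
  have [t1 t2 t3] := strip_fun_val (2 * x o1 + d * -1 * a1 o0)
    (2 * x o1 + d * 0 * a2 o0) (2 * x o1 + d * 1 * a3 o0) X1.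
  have qE k j : q k j z = p k j z + G k j z by rewrite /G addrC subrK.
  rewrite subr_ge0 /sqsum /Lin /Jac /Sq /= !qE.
  rewrite !qE in hdet'.
  move: X1 => /andP[X1 X2].
  have [h|h|h] := ltgtP X (- 2^-1); last by rewrite h eqxx in nX1.
  - rewrite p0x p1x (p01 h) (p11 h) in hdet' *; rewrite /s01 /s11 (s1 h) (t1 h).
    apply: pointwise_gap => //.
    + by clear -X1 X2 h; rewrite ler_norml; apply/andP; split; lra.
    + by clear -j0; lra.
    + by clear -j1; lra.
  - have [h'|h'|h'] := ltgtP X (2^-1); last by rewrite h' eqxx in nX2.
    + have hh : - 2^-1 < X < 2^-1 by rewrite h h'.
      rewrite p0x p1x (p02 hh) (p12 hh) in hdet' *; rewrite /s01 /s11 (s2 hh) (t2 hh).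
      apply: pointwise_gap => //.
      * by clear -h h'; rewrite ler_norml; apply/andP; split; lra.
      * by ring.
      * by ring.
    + rewrite p0x p1x (p03 h') (p13 h') in hdet' *; rewrite /s01 /s11 (s3 h') (t3 h').
      apply: pointwise_gap => //.
      * by clear -X2 h'; rewrite ler_norml; apply/andP; split; lra.
      * by clear -j0'; lra.
      * by clear -j1'; lra.
rewrite (RintegralB mD iq i4) (RintegralD mD i3 (itgZ mD 1000^-1 iG)).
rewrite (RintegralD mD i2 iSq) (RintegralD mD i1 iJac) (RintegralD mD ip iLin).
rewrite (RintegralZl _ mD iG) ILin IJac.
by clear -ISq; lra.
Qed.

End IntegratedGap.

(** * The minimizer *)

Section Matrices.
Context {R : realType}.
Notation plane := (R * R)%type.
Notation mplane := (measurableTypeR R * measurableTypeR R)%type.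
Notation leb1 := (@lebesgue_measure R).
Notation leb2 := (leb1 \x leb1)%E.
Notation o0 := (@ord0 1).
Notation o1 := (@ord_max 1).

Lemma lift00 : lift ord0 ord0 = o1 :> 'I_2.
Proof. exact/val_inj. Qed.

Lemma ord2 (i : 'I_2) : i = o0 \/ i = o1.
Proof.
have [->|i0] := eqVneq i o0; [by left|right].
exact: ord2_neq0.
Qed.

Lemma det_mx22 (M : 'M[R]_2) : \det M = M o0 o0 * M o1 o1 - M o0 o1 * M o1 o0.
Proof.
rewrite (expand_det_row _ ord0) big_ord_recl big_ord1 /cofactor !det_mx11.
have l1 : lift o1 (0 : 'I_1) = o0 by exact/val_inj.
by rewrite !mxE !lift00 l1 /= expr0 expr1; ring.
Qed.

Lemma mulmx_e1 (A : 'M[R]_2) k : (A *m e1) k ord0 = A k o0.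
Proof. by rewrite -colE mxE. Qed.

Lemma mulmx_e2 (A : 'M[R]_2) k : (A *m e2) k ord0 = A k o1.
Proof. by rewrite -colE mxE. Qed.

Lemma mulJ (v : 'cV[R]_2) : (J *m v) o0 ord0 = - v o1 ord0 /\
  (J *m v) o1 ord0 = v o0 ord0.
Proof.
rewrite /J /e1 /e2 !trmx_delta !mul_delta_mx mulmxBl.
have E (i j : 'I_2) k : (delta_mx i j *m v : 'cV[R]_2) k ord0 = (k == i)%:R * v j ord0.
  rewrite mxE (bigD1 j)//= big1 => [|l lj]; last first.
    by rewrite mxE (negbTE lj) andbF mul0r.
  by rewrite mxE eqxx andbT addr0.
have S (M N : 'cV[R]_2) k : (M - N) k ord0 = M k ord0 - N k ord0 by rewrite !mxE.
have n01 : (o0 == o1) = false by [].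
have n10 : (o1 == o0) = false by [].
by split; rewrite S !E ?eqxx ?n01 ?n10 mul0r mul1r ?sub0r ?subr0.
Qed.

Lemma affine_component (A : 'M[R]_2) (b : 'cV[R]_2) (z : plane) k :
  (A *m vec z + b) k ord0 = A k o0 * z.1 + A k o1 * z.2 + b k ord0.
Proof. by rewrite !mxE big_ord_recl big_ord1 !mxE lift00. Qed.

Definition wpartial (u : plane -> 'cV[R]_2) (k j : 'I_2) : plane -> R :=
  weak_partial Omega j (component u k).

Lemma det_grad (u : plane -> 'cV[R]_2) z : \det (grad Omega u z) =
  wpartial u o0 o0 z * wpartial u o1 o1 z - wpartial u o0 o1 z * wpartial u o1 o0 z.
Proof. by rewrite det_mx22 !mxE. Qed.

Lemma frob_sq22 (M : 'M[R]_2) : frob_sq M =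
  (M o0 o0) ^+ 2 + (M o0 o1) ^+ 2 + (M o1 o0) ^+ 2 + (M o1 o1) ^+ 2.
Proof.
have E (f : 'I_2 -> R) : \sum_i f i = f o0 + f o1.
  by rewrite big_ord_recl big_ord1 lift00.
by rewrite /frob_sq !E addrA.
Qed.

Lemma frob_grad (u : plane -> 'cV[R]_2) z :
  frob_sq (grad Omega u z) = sqsum (wpartial u) z.
Proof.
by rewrite frob_sq22 !mxE.
Qed.

Definition energy (q : 'I_2 -> 'I_2 -> plane -> R) : R :=
  Rintegral leb2 Omega (sqsum q).

Lemma dirichlet_sqsum (u : plane -> 'cV[R]_2) :
  (forall k j, sqitg leb2 (Omega : set mplane) (wpartial u k j)) ->
  dirichlet Omega u = (energy (wpartial u))%:E.
Proof.
move=> Lu; rewrite /dirichlet; under eq_integral do rewrite frob_grad.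
rewrite /energy /Rintegral fineK//.
exact: (integrable_fin_num (rect_measurable _ _ _ _) (sqsum_itg Lu)).
Qed.

Lemma sq_le_sqsum (q : 'I_2 -> 'I_2 -> plane -> R) k z :
  (q k o1 z) ^+ 2 <= sqsum q z.
Proof.
rewrite /sqsum; have [->|->] := ord2 k.
  by rewrite -!addrA addrCA lerDl !addr_ge0 ?sqr_ge0.
by rewrite lerDr !addr_ge0 ?sqr_ge0.
Qed.

Lemma component_continuous (u : plane -> 'cV[R]_2) k :
  {within Omega, continuous u} ->
  forall z, Omega z -> {for z, continuous (component u k)}.
Proof.
have oO : open (Omega : set plane).
  apply: openI.
    apply: (open_comp (f := fst)); last exact: interval_open.
    by move=> p _; exact: cvg_fst.
  apply: (open_comp (f := snd)); last exact: interval_open.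
  by move=> p _; exact: cvg_snd.
rewrite (continuous_open_subspace u oO) => cu z Oz.
have cz := cu z (mem_set Oz).
exact: (continuous_comp cz (@coord_continuous _ _ _ k ord0 _)).
Qed.

(** Once the hypotheses on the matrices are written in entries, minimality and
    uniqueness both follow from [integrated_gap]. *)
Lemma laminate_minimizer (f1 f2 f3 : R) (xi : 'cV[R]_2) (A1 A2 A3 : 'M[R]_2)
    (u0 : plane -> 'cV[R]_2) :
  f2 = (f1 + f3) / 2 -> `|f2 - f1| < 41 / 20 ->
  A1 *m e2 = xi -> A2 *m e2 = xi -> A3 *m e2 = xi ->
  2 *: (A2 *m e1) - 2 *: (A1 *m e1) = (f2 - f1) *: (J *m xi) ->
  2 *: (A3 *m e1) - 2 *: (A2 *m e1) = (f3 - f2) *: (J *m xi) ->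
  {within Omega, continuous u0} ->
  affine_on omega1 A1 u0 -> affine_on omega2 A2 u0 -> affine_on omega3 A3 u0 ->
  let g := fun x : plane =>
    \det A1 * \1_omega1 x + \det A2 * \1_omega2 x + \det A3 * \1_omega3 x in
  is_the_global_minimizer (admissible u0 g) u0.
Proof.
move=> hf hd B1 B2 B3 J1 J2 cu0.
move=> [b1 u1] [b2 u2] [b3 u3] g.
set d := f2 - f1 in hd J1.
have d' : f3 - f2 = d by rewrite /d hf; field.
rewrite d' in J2.
have xiE k : [/\ A1 k ord_max = xi k ord0, A2 k ord_max = xi k ord0 &
    A3 k ord_max = xi k ord0].
  by rewrite -!mulmx_e2 B1 B2 B3.
have [Jx0 Jx1] := mulJ xi.
have entry (v w t : 'cV[R]_2) k : 2 *: v - 2 *: w = d *: t ->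
    2 * v k ord0 - 2 * w k ord0 = d * t k ord0.
  by move=> /matrixP/(_ k ord0); rewrite !mxE.
have := entry _ _ _ o0 J1; rewrite !mulmx_e1 Jx0 mulrN => j0.
have := entry _ _ _ o1 J1; rewrite !mulmx_e1 Jx1 => j1.
have := entry _ _ _ o0 J2; rewrite !mulmx_e1 Jx0 mulrN => j0'.
have := entry _ _ _ o1 J2; rewrite !mulmx_e1 Jx1 => j1'.
have lt11 : (-1 : R) < 1 by lra.
have ltc : - (2^-1 : R) < 2^-1 by lra.
pose k1 k := (A2 k o0 - A1 k o0) / 2; pose k2 k := (A3 k o0 - A2 k o0) / 2.
pose be k := (A1 k o0 + A3 k o0) / 2.
pose al k := b2 k ord0 - (A2 k o0 - A1 k o0) / 4 - (A3 k o0 - A2 k o0) / 4.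
pose V k := kinked_partial (be k) (xi k ord0) (k1 k) (k2 k).
(* u0 belongs to the class: its components are affine up to kinks on the two
   interfaces, so that their traces and weak derivatives are explicit. *)
have u0E k z : Omega z ->
    component u0 k z = kinked (al k) (be k) (xi k ord0) (k1 k) (k2 k) z.
  have [x1 x2 x3] := xiE k.
  apply: (@kinked_form _ (component u0 k) _ _ _ _ (b1 k ord0) _ (b3 k ord0)).
  - exact: component_continuous.
  - by move=> y /u1; rewrite /component => ->; rewrite affine_component x1.
  - by move=> y /u2; rewrite /component => ->; rewrite affine_component x2.
  - by move=> y /u3; rewrite /component => ->; rewrite affine_component x3.
have tr k := (kinked_trace lt11 ltc (u0E k)).1.
have wk k j := (kinked_trace lt11 ltc (u0E k)).2 j.
have H1u0 k : in_H1 Omega (component u0 k) by case: (tr k).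
have Lp k j : sqitg leb2 (Omega : set mplane) (wpartial u0 k j).
  by case: (H1_weak_partial j (H1u0 k)).
have pV k j : {ae leb2, forall z : mplane, Omega z -> wpartial u0 k j z = V k j z}.
  exact: (weak_partial_ae (H1_weak_partial j (H1u0 k)) (wk k j)).
have hp : {ae leb2, forall z : mplane, Omega z -> forall k,
    [/\ z.1 < - 2^-1 -> wpartial u0 k o0 z = A1 k o0,
        - 2^-1 < z.1 < 2^-1 -> wpartial u0 k o0 z = A2 k o0,
        2^-1 < z.1 -> wpartial u0 k o0 z = A3 k o0 & wpartial u0 k o1 z = xi k ord0]}.
  move: (ae_and (ae_and (pV o0 o0) (pV o0 o1)) (ae_and (pV o1 o0) (pV o1 o1))).
  apply: ae_imply => -[X Y] [[h00 h01] [h10 h11]] Oz k.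
  have [s1 s2 s3 s4] := kinked_slope (A1 k o0) (A2 k o0) (A3 k o0) (xi k ord0) X Y.
  by have [E|E] := ord2 k; rewrite E in s1 s2 s3 s4 *; rewrite ?h00 ?h01 ?h10 ?h11.
have hg : {ae leb2, forall z : mplane, Omega z ->
    \det (grad Omega u0 z) = g z}.
  move: (ae_and hp (ae_and (ae_vertical_line (- 2^-1)) (ae_vertical_line (2^-1)))).
  apply: ae_imply => -[X Y] [hz [/= nX1 nX2]] Oz.
  have [/= p01 p02 p03 p0x] := hz Oz o0; have [/= p11 p12 p13 p1x] := hz Oz o1.
  have [x10 x20 x30] := xiE o0; have [x11 x21 x31] := xiE o1.
  rewrite det_grad p0x p1x /g !det_mx22.
  have /rect_in[/andP[X1 X2] hY] := Oz.
  have one (r s : R) : r < X < s ->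
      \1_(rect r s (- 2^-1) 2^-1) (X, Y) = 1 :> R.
    by move=> h; rewrite indicE mem_set//; apply/rect_in.
  have zero (r s : R) : ~ (r < X < s) ->
      \1_(rect r s (- 2^-1) 2^-1) (X, Y) = 0 :> R.
    by move=> h; rewrite indicE memNset// => /rect_in[].
  have [h|h|h] := ltgtP X (- 2^-1); last by rewrite h eqxx in nX1.
  - rewrite /omega1 /omega2 /omega3 one ?X1// !zero ?p01 ?p11//.
    + by rewrite x10 x11 !mulr0 !addr0 mulr1.
    + by clear -h => /andP[? ?]; lra.
    + by clear -h => /andP[? ?]; lra.
  - have [h'|h'|h'] := ltgtP X (2^-1); last by rewrite h' eqxx in nX2.
    + have hh : - 2^-1 < X < 2^-1 by rewrite h h'.
      rewrite /omega1 /omega2 /omega3 (one (- 2^-1) 2^-1)// !zero ?p02 ?p12//.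
      * by rewrite x20 x21 !mulr0 addr0 add0r mulr1.
      * by clear -h' => /andP[? ?]; lra.
      * by clear -h => /andP[? ?]; lra.
    + rewrite /omega1 /omega2 /omega3 (one 2^-1 1) ?h'// !zero ?p03 ?p13//.
      * by rewrite x30 x31 !mulr0 !add0r mulr1.
      * by clear -h' => /andP[? ?]; lra.
      * by clear -h' => /andP[? ?]; lra.
(* The excess of energy controls the squared norm of the perturbed gradient. *)
have gap u : admissible u0 g u ->
  (forall k j, sqitg leb2 (Omega : set mplane) (wpartial u k j)) /\
  energy (wpartial u0) +
    1000^-1 * energy (fun k j z => wpartial u k j z - wpartial u0 k j z)
  <= energy (wpartial u) /\
  forall k, zero_trace (-1) 1 (- 2^-1) 2^-1
    (fun z => component u k z - component u0 k z)
    (fun j z => wpartial u k j z - wpartial u0 k j z).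
  move=> [uB uD].
  have zt k : zero_trace (-1) 1 (- 2^-1) 2^-1
    (fun z => component u k z - component u0 k z)
    (fun j z => wpartial u k j z - wpartial u0 k j z).
    have [_ [t [Tu Tu0]]] := uB k.
    exact: (same_trace_zero lt11 ltc Tu Tu0).
  have hdet : {ae leb2, forall z : mplane, Omega z ->
    wpartial u o0 o0 z * wpartial u o1 o1 z - wpartial u o0 o1 z * wpartial u o1 o0 z =
    wpartial u0 o0 o0 z * wpartial u0 o1 o1 z - wpartial u0 o0 o1 z * wpartial u0 o1 o0 z}.
    move: (ae_and uD hg); apply: ae_imply => z [h1 h2] Oz.
    by rewrite -!det_grad h1// h2.
  have [Lq G] := @integrated_gap _ d (fun k => A1 k o0) (fun k => A2 k o0)
    (fun k => A3 k o0) (fun k => xi k ord0) (wpartial u0) (wpartial u) _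
    (ltW hd) j0 j0' j1 j1' Lp zt hp hdet.
  by split.
have gap_le0 (a b e : R) : a + 1000^-1 * b <= e -> e = a -> b <= 0.
  by clear=> h ea; lra.
have G0 u : 0 <= energy (fun k j z => wpartial u k j z - wpartial u0 k j z).
  by apply: Rintegral_ge0 => z _; rewrite /sqsum !addr_ge0// sqr_ge0.
split.
- split=> //= k; split; first exact: H1u0.
  by exists (kinked (al k) (be k) (xi k ord0) (k1 k) (k2 k)); split; exact: tr.
- move=> u /gap[Lu [G _]]; rewrite (dirichlet_sqsum Lp) (dirichlet_sqsum Lu) lee_fin.
  apply: le_trans G; rewrite lerDl.
  by apply: mulr_ge0 (G0 u); rewrite invr_ge0 ler0n.
- move=> u /gap[Lu [G zt]]; rewrite (dirichlet_sqsum Lp) (dirichlet_sqsum Lu) => E0.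
  have E := EFin_inj E0.
  have mD := @rect_measurable R (-1) 1 (- 2^-1) 2^-1.
  have LG k j : sqitg leb2 (Omega : set mplane) (fun z => wpartial u k j z - wpartial u0 k j z).
    exact: (sqitgB mD (Lu k j) (Lp k j)).
  have GG : energy (fun k j z => wpartial u k j z - wpartial u0 k j z) <= 0.
    exact: (gap_le0 _ _ _ G E).
  (* The Poincare inequality for each component. *)
  have W0 k : {ae leb2, forall z : mplane, Omega z ->
      component u k z - component u0 k z = 0}.
    apply: (Rint_sq_eq0 mD); first by case: (zt k).
    have P := Poincare lt11 (zt k).
    have Gk : Rintegral leb2 Omega (fun z => (wpartial u k o1 z - wpartial u0 k o1 z) ^+ 2) <=
      energy (fun k j z => wpartial u k j z - wpartial u0 k j z).
      apply: (le_Rintegral mD (sqitg_itg2 (LG k o1)) (sqsum_itg LG)) => z _.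
      exact: (sq_le_sqsum (fun k j z => wpartial u k j z - wpartial u0 k j z) k z).
    have := le_trans P (le_trans Gk GG).
    by rewrite pmulr_rle0// divr_gt0.
  move: (ae_and (W0 o0) (W0 o1)); apply: ae_imply => z [h0 h1] Oz.
  apply/matrixP => k l; rewrite (ord1 l).
  by apply/eqP; rewrite -subr_eq0; have [->|->] := ord2 k; apply/eqP; [exact: h0|exact: h1].
Qed.

End Matrices.

Theorem mainTheorem3 (R : realType) :
  exists c : R, 2 < c /\
  forall (f1 f2 f3 : R) (xi eta : 'cV[R]_2) (A1 A2 A3 : 'M[R]_2)
         (u0 : R * R -> 'cV[R]_2),
    f2 = (f1 + f3) / 2 ->
    `|f2 - f1| < c ->
    A1 *m e2 = xi -> A2 *m e2 = xi -> A3 *m e2 = xi ->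
    A2 *m e1 = eta ->
    2 *: (A2 *m e1) - 2 *: (A1 *m e1) = (f2 - f1) *: (J *m xi) ->
    2 *: (A3 *m e1) - 2 *: (A2 *m e1) = (f3 - f2) *: (J *m xi) ->
    {within Omega, continuous u0} ->
    affine_on omega1 A1 u0 -> affine_on omega2 A2 u0 ->
    affine_on omega3 A3 u0 ->
    let g := fun x : R * R =>
      \det A1 * \1_omega1 x + \det A2 * \1_omega2 x + \det A3 * \1_omega3 x in
    is_the_global_minimizer (admissible u0 g) u0.
Proof.
exists (41 / 20); split; first by lra.
move=> f1 f2 f3 xi eta A1 A2 A3 u0 hf hd B1 B2 B3 _ J1 J2.
exact: (laminate_minimizer hf hd B1 B2 B3 J1 J2).
Qed.
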